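(* Let $\omega=(\omega_1,\omega_2)\in(\overline{\mathbb{Q}}^{\times})^2$ be a nontrivial torsion point, and let \[ P(\omega)=[\omega_2^{-1}-\omega_1^{-1}:1-\omega_2^{-1}:\omega_1^{-1}-1]\in\mathbb{P}^2(\overline{\mathbb{Q}}), \] which is the unique point of the intersection of the lines $x_0+x_1+x_2=0$ and $x_0+\omega_1^{-1}x_1+\omega_2^{-1}x_2=0$. Then \[ 0\le \mathrm{h}(P(\omega))\le\log(2). \] The lower bound is attained exactly when \[ \omega\in\{(1,\zeta),(\zeta,1),(\zeta,\zeta)\mid\zeta\in\mu_\infty\setminus\{1\}\}\cup\{(\zeta,\zeta^2)\mid\zeta\in\mu_3^\circ\}, \] whereas the upper bound is attained exactly when \[ \omega\in\{(-1,\zeta),(\zeta,-1),(\zeta,-\zeta)\mid\zeta\in\mu_\infty\text{ with }\mathrm{ord}(\zeta)\neq 2^k\text{ for all }k\ge0\}. \]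
   Context: $\overline{\mathbb{Q}}$ is an algebraic closure of $\mathbb{Q}$, $\mu_\infty\subset\overline{\mathbb{Q}}^\times$ is the group of all roots of unity, $\mu_3^\circ$ is the set of primitive third roots of unity, and $\mathrm{ord}(\zeta)$ is the order of $\zeta\in\mu_\infty$. A torsion point of $(\overline{\mathbb{Q}}^\times)^2$ is an element of $\mu_\infty^2$; it is nontrivial if it is different from $(1,1)$. The (canonical) height of $\xi=[\xi_0:\dots:\xi_n]\in\mathbb{P}^n(\overline{\mathbb{Q}})$ is \[ \mathrm{h}(\xi)=\sum_{v}\sum_{w\mid v}\frac{[K_w:\mathbb{Q}_v]}{[K:\mathbb{Q}]}\log\max(|\xi_0|_w,\dots,|\xi_n|_w), \] where $K$ is any number field containing all $\xi_i$, $v$ ranges over the places of $\mathbb{Q}$ (with the usual Archimedean absolute value and the usual $p$-adic absolute values), $w$ ranges over the places of $K$ above $v$, and $|\cdot|_w$ is the absolute value in the class of $w$ extending $|\cdot|_v$. It depends neither on $K$ nor on the choice of homogeneous coordinates. *)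

(* Defs.v *)
From HB Require Import structures.
From mathcomp Require Import all_boot all_order all_algebra all_field.
From mathcomp Require Import all_classical all_reals all_analysis.

Set Implicit Arguments.
Unset Strict Implicit.
Unset Printing Implicit Defensive.

Import Order.TTheory GRing.Theory Num.Theory.
Import numFieldNormedType.Exports.

Local Open Scope classical_set_scope.
Local Open Scope ring_scope.

(* Throughout, algC serves as the algebraic closure of the rationals. *)

Definition is_absolute_value (R : realType) (L : fieldType) (f : L -> R) : Prop :=
  [/\ forall x, 0 <= f x,
      forall x, f x = 0 <-> x = 0,
      forall x y, f (x * y) = f x * f y
    & forall x y, f (x + y) <= f x + f y].

(* None is the Archimedean place, Some p the p-adic one. *)
Definition rat_place := option {p : nat | prime p}.

Definition padic_abs (R : realType) (p : nat) (q : rat) : R :=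
  if q == 0 then 0
  else p%:R ^+ logn p `|denq q|%N / p%:R ^+ logn p `|numq q|%N.

Definition rat_abs (R : realType) (v : rat_place) (q : rat) : R :=
  match v with
  | None => `|ratr q|
  | Some p => padic_abs R (val p) q
  end.

(* A place w of K above v is encoded by its normalized representative |.|_w.
   This is faithful because two equivalent absolute values with the same
   nontrivial restriction to the rationals are equal. *)
Definition places_above (R : realType) (K : fieldExtType rat) (v : rat_place) :
    set (K -> R) :=
  [set w | is_absolute_value w /\ forall q : rat, w q%:A = rat_abs R v q].

Definition abs_complete (R : realType) (L : fieldType) (f : L -> R) : Prop :=
  forall u : nat -> L,
    (forall e : R, 0 < e -> exists N : nat, forall m n : nat,
       (N <= m)%N -> (N <= n)%N -> f (u m - u n) < e) ->
    exists l : L, (fun n => f (u n - l)) @ \oo --> (0 : R).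

Definition is_completion (R : realType) (K L : fieldType) (f : K -> R)
    (j : {rmorphism K -> L}) (g : L -> R) : Prop :=
  [/\ is_absolute_value g,
      forall x, g (j x) = f x,
      forall (y : L) (e : R), 0 < e -> exists x : K, g (y - j x) < e
    & abs_complete g].

Definition has_degree (F L : fieldType) (phi : {rmorphism F -> L}) (d : nat) :
    Prop :=
  exists e : 'I_d -> L, forall y : L,
    exists! c : 'rV[F]_d, y = \sum_(i < d) phi (c 0 i) * e i.

(* d = [K_w : Q_v], for any models Qv and Kw of the two completions; phi is the
   embedding of Qv in Kw which extends the inclusion of the rationals in K. *)
Definition is_local_degree (R : realType) (K : fieldExtType rat)
    (v : rat_place) (w : K -> R) (d : nat) : Prop :=
  exists (Qv Kw : fieldType)
    (jQ : {rmorphism rat -> Qv}) (absQv : Qv -> R)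
    (jK : {rmorphism K -> Kw}) (absKw : Kw -> R)
    (phi : {rmorphism Qv -> Kw}),
    [/\ is_completion (rat_abs R v) jQ absQv,
        is_completion w jK absKw,
        forall q : rat, phi (jQ q) = jK q%:A,
        forall y : Qv, absKw (phi y) = absQv y
      & has_degree phi d].

Definition local_degree (R : realType) (K : fieldExtType rat)
    (v : rat_place) (w : K -> R) : nat :=
  xget 0%N [set d | is_local_degree v w d].

(* Height of the projective point with homogeneous coordinates x in K. Both
   \sum_(_ \in _) are finitely supported sums: K has finitely many places above
   each v, and for x != 0 only finitely many v contribute. *)
Definition height (R : realType) (K : fieldExtType rat) (n : nat)
    (x : 'rV[K]_n.+1) : R :=
  \sum_(v \in [set: rat_place]) \sum_(w \in @places_above R K v)
    (local_degree v w)%:R / (\dim {:K})%:R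
      * ln (\big[Num.max/0]_(i < n.+1) w (x 0 i)).

(* Equality in projective space of the points with homogeneous coordinates
   x and y, both meant to be nonzero. *)
Definition proj_eq (F : fieldType) (n : nat) (x y : 'rV[F]_n.+1) : Prop :=
  exists2 c : F, c != 0 & y = c *: x.

Definition mu_infty : set algC :=
  [set z | exists2 n : nat, (0 < n)%N & z ^+ n = 1].

Definition P_point (omega : algC * algC) : 'rV[algC]_3 :=
  \row_(i < 3)
    [:: omega.2^-1 - omega.1^-1; 1 - omega.2^-1; omega.1^-1 - 1]`_i.

Definition on_lines (omega : algC * algC) (x : 'rV[algC]_3) : Prop :=
  x 0 0 + x 0 1 + x 0 2 = 0 /\
  x 0 0 + omega.1^-1 * x 0 1 + omega.2^-1 * x 0 2 = 0.

Definition lower_set : set (algC * algC) :=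
  [set omega |
    (exists2 z : algC, mu_infty z /\ z <> 1 &
       [\/ omega = (1, z), omega = (z, 1) | omega = (z, z)])
    \/ (exists2 z : algC, 3.-primitive_root z & omega = (z, z ^+ 2))].

(* n.-primitive_root z says that z has order exactly n. *)
Definition upper_set : set (algC * algC) :=
  [set omega |
    exists2 z : algC,
      mu_infty z /\ (forall n k : nat, n.-primitive_root z -> n <> (2 ^ k)%N) &
      [\/ omega = (-1, z), omega = (z, -1) | omega = (z, - z)]].

(* Main.v *)
(** Put a = omega_1^-1 and b = omega_2^-1. The coordinates b - a, 1 - b, a - 1 of
    P(omega) are differences of roots of unity, so their absolute values are at
    most 2 at the Archimedean places and at most 1 at the others; as the heights
    of x and c x agree by the product formula, h <= log 2. Equality forces two of
    the points 1, a, b of the unit circle to be antipodal (look at one complex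
    place), and then the coordinates are 2, 1 - z, 1 + z up to roots of unity;
    at a place above 2 they are all small exactly when the order of z is a power
    of 2. Normalizing a coordinate to 1 gives h >= 0, and h = 0 forces the
    triangle 1, a, b to be equilateral or degenerate. The field K of the given
    coordinates contains a and b in the nondegenerate case: it contains
    r = (1 - b) / (a - 1), hence also the complex conjugate r' of r because
    cyclotomic fields are abelian, and b = (1 + r) / (1 + r').

    The product formula for K follows from the one for the rationals and from
    sum_(w | v) [K_w : Q_v] log |z|_w = log |N(z)|_v. For the latter, places are
    obtained as minimal submultiplicative seminorms (by Zorn's lemma), which
    gives |N(z)|_v <= max_w |z|_w ^ [K : Q]; in particular |N(z)|_v is determined
    up to a bounded factor by the |z|_w. For each w there are t in K close to a
    rational q at w and close to 1 at the other places above v, with |N(t)|_v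
    close to |q|_v ^ [K_w : Q_v]; they approximate the idempotent of K (x) Q_v
    attached to w. Comparing high powers of z with products of such t yields
    the formula. *)

Require Import Defs.
From HB Require Import structures.
From mathcomp Require Import all_boot all_order all_algebra all_field.
From mathcomp Require Import all_classical all_reals all_analysis.
From mathcomp Require Import fingroup perm complex integral_char finmap ring lra.
Import Order.TTheory GRing.Theory Num.Theory.
Import numFieldNormedType.Exports.
Set Implicit Arguments.
Unset Strict Implicit.
Unset Printing Implicit Defensive.
Local Open Scope classical_set_scope.
Local Open Scope ring_scope.

(** * Absolute values and submultiplicative seminorms *)

(** The field [K] and the coordinates are arbitrary, and invariance of the height under enlarging
    [K] is not established. Hence [a] and [b] must be found inside [K] before places of [K] can be
    evaluated at them. When two of [1], [a], [b] coincide they may lie outside [K], but then the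
    point is rational.

    The local norm formula, applied to a rational [q] with [|q|_v > 1], shows that the weights
    [K_w : Q_v] / [K : Q], which are positive, have sum 1 above each [v]. A local height is thus a
    weighted mean of the logarithms [ln (coord_max w x)], and a strict inequality at a single place
    makes it strict; this is why one well chosen place decides the equality cases.

    Seminorms give the Archimedean and the p-adic places at once, without extending valuations by
    Hensel's lemma. The norm estimate they provide is lossy, but the loss is harmless: a quantity
    linear in an exponent [k] and bounded independently of [k] vanishes. *)

Section AbsoluteValue.
Variables (R : realType) (F : fieldType) (f : F -> R).
Hypothesis Hf : is_absolute_value f.

Lemma abs_ge0 x : 0 <= f x. Proof. by case: Hf. Qed.

Lemma abs_eq0 x : (f x == 0) = (x == 0).
Proof. by case: Hf => _ H _ _; apply/eqP/eqP => /H. Qed.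

Lemma abs0 : f 0 = 0. Proof. by apply/eqP; rewrite abs_eq0. Qed.

Lemma abs_gt0 x : (0 < f x) = (x != 0).
Proof. by rewrite lt0r abs_eq0 abs_ge0 andbT. Qed.

Lemma absM x y : f (x * y) = f x * f y. Proof. by case: Hf. Qed.

Lemma absD x y : f (x + y) <= f x + f y. Proof. by case: Hf. Qed.

Lemma abs1 : f 1 = 1.
Proof.
have h1 : f 1 != 0 by rewrite abs_eq0 oner_eq0.
by apply: (mulfI h1); rewrite -absM !mulr1.
Qed.

Lemma absX x n : f (x ^+ n) = f x ^+ n.
Proof. by elim: n => [|n IH]; rewrite ?abs1 // !exprS absM IH. Qed.

Lemma abs_root_of_unity x n : (0 < n)%N -> x ^+ n = 1 -> f x = 1.
Proof.
move=> n0 xn; apply/eqP; rewrite -(@pexpr_eq1 _ _ n) ?abs_ge0 //.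
by rewrite -absX xn abs1.
Qed.

Lemma absN x : f (- x) = f x.
Proof.
suff h : f (-1) = 1 by rewrite -mulN1r absM h mul1r.
by apply: (@abs_root_of_unity _ 2) => //; rewrite sqrrN expr1n.
Qed.

Lemma abs_distC x y : f (x - y) = f (y - x).
Proof. by rewrite -absN opprB. Qed.

Lemma absB x y : f (x - y) <= f x + f y.
Proof. by rewrite (le_trans (absD _ _)) ?absN. Qed.

Lemma absV x : f x^-1 = (f x)^-1.
Proof.
have [->|x0] := eqVneq x 0; first by rewrite invr0 abs0 invr0.
have fx : f x != 0 by rewrite abs_eq0.
by apply: (mulfI fx); rewrite -absM !divff // abs1.
Qed.

Lemma abs_div x y : f (x / y) = f x / f y.
Proof. by rewrite absM absV. Qed.

Lemma abs_dist x y : `|f x - f y| <= f (x - y).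
Proof.
have h1 := absD (x - y) y; have h2 := absD (y - x) x.
rewrite !subrK (abs_distC y x) in h1 h2.
by rewrite ler_norml; apply/andP; split; lra.
Qed.

Lemma abs_sum I (r : seq I) (P : pred I) (G : I -> F) :
  f (\sum_(i <- r | P i) G i) <= \sum_(i <- r | P i) f (G i).
Proof.
elim/big_rec2: _ => [|i y1 y2 _ h]; first by rewrite abs0.
by apply: (le_trans (absD _ _)); rewrite lerD2l.
Qed.

Lemma abs_prod I (r : seq I) (P : pred I) (G : I -> F) :
  f (\prod_(i <- r | P i) G i) = \prod_(i <- r | P i) f (G i).
Proof. exact: (big_morph _ absM abs1). Qed.

End AbsoluteValue.

(** The seminorms below are infima, accessible only through strict upper approximations [r], [s];
    this form and the next one turn those into bounds on the infima. *)
Lemma le_addP_gt (R : realFieldType) (a b c : R) :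
  (forall r s, a < r -> b < s -> c <= r + s) -> c <= a + b.
Proof.
move=> h; rewrite leNgt; apply/negP => lt.
pose d := (c - (a + b)) / 4.
have := h (a + d) (b + d); rewrite /d; lra.
Qed.

Lemma le_mulP_gt (R : realFieldType) (a b c : R) : 0 <= a -> 0 <= b ->
  (forall r s, a < r -> b < s -> c <= r * s) -> c <= a * b.
Proof.
move=> a0 b0 h; rewrite leNgt; apply/negP => lt.
(* For [d <= 1] and [d <= e], [(a + d) * (b + d) <= a * b + d * (a + b + 1)] exceeds [a * b] by at
   most half of the gap to [c]. *)
pose e := (c - a * b) / (2 * (a + b + 1)).
have e0 : 0 < e by rewrite /e divr_gt0; lra.
have eE : e * (2 * (a + b + 1)) = c - a * b by rewrite /e divfK //; lra.
pose d := Num.min 1 e.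
have d0 : 0 < d by rewrite lt_min ltr01 e0.
have d1 : d <= 1 by rewrite ge_min lexx.
have de : d <= e by rewrite ge_min lexx orbT.
have := h (a + d) (b + d).
have -> : a < a + d by lra.
have -> : b < b + d by lra.
move=> /(_ isT isT).
have : d * (a + b + 1) <= e * (a + b + 1) by rewrite ler_wpM2r //; lra.
nra.
Qed.

Section SubmultiplicativeSeminorm.
Variables (R : realType) (F : fieldType).
Implicit Types (p : F -> R).

(** Only [0 < p 1] is asked, not [p 1 = 1]: the starting point is a sum of absolute values of matrix
    entries, whose value at 1 is the size of the matrix. The spectral radius restores the
    normalization. *)
Definition submult p : Prop :=
  [/\ forall x, 0 <= p x,
      p 0 = 0, 0 < p 1,
      forall x y, p (x + y) <= p x + p y
    & forall x y, p (x * y) <= p x * p y].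

Lemma submultX p x k : submult p -> p (x ^+ k) <= p 1 * p x ^+ k.
Proof.
move=> [p0 p00 p1 pD pM]; elim: k => [|k IH]; first by rewrite mulr1.
rewrite !exprS (le_trans (pM _ _)) // mulrCA ler_wpM2l //.
Qed.

Lemma submultXS p x k : submult p -> p (x ^+ k.+1) <= p x ^+ k.+1.
Proof.
move=> [p0 p00 p1 pD pM]; elim: k => [|k IH]; first by rewrite !expr1.
by rewrite exprS (le_trans (pM _ _)) // (exprS (p x)) ler_wpM2l.
Qed.

Lemma submult_sum p I (r : seq I) (P : pred I) (G : I -> F) : submult p ->
  p (\sum_(i <- r | P i) G i) <= \sum_(i <- r | P i) p (G i).
Proof.
move=> [p0 p00 p1 pD pM].
elim/big_rec2: _ => [|i y1 y2 _ h]; first by rewrite p00.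
by apply: (le_trans (pD _ _)); rewrite lerD2l.
Qed.

Lemma submultMn p x n : submult p -> p (x *+ n) <= p x *+ n.
Proof.
move=> [p0 p00 p1 pD pM]; elim: n => [|n IH]; first by rewrite mulr0n p00.
by rewrite !mulrS (le_trans (pD _ _)) // lerD2l.
Qed.

(* The infimum of this set is the spectral radius [lim p(x^k)^(1/k)]; this
   description avoids k-th roots. *)
Definition spectral_bound p x : set R :=
  [set r | 0 <= r /\ exists C, forall k, p (x ^+ k) <= C * r ^+ k].

Definition spectral p x : R := inf (spectral_bound p x).

Section Spectral.
Variable p : F -> R.
Hypothesis Hp : submult p.

Lemma spectral_bound_self x : spectral_bound p x (p x).
Proof.
case: (Hp) => p0 _ _ _ _; split => //; exists (p 1) => k.
exact: submultX.
Qed.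

Lemma spectral_ge0 x : 0 <= spectral p x.
Proof.
apply: lb_le_inf; first by exists (p x); exact: spectral_bound_self.
by move=> r [].
Qed.

Lemma spectral_le x r : spectral_bound p x r -> spectral p x <= r.
Proof. by apply: ge_inf; exists 0 => s []. Qed.

Lemma spectral_lt x r : spectral p x < r ->
  exists2 s, spectral_bound p x s & s < r.
Proof. by apply: inf_lt; exists (p x); exact: spectral_bound_self. Qed.

Lemma spectral_le_self x : spectral p x <= p x.
Proof. exact/spectral_le/spectral_bound_self. Qed.

Lemma spectral_bound_ge (r C s : R) : 0 < s -> 0 <= r ->
  (forall k, s ^+ k <= C * r ^+ k) -> s <= r.
Proof.
move=> s0 r0 h; rewrite leNgt; apply/negP => rs.
have C0 : 0 < C by have := h 0; rewrite !expr0 mulr1; lra.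
pose t := (s - r) / (C * (r + 1)).
have [r00|rn0] := eqVneq r 0.
  by have := h 1%N; rewrite r00 !expr1 mulr0; lra.
have rp : 0 < r by rewrite lt0r rn0.
pose q := s / r.
have q1 : 0 < q - 1 by rewrite subr_gt0 /q ltr_pdivlMr // mul1r.
have hq k : 1 + (q - 1) *+ k <= q ^+ k.
  elim: k => [|k IH]; first by rewrite mulr0n addr0.
  rewrite exprS; apply: (@le_trans _ _ (q * (1 + (q - 1) *+ k))); last first.
    by rewrite ler_wpM2l //; lra.
  have : 0 <= (q - 1) *+ k by rewrite mulrn_wge0 // ltW.
  rewrite mulrS; nra.
have hC k : q ^+ k <= C.
  by rewrite /q expr_div_n ler_pdivrMr ?exprn_gt0.
pose k := Num.bound (C / (q - 1)).
have := le_trans (hq k) (hC k).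
have : C / (q - 1) < k%:R by apply/archi_boundP; rewrite divr_ge0 // ltW.
rewrite ltr_pdivrMr // mulr_natl; lra.
Qed.

Lemma spectral_ge x s C : 0 < s ->
  (forall k, s ^+ k <= C * p (x ^+ k)) -> s <= spectral p x.
Proof.
move=> s0 h; apply: lb_le_inf; first by exists (p x); exact: spectral_bound_self.
move=> r [r0 [D hD]].
have C0 : 0 <= C.
  case: (Hp) => _ _ p1 _ _.
  have h1 := lt_le_trans ltr01 (h 0%N); rewrite expr0 in h1.
  by rewrite pmulr_lgt0 // in h1; exact: ltW.
apply: (@spectral_bound_ge r (C * D) s) => // k.
by rewrite (le_trans (h k)) // -mulrA ler_wpM2l.
Qed.

Lemma spectral1 : spectral p 1 = 1.
Proof.
case: (Hp) => p0 p00 p1 pD pM.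
apply/eqP; rewrite eq_le; apply/andP; split.
  apply: spectral_le; split => //; exists (p 1) => k.
  by rewrite !expr1n mulr1.
apply: (@spectral_ge _ _ (p 1)^-1) => // k.
by rewrite !expr1n mulVf // gt_eqF.
Qed.

(** [F] is commutative, so the binomial formula bounds [p ((x + y) ^+ k)] by [C * D * (r + s) ^+ k]
    whenever [C], [r] and [D], [s] control the powers of [x] and [y]. *)
Lemma spectral_submult : submult (spectral p).
Proof.
case: (Hp) => p0 p00 p1 pD pM.
split; [exact: spectral_ge0 | | by rewrite spectral1 | |].
- apply/eqP; rewrite eq_le spectral_ge0 andbT -p00; exact: spectral_le_self.
- move=> x y; apply: le_addP_gt => r s xr ys.
  have {xr} [r' [r0 [C hC]] lr] := spectral_lt xr.
  have {ys} [s' [s0 [D hD]] ls] := spectral_lt ys.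
  apply: (@le_trans _ _ (r' + s')); last by lra.
  apply: spectral_le; split; first exact: addr_ge0.
  exists (C * D) => k; rewrite !exprDn mulr_sumr.
  apply: (le_trans (submult_sum _ _ _ Hp)); apply: ler_sum => i _.
  apply: (le_trans (submultMn _ _ Hp)); rewrite mulrnAr lerMn2r; apply/orP; right.
  apply: (le_trans (pM _ _)); rewrite mulrACA.
  by apply: ler_pM.
- move=> x y; apply: le_mulP_gt => [||r s xr ys]; try exact: spectral_ge0.
  have {xr} [r' [r0 [C hC]] lr] := spectral_lt xr.
  have {ys} [s' [s0 [D hD]] ls] := spectral_lt ys.
  apply: (@le_trans _ _ (r' * s')); last by apply: ler_pM; rewrite // ltW.
  apply: spectral_le; split; first exact: mulr_ge0.
  exists (C * D) => k; rewrite !exprMn.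
  apply: (le_trans (pM _ _)); rewrite mulrACA.
  by apply: ler_pM.
Qed.

(** Control of the powers of [x ^+ m] gives control of all powers of [x], by Euclidean division of
    the exponent. *)
Lemma spectralX x m : spectral p (x ^+ m) = spectral p x ^+ m.
Proof.
case: (Hp) => p0 p00 p1 pD pM.
case: m => [|m]; first by rewrite !expr0 spectral1.
apply/eqP; rewrite eq_le (submultXS _ _ spectral_submult) /=.
apply: lb_le_inf; first by exists (p (x ^+ m.+1)); exact: spectral_bound_self.
move=> r [r0 [C hC]]; rewrite leNgt; apply/negP => lt.
(* [t] replaces the root of [r] of order [m.+1]. The choice [P * (1 - b)] works by Bernoulli: [(1 -
   b) ^+ m.+1 >= 1 - b * m.+1 >= 1 - a = r / P ^+ m.+1]. *)
have [t [t0 tx rt]] : exists t, [/\ 0 < t, t < spectral p x & r <= t ^+ m.+1].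
  have P0 : 0 < spectral p x.
    rewrite lt0r spectral_ge0 andbT; apply/eqP => h; move: lt.
    by rewrite h expr0n /= ltNge r0.
  set P := spectral p x in lt P0 *.
  pose a := 1 - r / P ^+ m.+1.
  have Pm : 0 < P ^+ m.+1 by rewrite exprn_gt0.
  have a0 : 0 < a by rewrite /a subr_gt0 ltr_pdivrMr // mul1r.
  have a1 : a <= 1 by rewrite /a lerBlDr lerDl divr_ge0 // ltW.
  pose b := a / (m.+2)%:R.
  have bE : b * (m.+2)%:R = a by rewrite /b divfK // pnatr_eq0.
  have b0 : 0 < b by rewrite /b divr_gt0.
  have b1 : b < 1 by move: bE; rewrite -natr1 mulrDr mulr1; have : 0 < b * (m.+1)%:R by [rewrite mulr_gt0]; lra.
  exists (P * (1 - b)); split.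
  - by rewrite mulr_gt0 // subr_gt0.
  - by rewrite gtr_pMr //; lra.
  - rewrite exprMn.
    have hb k : 1 - b * k%:R <= (1 - b) ^+ k.
      elim: k => [|k IH]; first by rewrite mulr0 subr0.
      rewrite exprS -natr1; apply: (@le_trans _ _ ((1 - b) * (1 - b * k%:R))).
        have : 0 <= b * (b * k%:R) by rewrite !mulr_ge0 // ltW.
        lra.
      by rewrite ler_wpM2l //; lra.
    apply: (@le_trans _ _ (P ^+ m.+1 * (1 - a))).
      by rewrite /a subKr mulrC divfK // gt_eqF.
    rewrite ler_pM2l //; apply: le_trans (hb m.+1).
    by rewrite -bE -[in leLHS](natr1 m.+1); lra.
suff : spectral p x <= t by lra.
apply: spectral_le; split; first exact: ltW.
(* [D] absorbs the finitely many remainders of exponents modulo [m.+1]. *)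
pose D := \sum_(i < m.+1) p (x ^+ i) / t ^+ i.
have D0 i : (i < m.+1)%N -> p (x ^+ i) <= D * t ^+ i.
  move=> im; rewrite -ler_pdivrMr ?exprn_gt0 // /D (bigD1 (Ordinal im)) //=.
  by rewrite lerDl sumr_ge0 // => j _; rewrite divr_ge0 // exprn_ge0 // ltW.
exists (C * D) => k; rewrite {1 2}(divn_eq k m.+1) !exprD.
apply: (le_trans (pM _ _)); rewrite mulrACA; apply: ler_pM => //.
  rewrite mulnC !exprM; apply: (le_trans (hC _)).
  rewrite ler_wpM2l //; last by apply: lerXn2r => //; rewrite nnegrE ?exprn_ge0 // ltW.
  by have := hC 0%N; rewrite !expr0 mulr1; lra.
by apply: D0; rewrite ltn_mod.
Qed.

End Spectral.

(* The sequence is nonincreasing, and its limit is a seminorm below [p] for which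
   multiplication by [z] scales by exactly [p z]. *)
Definition twist p z (y : F) : R := inf (range (fun k => p (y * z ^+ k) / p z ^+ k)).

Section Twist.
Variables (p : F -> R) (z : F).
Hypothesis Hp : submult p.
Hypothesis pX : forall k, p (z ^+ k) = p z ^+ k.
Hypothesis pz : 0 < p z.

Let a y k := p (y * z ^+ k) / p z ^+ k.

Let a_ge0 y k : 0 <= a y k.
Proof. by case: (Hp) => p0 *; rewrite divr_ge0 // exprn_ge0. Qed.

Let a_dec y k l : (k <= l)%N -> a y l <= a y k.
Proof.
move=> /subnK <-; elim: (l - k)%N => [//|n IH].
apply: le_trans IH; rewrite addSn; set m := (n + k)%N.
have zm : p z ^+ m != 0 by rewrite gt_eqF // exprn_gt0.
rewrite /a ler_pdivrMr ?exprn_gt0 // exprSr [in leRHS]exprSr [in leRHS]mulrA divfK //.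
by rewrite mulrA; case: (Hp).
Qed.

Let twist_le y k : twist p z y <= a y k.
Proof. by apply: ge_inf; [exists 0 => _ [n _ <-]; exact: a_ge0 | exists k]. Qed.

Let twist_lt y r : twist p z y < r -> exists k, a y k < r.
Proof.
rewrite /twist => h; have [|_ [k _ <-] lt] := inf_lt _ h; last by exists k.
by exists (a y 0); exists 0%N.
Qed.

Let twist_ge y r : (forall k, r <= a y k) -> r <= twist p z y.
Proof.
move=> h; apply: lb_le_inf; first by exists (a y 0); exists 0%N.
by move=> _ [k _ <-]; exact: h.
Qed.

Lemma twist1 : twist p z 1 = 1.
Proof.
have a1 k : a 1 k = 1 by rewrite /a mul1r pX divff // gt_eqF // exprn_gt0.
apply/eqP; rewrite eq_le; apply/andP; split; first by rewrite -(a1 0%N).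
by apply: twist_ge => k; rewrite a1.
Qed.

Lemma twist_le_self y : twist p z y <= p y.
Proof. by apply: (le_trans (twist_le y 0)); rewrite /a !expr0 mulr1 divr1. Qed.

Lemma twist_submult : submult (twist p z).
Proof.
case: (Hp) => p0 p00 p1 pD pM; split.
- by move=> y; exact: twist_ge.
- apply/eqP; rewrite eq_le; apply/andP; split; last exact: twist_ge.
  by rewrite -p00 twist_le_self.
- by rewrite twist1.
- move=> x y; apply: le_addP_gt => r s /twist_lt[k hk] /twist_lt[l hl].
  pose m := maxn k l.
  apply: (le_trans (twist_le _ m)).
  apply: (@le_trans _ _ (a x m + a y m)).
    by rewrite /a -mulrDl ler_pM2r ?invr_gt0 ?exprn_gt0 // mulrDl.
  apply: lerD; apply: le_trans (ltW _); try eassumption; apply: a_dec.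
    exact: leq_maxl.
  exact: leq_maxr.
- move=> x y; apply: le_mulP_gt; try exact: twist_ge.
  move=> r s /twist_lt[k hk] /twist_lt[l hl].
  apply: (le_trans (twist_le _ (k + l))).
  apply: (@le_trans _ _ (a x k * a y l)).
    rewrite /a mulrACA -invfM -exprD ler_pM2r ?invr_gt0 ?exprn_gt0 //.
    by rewrite exprD mulrACA.
  by apply: ler_pM; rewrite ?a_ge0 // ltW.
Qed.

(** Multiplying by [z] shifts the sequence by one index, up to the factor [p z], and the infimum of
    a nonincreasing sequence ignores the shift. *)
Lemma twistM y : twist p z (z * y) = p z * twist p z y.
Proof.
have aS k : a (z * y) k = p z * a y k.+1.
  rewrite /a (mulrC z) -mulrA -exprS (exprS (p z)) invfM [RHS]mulrCA mulVKf //.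
  by rewrite gt_eqF.
apply/eqP; rewrite eq_le; apply/andP; split.
  rewrite [leRHS]mulrC -ler_pdivrMr //; apply: twist_ge => k.
  rewrite ler_pdivrMr // [leRHS]mulrC; apply: le_trans (twist_le _ k) _.
  by rewrite aS ler_pM2l // a_dec.
by apply: twist_ge => k; rewrite aS ler_pM2l.
Qed.

End Twist.

Lemma minimal_submult p0 : submult p0 -> p0 1 = 1 ->
  exists p, [/\ submult p, p 1 = 1, forall x, p x <= p0 x &
    forall q, submult q -> q 1 = 1 -> (forall x, q x <= p x) -> q = p].
Proof.
move=> sp0 p01.
pose T := {p : F -> R | [/\ submult p, p 1 = 1 & forall x, p x <= p0 x]}.
pose t0 : T := exist _ p0 (And3 sp0 p01 (fun x => lexx (p0 x))).
(* The order is reversed: a maximal element is a minimal seminorm. The constraint [p 1 = 1] in [T]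
   keeps the infimum of a chain from degenerating to 0. *)
pose le (p q : T) : bool := `[< forall x, sval q x <= sval p x >].
have [//|//|//|A Atot|[p [sp p1 pp0]] pmin] := @Zorn T le.
- by move=> p; apply/asboolP.
- move=> p q r /asboolP pq /asboolP qr; apply/asboolP => x.
  exact: le_trans (qr x) (pq x).
- move=> [p Hp] [q Hq] /asboolP /= pq /asboolP /= qp; apply: eq_exist; apply/funext => x.
  by apply/eqP; rewrite eq_le pq qp.
- have [->|/set0P[a Aa]] := eqVneq A set0; first by exists t0.
  pose S x : set R := [set sval q x | q in A].
  pose m x := inf (S x).
  have S0 x : S x !=set0 by exists (sval a x), a.
  have m_le q x : A q -> m x <= sval q x.
    move=> Aq; apply: ge_inf; last by exists q.
    by exists 0 => _ [[r [[r0 _ _ _ _] _ _]] _ <-] /=.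
  have m_lt x r : m x < r -> exists2 q, A q & sval q x < r.
    by rewrite /m => h; have [//|_ [q Aq <-] lt] := inf_lt _ h; exists q.
  have m_ge x r : (forall q, A q -> r <= sval q x) -> r <= m x.
    by move=> h; apply: lb_le_inf => // _ [q Aq <-]; exact: h.
  have m0 x : 0 <= m x by apply: m_ge => -[q [[]]].
  (* Both inequalities involve values at two points, so one member of the chain must be near the
     infimum at both; totality of the chain provides it. *)
  have m2 x y r s : m x < r -> m y < s ->
      exists q, [/\ A q, sval q x < r & sval q y < s].
    move=> /m_lt[q Aq qx] /m_lt[q' Aq' qy].
    have [/asboolP h|/asboolP h] := Atot _ _ Aq Aq'.
      by exists q'; split => //; exact: le_lt_trans (h _) qx.
    by exists q; split => //; exact: le_lt_trans (h _) qy.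
  have m1 : m 1 = 1.
    apply/eqP; rewrite eq_le; apply/andP; split.
      by apply: (le_trans (m_le _ _ Aa)); case: (a) => q [_ /= ->].
    by apply: m_ge => q _; case: (svalP q) => _ -> _.
  have sm : submult m.
    split => //.
    + apply/eqP; rewrite eq_le m0 andbT; apply: (le_trans (m_le _ _ Aa)).
      by case: (a) => q [[/= _ -> _ _ _] _ _].
    + by rewrite m1.
    + move=> x y; apply: le_addP_gt => r s mr ms.
      have [q [Aq qr qs]] := m2 _ _ _ _ mr ms.
      apply: (le_trans (m_le _ _ Aq)).
      case: q qr qs {Aq} => q /= [[_ _ _ qD _] _ _] qr qs.
      by apply: (le_trans (qD _ _)); rewrite lerD // ltW.
    + move=> x y; apply: le_mulP_gt => // r s mr ms.
      have [q [Aq qr qs]] := m2 _ _ _ _ mr ms.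
      apply: (le_trans (m_le _ _ Aq)).
      case: q qr qs {Aq} => q /= [[q0 _ _ _ qM] _ _] qr qs.
      by apply: (le_trans (qM _ _)); apply: ler_pM => //; rewrite ltW.
  have mp0 x : m x <= p0 x.
    by apply: (le_trans (m_le _ _ Aa)); case: (a) => q [].
  by exists (exist _ m (And3 sm m1 mp0)) => q Aq; apply/asboolP => x; exact: m_le.
- exists p; split => // q sq q1 qp.
  have qp0 x : q x <= p0 x := le_trans (qp x) (pp0 x).
  have := pmin (exist _ q (And3 sq q1 qp0)).
  rewrite /le; case: asboolP => [_|[]] //.
  by move=> /(_ isT) /(congr1 sval).
Qed.

(* A minimal seminorm equals its spectral radius and all its twists. *)
Lemma minimal_submult_mult p : submult p -> p 1 = 1 ->
  (forall q, submult q -> q 1 = 1 -> (forall x, q x <= p x) -> q = p) ->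
  is_absolute_value p.
Proof.
move=> sp p1 pmin; case: (sp) => p0 p00 _ pD pM.
have pX x k : p (x ^+ k) = p x ^+ k.
  have <- : spectral p = p.
    apply: pmin => [||x']; [exact: spectral_submult|exact: spectral1|exact: spectral_le_self].
  exact: spectralX.
have pMe x y : p (x * y) = p x * p y.
  have [x0|x0] := eqVneq (p x) 0.
    by apply/eqP; rewrite eq_le pM x0 mul0r p0.
  have px : 0 < p x by rewrite lt0r x0 p0.
  have e : twist p x = p.
    apply: pmin => [||y']; [exact: twist_submult|exact: twist1|exact: twist_le_self].
  by have := twistM sp px y; rewrite e.
split => // x; split => [px|->//].
apply/eqP/negPn/negP => x0.
by have := pMe x x^-1; rewrite divff // p1 px mul0r => /eqP; rewrite oner_eq0.
Qed.

(** Minimization could destroy a lower bound at [z]. Twisting by [z] beforehand fixes the value at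
    [z^-1] to the inverse of the spectral radius of [z]. The minimal [w] is at most that at [z^-1]
    and, being multiplicative, at least the spectral radius at [z]. *)
Theorem absolute_value_below p z s C : submult p -> 0 < s ->
  (forall k, s ^+ k <= C * p (z ^+ k)) ->
  exists w : F -> R,
    [/\ is_absolute_value w, forall x, w x <= spectral p x & s <= w z].
Proof.
move=> sp s0 hs.
have sz : s <= spectral p z := spectral_ge sp s0 hs.
have z0 : 0 < spectral p z := lt_le_trans s0 sz.
have zX k := spectralX sp z k.
have sp1 := spectral_submult sp.
have sp2 := twist_submult sp1 zX z0.
have [w [sw w1 ww wmin]] := minimal_submult sp2 (twist1 sp1 zX z0).
have absw := minimal_submult_mult sw w1 wmin.
exists w; split => // [x|].
  by apply: le_trans (ww x) _; apply: twist_le_self.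
have zn0 : z != 0.
  by apply: contraTneq z0 => ->; case: sp1 => _ -> _ _ _; rewrite ltxx.
have := twistM sp1 z0 z^-1; rewrite divff // twist1 // => e.
have := ww z^-1; rewrite absV // => h.
have wz : 0 < w z by rewrite abs_gt0.
apply: (le_trans sz); rewrite -(ler_pM2r (_ : 0 < (w z)^-1)) ?invr_gt0 // divff ?gt_eqF //.
by rewrite e ler_pM2l.
Qed.

End SubmultiplicativeSeminorm.

(** * Completions *)

Lemma cvg_sumr (R : realType) I (r : seq I) (P : pred I) (u : I -> nat -> R) (l : I -> R) :
  (forall i, P i -> u i @ \oo --> l i) ->
  (fun n => \sum_(i <- r | P i) u i n) @ \oo --> \sum_(i <- r | P i) l i.
Proof.
move=> h; elim: r => [|i r IH].
  by rewrite big_nil; under eq_fun do rewrite big_nil; exact: cvg_cst.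
rewrite big_cons; under eq_fun do rewrite big_cons.
by case: ifP => // Pi; apply: cvgD => //; exact: h.
Qed.

Section AbsoluteLimit.
Variables (R : realType) (F : fieldType) (f : F -> R).
Hypothesis Hf : is_absolute_value f.
Implicit Types (u v : nat -> F) (l : F).

Definition abs_lim u l := (fun n => f (u n - l)) @ \oo --> (0 : R).

Lemma cvg0_le (a b : nat -> R) : (forall n, 0 <= a n <= b n) ->
  b @ \oo --> (0 : R) -> a @ \oo --> (0 : R).
Proof.
move=> h hb; apply: (@squeeze_cvgr _ _ _ _ (fun=> 0) b) => //; last exact: cvg_cst.
exact: nearW.
Qed.

Lemma abs_lim_cst l : abs_lim (fun=> l) l.
Proof. by rewrite /abs_lim; under eq_fun do rewrite subrr (abs0 Hf); exact: cvg_cst. Qed.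

Lemma abs_limD u v l m : abs_lim u l -> abs_lim v m -> abs_lim (fun n => u n + v n) (l + m).
Proof.
move=> hu hv; apply: (@cvg0_le _ (fun n => f (u n - l) + f (v n - m))).
  by move=> n; rewrite (abs_ge0 Hf) opprD addrACA (absD Hf).
by rewrite -[0]addr0; exact: cvgD.
Qed.

Lemma abs_limN u l : abs_lim u l -> abs_lim (fun n => - u n) (- l).
Proof. by rewrite /abs_lim; under [in X in _ -> X]eq_fun do rewrite -opprD (absN Hf). Qed.

Lemma abs_limB u v l m : abs_lim u l -> abs_lim v m -> abs_lim (fun n => u n - v n) (l - m).
Proof. by move=> hu /abs_limN; exact: abs_limD. Qed.

Lemma abs_lim_norm u l : abs_lim u l -> (fun n => f (u n)) @ \oo --> f l.
Proof.
move=> h; apply/subr_cvg0; apply/norm_cvg0P.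
apply: (@cvg0_le _ (fun n => f (u n - l))) h => n.
rewrite normr_ge0 /=; exact: abs_dist.
Qed.

Lemma abs_limM u v l m : abs_lim u l -> abs_lim v m -> abs_lim (fun n => u n * v n) (l * m).
Proof.
move=> hu hv.
apply: (@cvg0_le _ (fun n => f (u n - l) * f (v n) + f l * f (v n - m))).
  move=> n; rewrite (abs_ge0 Hf) /= -!(absM Hf).
  have -> : u n * v n - l * m = (u n - l) * v n + l * (v n - m) by ring.
  exact: absD.
rewrite (_ : 0 = 0 * f m + f l * 0); last by rewrite mul0r mulr0 addr0.
apply: cvgD; first by apply: cvgM => //; exact: abs_lim_norm.
by apply: cvgM => //; exact: cvg_cst.
Qed.

Lemma abs_lim_sum I (r : seq I) (P : pred I) (u : I -> nat -> F) (l : I -> F) :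
  (forall i, P i -> abs_lim (u i) (l i)) ->
  abs_lim (fun n => \sum_(i <- r | P i) u i n) (\sum_(i <- r | P i) l i).
Proof.
move=> h; elim: r => [|i r IH].
  by rewrite big_nil; under eq_fun do rewrite big_nil; exact: abs_lim_cst.
rewrite big_cons; under eq_fun do rewrite big_cons.
by case: ifP => // Pi; apply: abs_limD => //; exact: h.
Qed.

Lemma abs_lim_prod I (r : seq I) (P : pred I) (u : I -> nat -> F) (l : I -> F) :
  (forall i, P i -> abs_lim (u i) (l i)) ->
  abs_lim (fun n => \prod_(i <- r | P i) u i n) (\prod_(i <- r | P i) l i).
Proof.
move=> h; elim: r => [|i r IH].
  by rewrite big_nil; under eq_fun do rewrite big_nil; exact: abs_lim_cst.
rewrite big_cons; under eq_fun do rewrite big_cons.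
by case: ifP => // Pi; apply: abs_limM => //; exact: h.
Qed.

Lemma abs_lim_det k (M : nat -> 'M[F]_k) (L : 'M[F]_k) :
  (forall i j, abs_lim (fun n => M n i j) (L i j)) ->
  abs_lim (fun n => \det (M n)) (\det L).
Proof.
move=> h; rewrite /determinant; apply: abs_lim_sum => s _.
by apply: abs_limM; [exact: abs_lim_cst | apply: abs_lim_prod => i _; exact: h].
Qed.

Lemma abs_lim_uniq u l m : abs_lim u l -> abs_lim u m -> l = m.
Proof.
move=> hl hm; apply/eqP; rewrite -subr_eq0 -(abs_eq0 Hf); apply/eqP.
have h := abs_lim_norm (abs_limB hl hm).
rewrite -(cvg_lim _ h) //; under eq_fun do rewrite subrr (abs0 Hf).
by rewrite lim_cst.
Qed.

Lemma abs_lim_eps u l : abs_lim u l <->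
  forall e : R, 0 < e -> exists N, forall n, (N <= n)%N -> f (u n - l) < e.
Proof.
split=> [h e e0|h].
  have /cvgrPdist_lt/(_ e e0) [N _ hN] := h.
  by exists N => n Nn; have := hN n Nn; rewrite sub0r normrN ger0_norm ?(abs_ge0 Hf).
apply/cvgrPdist_lt => e /h[N hN]; exists N => // n /= Nn.
by rewrite sub0r normrN ger0_norm ?(abs_ge0 Hf) // hN.
Qed.

Lemma exists_abs_lim (P : F -> Prop) l :
  (forall e : R, 0 < e -> exists2 x, P x & f (l - x) < e) ->
  exists2 u, (forall n, P (u n)) & abs_lim u l.
Proof.
move=> h; have h' (n : nat) : {x | P x & f (l - x) < n.+1%:R^-1}.
  by apply: cid2; apply: h; rewrite invr_gt0.
exists (fun n => s2val (h' n)) => [n|]; first exact: s2valP (h' n).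
apply: (@cvg0_le _ (fun n => n.+1%:R^-1)); last exact: cvg_harmonic.
move=> n; rewrite (abs_ge0 Hf) (abs_distC Hf) ltW //; exact: s2valP' (h' n).
Qed.

Definition abs_cauchy u := forall e : R, 0 < e -> exists N : nat, forall m n : nat,
  (N <= m)%N -> (N <= n)%N -> f (u m - u n) < e.

Lemma abs_lim_cauchy u l : abs_lim u l -> abs_cauchy u.
Proof.
move=> /abs_lim_eps h e e0; have [|N hN] := h (e / 2); first by rewrite divr_gt0.
exists N => m n Nm Nn.
have -> : u m - u n = (u m - l) - (u n - l) by ring.
apply: (le_lt_trans (absB Hf _ _)); have := hN m Nm; have := hN n Nn; lra.
Qed.

Lemma abs_cauchy_bounded u : abs_cauchy u -> exists2 B, 0 < B & forall n, f (u n) <= B.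
Proof.
move=> /(_ 1 ltr01)[N hN].
have S0 : 0 <= \sum_(i < N.+1) f (u i) by apply: sumr_ge0 => i _; exact: abs_ge0.
exists (1 + \sum_(i < N.+1) f (u i)); first lra.
move=> n; have [nN|Nn] := leqP n N.
  rewrite (bigD1 (Ordinal (nN : (n < N.+1)%N))) //= addrCA lerDl.
  by apply: addr_ge0 => //; apply: sumr_ge0 => i _; exact: abs_ge0.
rewrite (bigD1 ord_max) //=.
have := absD Hf (u n - u N) (u N); rewrite subrK.
have := hN n N (ltnW Nn) (leqnn N).
have : 0 <= \sum_(i < N.+1 | i != ord_max) f (u i).
  by apply: sumr_ge0 => i _; exact: abs_ge0.
lra.
Qed.

Lemma abs_cauchyB u v : abs_cauchy u -> abs_cauchy v -> abs_cauchy (fun n => u n - v n).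
Proof.
move=> hu hv e e0; have e2 : 0 < e / 2 by rewrite divr_gt0.
have [N hN] := hu _ e2; have [M hM] := hv _ e2; exists (maxn N M) => m n.
rewrite !geq_max => /andP[Nm Mm] /andP[Nn Mn].
have -> : u m - v m - (u n - v n) = (u m - u n) - (v m - v n) by ring.
apply: (le_lt_trans (absB Hf _ _)).
have := hN m n Nm Nn; have := hM m n Mm Mn; lra.
Qed.

Lemma abs_cauchyM u v : abs_cauchy u -> abs_cauchy v -> abs_cauchy (fun n => u n * v n).
Proof.
move=> hu hv e e0; have [B B0 hB] := abs_cauchy_bounded hu.
have [C C0 hC] := abs_cauchy_bounded hv.
have [|N hN] := hu (e / 2 / C); first by rewrite !divr_gt0.
have [|M hM] := hv (e / 2 / B); first by rewrite !divr_gt0.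
exists (maxn N M) => m n.
rewrite !geq_max => /andP[Nm Mm] /andP[Nn Mn].
have -> : u m * v m - u n * v n = (u m - u n) * v m + u n * (v m - v n) by ring.
apply: (le_lt_trans (absD Hf _ _)); rewrite !(absM Hf).
have h1 := hN m n Nm Nn; rewrite ltr_pdivlMr // in h1.
have h2 := hM m n Mm Mn; rewrite ltr_pdivlMr // in h2.
have h3 : f (u m - u n) * f (v m) <= f (u m - u n) * C.
  by rewrite ler_wpM2l ?hC ?(abs_ge0 Hf).
have h4 : f (u n) * f (v m - v n) <= B * f (v m - v n).
  by rewrite ler_wpM2r ?hB ?(abs_ge0 Hf).
lra.
Qed.

End AbsoluteLimit.

Section Completion.
Variable R : realType.

(** The proof is packed with the function so that the ring structures on Cauchy sequences and on
    their quotient, which rely on it, are determined by [a] alone. *)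
Record absval (F : fieldType) := AbsVal {
  absval_fun :> F -> R;
  absvalP : is_absolute_value absval_fun }.

Variables (F : fieldType) (a : absval F).
Let Ha : is_absolute_value a := absvalP a.

Definition cauchyb : {pred nat -> F} := fun u => `[< abs_cauchy a u >].

Lemma cauchyb_subring : subring_closed cauchyb.
Proof.
split => [|u v /asboolP hu /asboolP hv|u v /asboolP hu /asboolP hv]; apply/asboolP.
- by move=> e e0; exists 0%N => m n _ _; rewrite subrr (abs0 Ha).
- exact: abs_cauchyB.
- exact: abs_cauchyM.
Qed.

HB.instance Definition _ := GRing.isSubringClosed.Build (nat -> F) cauchyb cauchyb_subring.

Record cseq := CSeq { cseq_val :> nat -> F; _ : cauchyb cseq_val }.

HB.instance Definition _ := [isSub for cseq_val].
HB.instance Definition _ := [Choice of cseq by <:].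
HB.instance Definition _ := [SubChoice_isSubComNzRing of cseq by <:].

Lemma cseqP (u : cseq) : abs_cauchy a u.
Proof. by case: u => u /= h; apply/asboolP. Qed.

Definition nullb : {pred cseq} := fun u => `[< abs_lim a u 0 >].

Lemma nullb_ideal : idealr_closed nullb.
Proof.
split => [||w u v].
- by apply/asboolP; exact: abs_lim_cst.
- apply/asboolPn => h.
  by have /eqP := abs_lim_uniq Ha h (abs_lim_cst Ha 1); rewrite eq_sym oner_eq0.
- move=> /asboolP hu /asboolP hv; apply/asboolP.
  have [B B0 hB] := abs_cauchy_bounded Ha (@cseqP w).
  have hu' : (fun n => B * a (u n - 0)) @ \oo --> (0 : R).
    by rewrite -[X in _ --> X](mulr0 B); apply: cvgM => //; exact: cvg_cst.
  apply: (@cvg0_le R (fun n => a (w n * u n + v n - 0)) (fun n => B * a (u n - 0) + a (v n - 0))); last first.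
    by rewrite -[X in _ --> X]addr0; apply: cvgD.
  move=> n; rewrite (abs_ge0 Ha) !subr0 /=.
  apply: (le_trans (absD Ha _ _)); rewrite lerD2r (absM Ha).
  by rewrite ler_wpM2r ?(abs_ge0 Ha).
Qed.

HB.instance Definition _ := isIdealr.Build cseq nullb nullb_ideal.

Definition completion := {ideal_quot nullb}.
HB.instance Definition _ := GRing.ComNzRing.on completion.

Definition cpi (u : cseq) : completion := \pi_(completion)%qT u.

Lemma cpi_eq0 (u : cseq) : cpi u = 0 <-> abs_lim a u 0.
Proof.
have c0 : cpi 0 = 0 by rewrite /cpi piE.
have -> : (cpi u = 0) <-> (u - 0 \in nullb).
  by rewrite Quotient.idealrBE -c0; split => /eqP.
by rewrite subr0; split => /asboolP.
Qed.

Definition crepr (x : completion) : cseq := generic_quotient.repr x.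

Lemma cpiK x : cpi (crepr x) = x. Proof. exact: generic_quotient.reprK. Qed.

Lemma cpiD u v : cpi (u + v) = cpi u + cpi v.
Proof. by rewrite /cpi piE. Qed.

Lemma cpiB u v : cpi (u - v) = cpi u - cpi v.
Proof. by rewrite /cpi !piE. Qed.

Lemma cpiM u v : cpi (u * v) = cpi u * cpi v.
Proof. by rewrite /cpi piE. Qed.

Lemma cpi1 : cpi 1 = 1. Proof. by rewrite /cpi piE. Qed.

Definition cabs (x : completion) : R := lim ((fun n => a (crepr x n)) @ \oo).

Lemma cseq_norm_cvg (u : cseq) : cvg ((fun n => a (u n)) @ \oo).
Proof.
apply: R_complete; apply: cauchy_exP => e e0.
have [N hN] := cseqP u e0; exists (a (u N)); exists N => // n /= Nn.
by rewrite /ball /= (le_lt_trans (abs_dist Ha _ _)) // hN.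
Qed.

Lemma cabs_cvg (u : cseq) : (fun n => a (u n)) @ \oo --> cabs (cpi u).
Proof.
have h : abs_lim a (u - crepr (cpi u) : cseq) 0.
  by apply/cpi_eq0; rewrite cpiB cpiK subrr.
set v := crepr (cpi u) in h *.
have hv : (fun n => a (v n)) @ \oo --> cabs (cpi u) by exact: cseq_norm_cvg.
apply/subr_cvg0; rewrite -(addr0 0) (_ : (fun n => _) =
  (fun n => (a (u n) - a (v n)) + (a (v n) - cabs (cpi u)))); last first.
  by apply/funext => n; rewrite addrA subrK.
apply: cvgD; last exact/subr_cvg0.
apply/norm_cvg0P; apply: (@cvg0_le R _ (fun n => a (u n - v n - 0))) h => n.
by rewrite normr_ge0 subr0 /= (abs_dist Ha).
Qed.

Lemma cabs_cpi (u : cseq) l : (fun n => a (u n)) @ \oo --> l -> cabs (cpi u) = l.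
Proof. by move=> h; rewrite -(cvg_lim _ h) // (cvg_lim _ (@cabs_cvg u)). Qed.

Lemma cabs_ge0 x : 0 <= cabs x.
Proof.
apply: limr_ge; first exact: cseq_norm_cvg.
by apply: nearW => n; exact: abs_ge0.
Qed.

Lemma cabs_eq0 x : cabs x = 0 <-> x = 0.
Proof.
rewrite -(cpiK x) cpi_eq0; split => h; last first.
  by apply: cabs_cpi; have := h; rewrite /abs_lim; under eq_fun do rewrite subr0.
by have := @cabs_cvg (crepr x); rewrite h /abs_lim; under [in X in _ -> X]eq_fun do rewrite subr0.
Qed.

(** A Cauchy sequence that is not null eventually exceeds half of its limiting absolute value, so it
    can be inverted termwise; finitely many zero terms, with inverse 0, do not affect the class. *)
Lemma completion_mulV x : x != 0 -> exists y : completion, y * x = 1.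
Proof.
move=> x0; set u := crepr x; set l := cabs x.
have l0 : 0 < l by rewrite lt0r cabs_ge0 andbT; apply: contra_neq x0 => /cabs_eq0.
have hu : (fun n => a (u n)) @ \oo --> l by rewrite /l -(cpiK x); exact: cabs_cvg.
have [N hN] : exists N, forall n, (N <= n)%N -> l / 2 < a (u n).
  have /cvgrPdist_lt/(_ (l / 2)) := hu; rewrite divr_gt0 // => /(_ isT)[N _ hN].
  by exists N => n /hN; rewrite ltr_norml => /andP[_]; lra.
have cv : cauchyb (fun n => (u n)^-1).
  apply/asboolP => e e0.
  (* The factor compensates the denominator in [1/x - 1/y = (y - x) / (x y)], where [x] and [y]
     exceed [l / 2] in absolute value. *)
  have [|M hM] := @cseqP u (e * (l / 2) ^+ 2); first by rewrite mulr_gt0 // exprn_gt0 // divr_gt0.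
  exists (maxn N M) => m n; rewrite !geq_max => /andP[Nm Mm] /andP[Nn Mn].
  have am := hN m Nm; have an := hN n Nn.
  have l2 : 0 < l / 2 by rewrite divr_gt0.
  have um : u m != 0 by rewrite -(abs_gt0 Ha) (lt_trans l2).
  have un : u n != 0 by rewrite -(abs_gt0 Ha) (lt_trans l2).
  have -> : (u m)^-1 - (u n)^-1 = (u n - u m) / (u m * u n) by field; rewrite um un.
  rewrite (abs_div Ha) (absM Ha) ltr_pdivrMr ?mulr_gt0 ?(lt_trans l2) //.
  apply: (lt_le_trans (hM n m Mn Mm)); rewrite ler_pM2l // expr2.
  by apply: ler_pM => //; exact: ltW.
exists (cpi (CSeq cv)); rewrite -(cpiK x) -cpiM -cpi1; apply/eqP.
rewrite -subr_eq0 -cpiB; apply/eqP/cpi_eq0/(abs_lim_eps Ha) => e e0.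
exists N => n Nn; have un : u n != 0.
  by rewrite -(abs_gt0 Ha) (lt_trans _ (hN n Nn)) // divr_gt0.
have -> : (CSeq cv * crepr x - 1 : cseq) n - 0 = (u n)^-1 * u n - 1 - 0 by [].
by rewrite mulVf // subrr subr0 (abs0 Ha).
Qed.

Definition cinv (x : completion) : completion :=
  if pselect (exists y : completion, y * x = 1) is left h then projT1 (cid h) else x.

Definition cunit : {pred completion} := fun x => x != 0.

Lemma cmulVx : {in cunit, left_inverse 1 cinv *%R}.
Proof.
move=> x x0; rewrite /cinv; case: pselect => [h|[]]; first by case: cid.
exact: completion_mulV.
Qed.

Lemma cunitPl (x y : completion) : y * x = 1 -> cunit x.
Proof.
move=> h; apply/eqP => x0; move: h; rewrite x0 mulr0 => /esym/eqP.
by rewrite oner_eq0.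
Qed.

Lemma cinv_out : {in [predC cunit], cinv =1 id}.
Proof.
move=> x; rewrite inE /= => h; rewrite /cinv; case: pselect => // hy.
by exfalso; case: hy => y /cunitPl hx; case/negP: h.
Qed.

HB.instance Definition _ :=
  GRing.ComNzRing_hasMulInverse.Build completion cmulVx cunitPl cinv_out.
HB.instance Definition _ :=
  GRing.ComUnitRing_isField.Build completion (fun x x0 => x0).

Lemma cabs_absolute_value : is_absolute_value (cabs : completion -> R).
Proof.
split; [exact: cabs_ge0 | exact: cabs_eq0 | |].
- move=> x y; rewrite -(cpiK x) -(cpiK y) -cpiM; apply: cabs_cpi.
  rewrite (_ : (fun n => _) = (fun n => a (crepr x n) * a (crepr y n))); last first.
    by apply/funext => n; rewrite -(absM Ha).
  by apply: cvgM; exact: cabs_cvg.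
- move=> x y; rewrite -(cpiK x) -(cpiK y) -cpiD.
  apply: (ler_cvg_to (@cabs_cvg (crepr x + crepr y)) (cvgD (@cabs_cvg (crepr x)) (@cabs_cvg (crepr y)))).
  by apply: nearW => n; exact: absD.
Qed.

Lemma cauchyb_cst x : cauchyb (fun=> x).
Proof. by apply/asboolP => e e0; exists 0%N => m n _ _; rewrite subrr (abs0 Ha). Qed.

Definition cinj (x : F) : completion := cpi (CSeq (cauchyb_cst x)).

Lemma cinj_zmod : zmod_morphism cinj.
Proof.
move=> x y; rewrite /cinj -cpiB; congr cpi; exact/val_inj.
Qed.

Lemma cinj_monoid : monoid_morphism cinj.
Proof.
split; first by rewrite /cinj -cpi1; congr cpi; exact/val_inj.
by move=> x y; rewrite /cinj -cpiM; congr cpi; exact/val_inj.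
Qed.

HB.instance Definition _ := GRing.isZmodMorphism.Build F completion cinj cinj_zmod.
HB.instance Definition _ := GRing.isMonoidMorphism.Build F completion cinj cinj_monoid.

Lemma cabs_cinj x : cabs (cinj x) = a x.
Proof. by apply: cabs_cpi; exact: (cvg_cst (a x)). Qed.

Lemma cabs_cpi_lim (u : cseq) : abs_lim cabs (fun n => cinj (u n)) (cpi u).
Proof.
apply/(abs_lim_eps cabs_absolute_value) => e e0.
have [|N hN] := @cseqP u (e / 2); first by rewrite divr_gt0.
exists N => n Nn; rewrite /cinj -cpiB.
apply: (@le_lt_trans _ _ (e / 2)); last by lra.
apply: (ler_cvg_to (@cabs_cvg (CSeq (cauchyb_cst (u n)) - u)) (cvg_cst (e / 2))).
by exists N => // m /= Nm; apply/ltW/hN.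
Qed.

Lemma cinj_dense y (e : R) : 0 < e -> exists x, cabs (y - cinj x) < e.
Proof.
move=> e0; have := @cabs_cpi_lim (crepr y).
move=> /(abs_lim_eps cabs_absolute_value)/(_ e e0)[N hN].
exists (crepr y N); rewrite (abs_distC cabs_absolute_value).
by have := hN N (leqnn N); rewrite cpiK.
Qed.

(** Each term is replaced by an element of [F] at distance less than [1/(n + 1)]; these elements
    form a Cauchy sequence in [F], whose class is the limit. *)
Lemma cabs_complete : abs_complete cabs.
Proof.
move=> u hu; have h (n : nat) : {x | cabs (u n - cinj x) < n.+1%:R^-1}.
  by apply: cid; apply: cinj_dense; rewrite invr_gt0.
pose x n := projT1 (h n); have hx n : cabs (u n - cinj (x n)) < n.+1%:R^-1 := projT2 (h n).
have Hc := cabs_absolute_value.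
have ux : abs_lim cabs (fun n => u n - cinj (x n)) 0.
  apply: (@cvg0_le R _ (fun n => n.+1%:R^-1)); last exact: cvg_harmonic.
  by move=> n; rewrite subr0 (abs_ge0 Hc) ltW.
have cx : cauchyb x.
  apply/asboolP => e e0.
  have := abs_cauchyB Hc hu (abs_lim_cauchy Hc ux) e0; case=> N hN.
  exists N => m n Nm Nn; rewrite -cabs_cinj rmorphB.
  by have := hN m n Nm Nn; rewrite !subKr.
exists (cpi (CSeq cx)).
have := abs_limD Hc ux (@cabs_cpi_lim (CSeq cx)); rewrite add0r.
by under eq_fun do rewrite subrK.
Qed.

Lemma completionP : is_completion a cinj cabs.
Proof.
split; [exact: cabs_absolute_value | exact: cabs_cinj | exact: cinj_dense | exact: cabs_complete].
Qed.

End Completion.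

Section CompletionMap.
Variables (R : realType) (k F : fieldType) (b : absval R k) (a : absval R F).
Variable phi : {rmorphism k -> F}.
Hypothesis phi_abs : forall x, a (phi x) = b x.

Lemma cauchyb_map (u : cseq b) : cauchyb a (phi \o u).
Proof.
apply/asboolP => e /(@cseqP _ _ _ u)[N hN]; exists N => m n Nm Nn.
by rewrite /= -rmorphB phi_abs hN.
Qed.

Definition cseq_map u : cseq a := CSeq (cauchyb_map u).

(** The embedding of [Q_v] in [K_w] required by [is_local_degree]; since [phi] is an isometry, it
    may be applied termwise. *)
Definition completion_map (x : completion b) : completion a := cpi (cseq_map (crepr x)).

Lemma completion_map_cpi u : completion_map (cpi u) = cpi (cseq_map u).
Proof.
apply/eqP; rewrite -subr_eq0 -cpiB; apply/eqP/cpi_eq0.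
have : abs_lim b (crepr (cpi u) - u : cseq b) 0.
  by apply/cpi_eq0; rewrite cpiB cpiK subrr.
rewrite /abs_lim => h; rewrite (_ : (fun n => _) = (fun n => b ((crepr (cpi u) - u : cseq b) n - 0))) //.
by apply/funext => n; rewrite !subr0 -phi_abs rmorphB.
Qed.

Lemma completion_map_zmod : zmod_morphism completion_map.
Proof.
move=> x y; rewrite -(cpiK x) -(cpiK y) -cpiB !completion_map_cpi -cpiB.
by congr cpi; apply/val_inj/funext => n; exact: rmorphB.
Qed.

Lemma completion_map_monoid : monoid_morphism completion_map.
Proof.
split.
  by rewrite -cpi1 completion_map_cpi -cpi1; congr cpi; apply/val_inj/funext => n; exact: rmorph1.
move=> x y; rewrite -(cpiK x) -(cpiK y) -cpiM !completion_map_cpi -cpiM.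
by congr cpi; apply/val_inj/funext => n; exact: rmorphM.
Qed.

HB.instance Definition _ := GRing.isZmodMorphism.Build _ _ completion_map completion_map_zmod.
HB.instance Definition _ := GRing.isMonoidMorphism.Build _ _ completion_map completion_map_monoid.

Lemma completion_map_inj x : completion_map (cinj b x) = cinj a (phi x).
Proof. by rewrite /cinj completion_map_cpi; congr cpi; exact/val_inj. Qed.

Lemma cabs_completion_map x : cabs (completion_map x) = cabs x.
Proof.
rewrite -(cpiK x) completion_map_cpi; apply: cabs_cpi.
by have := @cabs_cvg _ _ _ (crepr x); under [in X in _ -> X]eq_fun do rewrite /= phi_abs.
Qed.

End CompletionMap.

(** * Finite extensions of complete fields *)

Section FiniteDimension.
Variables (R : realType) (k L : fieldType) (phi : {rmorphism k -> L}).
Variables (f : k -> R) (g : L -> R).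
Hypotheses (Hf : is_absolute_value f) (Hg : is_absolute_value g).
Hypothesis phi_abs : forall x, g (phi x) = f x.
Hypothesis fC : abs_complete f.
Variable e : nat -> L.

(** Coefficients and vectors are indexed by [nat], not by ordinals, so that inductions on [m] add
    one term to the same families. *)
Definition comb m (c : nat -> k) : L := \sum_(i < m) phi (c i) * e i.

Definition comb_free m := forall c, comb m c = 0 -> forall i, (i < m)%N -> c i = 0.

Definition comb_bounded m C :=
  forall c i, (i < m)%N -> f (c i) <= C * g (comb m c).

Lemma combB m c d : comb m (fun i => c i - d i) = comb m c - comb m d.
Proof. by rewrite /comb -sumrB; apply: eq_bigr => i _; rewrite rmorphB mulrBl. Qed.

Lemma combZ m c x : comb m (fun i => x * c i) = phi x * comb m c.
Proof. by rewrite /comb mulr_sumr; apply: eq_bigr => i _; rewrite rmorphM mulrA. Qed.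

Lemma combS m c : comb m.+1 c = comb m c + phi (c m) * e m.
Proof. by rewrite /comb big_ord_recr. Qed.

(** Bounded coordinates turn a convergent sequence of combinations into Cauchy sequences of
    coefficients, which converge because [k] is complete. *)
Lemma comb_closed m C y : 0 <= C -> comb_bounded m C ->
  (forall d : R, 0 < d -> exists c, g (y - comb m c) < d) -> exists c, y = comb m c.
Proof.
move=> C0 hC h.
have [|u /choice[c uc] hu] := @exists_abs_lim _ _ _ Hg (fun x => exists c, x = comb m c) y.
  by move=> d /h[c hc]; exists (comb m c) => //; exists c.
have cu := abs_lim_cauchy Hg hu.
have /choice[l hl] : forall i, exists l, (i < m)%N -> abs_lim f (fun n => c n i) l.
  move=> i; have [im|im] := ltnP i m; last by exists 0.
  have [|l hl] := fC (u := fun n => c n i); last by exists l.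
  move=> d d0; have [|N hN] := cu (d / (C + 1)); first by rewrite divr_gt0 //; lra.
  exists N => n p Nn Np; have := hN n p Nn Np; rewrite !uc -combB => h1.
  apply: (le_lt_trans (hC (fun i => c n i - c p i) i im)).
  rewrite ltr_pdivlMr in h1; last by lra.
  have := abs_ge0 Hg (comb m (fun i => c n i - c p i)); nra.
exists l; apply: (abs_lim_uniq Hg hu).
rewrite (_ : u = fun n => comb m (c n)); last exact/funext.
apply: (abs_lim_sum Hg) => i _; apply: (abs_limM Hg); last exact: abs_lim_cst.
have := hl i (ltn_ord i); rewrite /abs_lim.
by under [in X in _ -> X]eq_fun do rewrite -rmorphB phi_abs.
Qed.

(** Equivalence of norms in finite dimension over a complete field. By induction the first [m]
    vectors span a closed subspace, so [e m] lies at a positive distance [d] from it. This bounds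
    the last coefficient; subtracting the last term bounds the others. *)
Lemma comb_free_bounded m : comb_free m -> exists2 C, 0 <= C & comb_bounded m C.
Proof.
elim: m => [|m IH] fr; first by exists 0.
have {IH} [|C C0 hC] := IH.
  move=> c c0 i im; pose c' i := if (i < m)%N then c i else 0.
  have e' : comb m c' = comb m c by apply: eq_bigr => j _; rewrite /c' ltn_ord.
  have : comb m.+1 c' = 0 by rewrite combS {2}/c' ltnn rmorph0 mul0r addr0 e'.
  by move=> /fr/(_ i (ltnW im)); rewrite /c' im.
have [d d0 hd] : exists2 d, 0 < d & forall c, d <= g (e m - comb m c).
  apply: contrapT => h.
  have [|c ec] := @comb_closed m C (e m) C0 hC.
    move=> d d0; apply: contrapT => h'; apply: h; exists d => // c.
    by rewrite leNgt; apply/negP => lt; apply: h'; exists c.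
  pose c' i := if (i < m)%N then - c i else 1.
  have e' : comb m c' = - comb m c.
    by rewrite /comb -sumrN; apply: eq_bigr => j _; rewrite /c' ltn_ord rmorphN mulNr.
  have : comb m.+1 c' = 0.
    by rewrite combS {2}/c' ltnn rmorph1 mul1r e' -ec addNr.
  by move=> /fr/(_ m (ltnSn m))/eqP; rewrite /c' ltnn oner_eq0.
have bm c : f (c m) <= d^-1 * g (comb m.+1 c).
  have [->|cm] := eqVneq (c m) 0.
    by rewrite (abs0 Hf) mulr_ge0 ?(abs_ge0 Hg) // invr_ge0 ltW.
  have fm : 0 < f (c m) by rewrite (abs_gt0 Hf).
  rewrite ler_pdivlMl //.
  have := hd (fun i => - (c m)^-1 * c i); rewrite combZ => h.
  have -> : comb m.+1 c = phi (c m) * (e m - phi (- (c m)^-1) * comb m c).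
    rewrite combS rmorphN mulNr opprK mulrDr mulrA -rmorphM divff // rmorph1.
    by rewrite mul1r addrC.
  by rewrite (absM Hg) phi_abs mulrC ler_pM2l.
have ge0 := abs_ge0 Hg.
exists (d^-1 + C * (1 + d^-1 * g (e m))).
  have : 0 <= d^-1 * g (e m) by rewrite mulr_ge0 ?ge0 // invr_ge0 ltW.
  have : 0 < d^-1 by rewrite invr_gt0.
  nra.
move=> c i; rewrite ltnS leq_eqVlt => /predU1P[->|im].
  apply: (le_trans (bm c)); rewrite mulrDl lerDl !mulr_ge0 ?ge0 //.
  by rewrite addr_ge0 // mulr_ge0 ?ge0 // invr_ge0 ltW.
apply: (le_trans (hC c i im)); rewrite mulrDl -[leLHS]add0r lerD //.
  by rewrite mulr_ge0 ?ge0 // invr_ge0 ltW.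
rewrite -mulrA ler_wpM2l //.
have -> : comb m c = comb m.+1 c - phi (c m) * e m by rewrite combS addrK.
apply: (le_trans (absB Hg _ _)); rewrite mulrDl mul1r lerD2l (absM Hg) phi_abs.
by rewrite mulrAC ler_wpM2r ?ge0.
Qed.

Lemma comb_free_closed m y : comb_free m ->
  (forall d : R, 0 < d -> exists c, g (y - comb m c) < d) -> exists c, y = comb m c.
Proof. by move=> /comb_free_bounded[C C0 hC]; exact: comb_closed C0 hC. Qed.

End FiniteDimension.

Lemma has_degree_uniq (F L : fieldType) (phi : {rmorphism F -> L}) d d' :
  has_degree phi d -> has_degree phi d' -> d = d'.
Proof.
suff h d1 d2 : has_degree phi d1 -> has_degree phi d2 -> (d1 <= d2)%N.
  by move=> h1 h2; apply/eqP; rewrite eqn_leq !h.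
move=> [e he] [e' he'].
have /choice[A hA] : forall i : 'I_d1, exists c : 'rV[F]_d2, e i = \sum_(j < d2) phi (c 0 j) * e' j.
  by move=> i; have [c [hc _]] := he' (e i); exists c.
have /choice[B hB] : forall i : 'I_d2, exists c : 'rV[F]_d1, e' i = \sum_(j < d1) phi (c 0 j) * e j.
  by move=> i; have [c [hc _]] := he (e' i); exists c.
pose MA := \matrix_(i < d1, j < d2) A i 0 j; pose MB := \matrix_(i < d2, j < d1) B i 0 j.
apply: (@mulmx1_min _ d1 d2 MA MB); apply/row_matrixP => i.
have [c [_ uc]] := he (e i).
rewrite -[LHS](uc (row i (MA *m MB))).
  apply: uc; rewrite (bigD1 i) //= !mxE eqxx rmorph1 mul1r big1 ?addr0 // => j ji.
  by rewrite !mxE eq_sym (negPf ji) rmorph0 mul0r.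
rewrite hA; under eq_bigr => j _ do rewrite hB mulr_sumr.
rewrite exchange_big; apply: eq_bigr => j _ /=.
rewrite !mxE rmorph_sum mulr_suml; apply: eq_bigr => l _.
by rewrite !mxE rmorphM mulrA.
Qed.

(** * Norms of number fields and existence of places *)

(** Sylvester's identity, from two block triangular factorizations involving [X]. *)
Lemma det_1D_mulmxC (R : comNzRingType) m n (A : 'M[R]_(m, n)) (B : 'M[R]_(n, m)) :
  \det (1%:M + A *m B) = \det (1%:M + B *m A).
Proof.
pose X := block_mx (1%:M : 'M[R]_m) (- A) B (1%:M : 'M[R]_n).
have e1 : block_mx (1%:M + A *m B) 0 B 1%:M = block_mx 1%:M A 0 1%:M *m X.
  by rewrite mulmx_block !mul1mx !mul0mx !mulmx1 add0r addNr add0r.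
have e2 : block_mx 1%:M 0 B 1%:M *m block_mx 1%:M (- A) 0 (1%:M + B *m A) = X.
  rewrite mulmx_block !mul1mx !mul0mx !mulmx1 ?mulmx0 !addr0.
  by rewrite mulmxN addrCA addNr addr0.
have := congr1 determinant e1; rewrite det_mulmx det_lblock det_ublock !det1 !mulr1 mul1r => ->.
by rewrite -e2 det_mulmx det_lblock det_ublock !det1 !mul1r.
Qed.

(** A rank factorization [E = B A] of an idempotent satisfies [A B = 1], so Sylvester's identity
    reduces the determinant to that of a scalar matrix of size [\rank E]. *)
Lemma det_idempotent (F : fieldType) n (E : 'M[F]_n) (x : F) : E *m E = E ->
  \det (1%:M + x *: E) = (1 + x) ^+ \rank E.
Proof.
move=> EE.
move: (col_base_full E) (row_base_free E) (mulmx_base E).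
move: (\rank E) (col_base E) (row_base E) => r B A fB fA eE.
have AB : A *m B = 1%:M.
  apply: (row_free_inj fA); apply: (row_full_inj fB).
  by rewrite mul1mx !mulmxA eE -mulmxA eE EE.
rewrite -eE scalemxAl det_1D_mulmxC -scalemxAr AB -[X in X + _]scale1r -scalerDl.
by rewrite scalemx1 det_scalar.
Qed.

Lemma companion_exists (R : comNzRingType) n (f : {poly R}) :
  f \is monic -> size f = n.+2 ->
  exists2 C : 'M[R]_n.+1, char_poly C = f &
    forall i : 'I_n.+1, delta_mx 0 0 *m C ^+ i = delta_mx 0 i :> 'rV_n.+1.
Proof.
move=> fm sf; have e : (size f).-1 = n.+1 by rewrite sf.
suff [C cC cyc] : exists2 C : 'M[R]_((size f).-1), char_poly C = f &
    forall (i j : 'I_((size f).-1)), j = i.+1 :> nat -> delta_mx 0 i *m C = delta_mx 0 j :> 'rV_((size f).-1).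
  move: C cC cyc; rewrite e => C cC cyc; exists C => //; case=> i; elim: i => [|i IH] hi.
    by rewrite expr0 mulmx1; congr delta_mx; exact: val_inj.
  rewrite exprSr -[_ * C]/(_ *m C) mulmxA (IH (ltnW hi)).
  exact: (cyc (Ordinal (ltnW hi)) (Ordinal hi)).
exists (companionmx f); first exact: companionmxK.
move=> i j ij; have h : (i.+1 < (size f).-1)%N by rewrite -ij.
by rewrite (mulmx_delta_companion h); congr delta_mx; exact: val_inj.
Qed.

(** * Cyclic matrices and the quotient by their characteristic polynomial *)

Section CyclicMatrix.
Variables (F : fieldType) (n : nat) (C : 'M[F]_n.+1).

(** The first basis row vector generates the space: [g] goes to [e_0 g(C)], which identifies row
    vectors with polynomials modulo [char_poly C]. *)
Definition cyclic_mx :=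
  forall i : 'I_n.+1, delta_mx 0 0 *m C ^+ i = delta_mx 0 i :> 'rV_n.+1.

Hypothesis cyc : cyclic_mx.
Let f := char_poly C.

Lemma cyclic_horner (g : {poly F}) : (size g <= n.+1)%N ->
  delta_mx 0 0 *m horner_mx C g = poly_rV g :> 'rV_n.+1.
Proof.
move=> sg; rewrite -[in LHS](poly_rV_K sg).
rewrite (_ : rVpoly _ = \sum_(i < n.+1) (poly_rV g) 0 i *: 'X^i); last first.
  by rewrite /rVpoly poly_def; apply: eq_bigr => i _; rewrite insubT /= ?ltn_ord // => h; congr (_ *: _); congr fun_of_matrix; exact: val_inj.
rewrite rmorph_sum mulmx_sumr [RHS]row_sum_delta; apply: eq_bigr => i _.
by rewrite /= horner_mxZ rmorphXn /= horner_mx_X -scalemxAr cyc.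
Qed.

Lemma cyclic_horner_eq0 (g : {poly F}) :
  (delta_mx 0 0 *m horner_mx C g == 0 :> 'rV_n.+1) = (f %| g).
Proof.
have CH : horner_mx C f = 0 := Cayley_Hamilton C.
have fm : f \is monic := char_poly_monic C.
rewrite {1}(divp_eq g f) rmorphD rmorphM /= CH mulr0 add0r cyclic_horner; last first.
  by rewrite -ltnS -(size_char_poly C) ltn_modp monic_neq0.
rewrite /dvdp; apply/eqP/eqP => [h|->]; last exact: linear0.
have sm : (size (g %% f)%R <= n.+1)%N.
  by rewrite -ltnS -(size_char_poly C) ltn_modp monic_neq0.
by rewrite -(poly_rV_K sm) h linear0.
Qed.

Lemma horner_mx_eq0 (g : {poly F}) : (horner_mx C g == 0) = (f %| g).
Proof.
apply/eqP/idP => [h|/dvdpP[q ->]].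
  by rewrite -cyclic_horner_eq0 h mulmx0.
by rewrite rmorphM /= (Cayley_Hamilton C) mulr0.
Qed.

(** The first [deg p] basis vectors stay independent under [g(C)]: if the combination given by a
    polynomial [c] of smaller degree is killed, then [f], hence [p], divides [c * g], so [p] divides
    [c] and [c = 0]. *)
Lemma rank_horner_ge (p h g : {poly F}) : f = p * h -> coprimep p g ->
  ((size p).-1 <= \rank (horner_mx C g))%N.
Proof.
move=> fE cpg; set d := (size p).-1.
pose X : 'M[F]_(d, n.+1) := \matrix_(i < d) (delta_mx 0 0 *m C ^+ i : 'rV_n.+1).
suff rf : row_free (X *m horner_mx C g).
  by apply: leq_trans (mxrankM_maxr X _); rewrite (eqP rf).
apply/inj_row_free => c hc; have p0 : p != 0.
  by apply: contraTneq (char_poly_monic C) => p0; rewrite -/f fE p0 mul0r monicE lead_coef0 eq_sym oner_eq0.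
have e : c *m X = delta_mx 0 0 *m horner_mx C (rVpoly c).
  rewrite mulmx_sum_row (_ : rVpoly c = \sum_(i < d) c 0 i *: 'X^i); last first.
    by rewrite /rVpoly poly_def; apply: eq_bigr => i _; rewrite insubT /= ?ltn_ord // => h'; congr (_ *: _); congr fun_of_matrix; exact: val_inj.
  rewrite rmorph_sum mulmx_sumr; apply: eq_bigr => i _.
  by rewrite rowK /= horner_mxZ rmorphXn /= horner_mx_X -scalemxAr.
move: hc; rewrite mulmxA e -mulmxA -[_ *m horner_mx C g]/(_ * _) -rmorphM /=.
move/eqP; rewrite cyclic_horner_eq0 => fd.
have : p %| rVpoly c * g by apply: dvdp_trans fd; rewrite fE dvdp_mulr.
rewrite Gauss_dvdpl // => /dvdp_leq; have [c0 _|c0 /(_ isT)] := eqVneq (rVpoly c) 0.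
  by rewrite -(rVpolyK c) c0 linear0.
rewrite leqNgt (leq_ltn_trans (size_poly _ _)) // /d.
by rewrite ltn_predL lt0n size_poly_eq0.
Qed.

(* With [u p + s h = 1], the class of [s h] is the idempotent which is 1 modulo
   [p] and 0 modulo [h]. *)
Lemma det_coprime_idempotent (p h u s : {poly F}) (x : F) :
  f = p * h -> u * p + s * h = 1 ->
  \det (1%:M + x *: horner_mx C (s * h)) = (1 + x) ^+ (size p).-1.
Proof.
move=> fE bez; set E := horner_mx C (s * h).
have E1 : 1 - E = horner_mx C (u * p) by rewrite -[u * p](addrK (s * h)) bez rmorphB rmorph1.
have EE0 : E *m (1 - E) = 0.
  rewrite E1 -[_ *m _]/(_ * _) -rmorphM /=; apply/eqP; rewrite horner_mx_eq0 fE.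
  by rewrite mulrCA -mulrA [h * p]mulrC mulrA dvdp_mull.
have EE : E *m E = E.
  by move: EE0; rewrite mulmxBr mulmx1 => /eqP; rewrite subr_eq0 => /eqP.
have f0 : f != 0 := monic_neq0 (char_poly_monic C).
have [p0 h0] : p != 0 /\ h != 0 by move: f0; rewrite fE mulf_eq0 => /norP[].
have cph : coprimep p h.
  by apply/Bezout_eq1_coprimepP; exists (u, s).
have cps : coprimep p s.
  by apply/Bezout_eq1_coprimepP; exists (u, h); rewrite /= [h * s]mulrC.
have chu : coprimep h u.
  by apply/Bezout_eq1_coprimepP; exists (s, p); rewrite /= addrC [p * u]mulrC.
(* The lower bounds [deg p] and [deg h] on the two ranks add up to the size of the matrix, while
   [E (1 - E) = 0] bounds the sum of the ranks by that size; so both are equalities. *)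
have r1 : ((size p).-1 <= \rank E)%N.
  by apply: (rank_horner_ge fE); rewrite coprimepMr cps.
have r2 : ((size h).-1 <= \rank (1 - E)%R)%N.
  rewrite E1; apply: (@rank_horner_ge h p); first by rewrite mulrC.
  by rewrite coprimepMr chu coprimep_sym.
have r3 : (\rank E + \rank (1 - E)%R <= n.+1)%N := mulmx0_rank_max EE0.
have sf : ((size p).-1 + (size h).-1 = n.+1)%N.
  have := size_char_poly C; rewrite -/f fE size_mul // => e.
  move: p0 h0 e; rewrite -!size_poly_gt0.
  by case: (size p) => [|i]; case: (size h) => [|j] //= _ _; rewrite ?addSn ?addnS /= ?addnS => -[].
rewrite det_idempotent //; congr (_ ^+ _); apply/eqP; rewrite eqn_leq r1 andbT.
by rewrite -(leq_add2r (size h).-1) sf (leq_trans _ r3) // leq_add2l.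
Qed.

End CyclicMatrix.

(** * Number fields through a primitive element: norms and places *)

Section NumberField.
Variable K : fieldExtType rat.

(** Presents [K] as Q[X]/(f) with a cyclic matrix of characteristic polynomial [f], so that norms
    are determinants of rational matrices and base change to [Q_v] is entrywise. [gen_deg] is the
    degree minus 1, which makes the matrix size visibly positive. *)
Record generator := Generator {
  gen_deg : nat;
  gen : K;
  gen_mx : 'M[rat]_gen_deg.+1;
  gen_dim : \dim {:K} = gen_deg.+1;
  gen_cyclic : cyclic_mx gen_mx;
  gen_separable : separable_poly (char_poly gen_mx);
  gen_eq0 : forall g, (horner_alg gen g == 0) = (char_poly gen_mx %| g);
  gen_surj : forall z, exists g, horner_alg gen g = z }.

Lemma generator_exists : inhabited generator.
Proof.
have char0 : [pchar K] =i pred0 by move=> p; rewrite pchar_lalg pchar_num.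
have sepK (E : {subfield K}) : separable 1 E.
  by apply/separableP => y _; exact: pcharf0_separable.
have := eq_adjoin_separable_generator (sepK {:K}%AS) (sub1v _).
set t := separable_generator _ _ => defK.
have sept : separable_element 1 t := pcharf0_separable _ char0 t.
have /polyOver1P[f0 Df] := minPolyOver 1%AS t.
have dimK : \dim {:K} = (adjoin_degree 1%AS t).
  by rewrite [in LHS]defK dim_Fadjoin dimv1 muln1.
case Dn : (adjoin_degree 1%AS t) dimK => [|n] dimK.
  by move: Dn; rewrite /adjoin_degree.
have sf0 : size f0 = n.+2.
  by have := size_minPoly 1%AS t; rewrite Df size_map_poly Dn.
have f0m : f0 \is monic.
  by have := monic_minPoly 1%AS t; rewrite Df map_monic.
have [C DC cycC] := companion_exists f0m sf0.
exists; apply: (@Generator n t C) => //.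
- by rewrite DC; move: sept; rewrite /separable_element Df separable_map.
- move=> g; rewrite DC; apply/eqP/idP => [h|/dvdpP[q ->]].
    rewrite -(dvdp_map (in_alg K)) -Df; apply: minPoly_dvdp; first exact: alg_polyOver.
    exact/rootP.
  by rewrite /horner_alg /horner_morph rmorphM /= hornerM -Df minPolyxx mulr0.
- move=> z; have : z \in <<1; t>>%VS by rewrite -defK memvf.
  by move=> /Fadjoin1_polyP[p ->]; exists p.
Qed.

Variable G : generator.
Local Notation n := (gen_deg G).+1.
Local Notation t := (gen G).
Local Notation C := (gen_mx G).

Definition gen_poly (z : K) : {poly rat} := projT1 (cid (gen_surj G z)).

Lemma gen_polyK z : horner_alg t (gen_poly z) = z.
Proof. by rewrite /gen_poly; case: cid. Qed.

(** Multiplication by [z] in the basis of powers of the generator. *)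
Definition regular_mx (z : K) : 'M[rat]_n := horner_mx C (gen_poly z).

(** Two polynomials with the same value at the generator differ by a multiple of the characteristic
    polynomial, so the choice made by [gen_poly] does not matter. *)
Lemma regular_mxE g : regular_mx (horner_alg t g) = horner_mx C g.
Proof.
apply/eqP; rewrite -subr_eq0 -rmorphB /= (horner_mx_eq0 (@gen_cyclic G)).
by rewrite -gen_eq0 rmorphB /= gen_polyK subrr.
Qed.

Lemma regular_mx1 : regular_mx 1 = 1.
Proof. by rewrite -(rmorph1 (horner_alg t)) regular_mxE rmorph1. Qed.

Lemma regular_mxM x y : regular_mx (x * y) = regular_mx x * regular_mx y.
Proof. by rewrite -{1}(gen_polyK x) -{1}(gen_polyK y) -rmorphM regular_mxE rmorphM. Qed.

Lemma regular_mxD x y : regular_mx (x + y) = regular_mx x + regular_mx y.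
Proof. by rewrite -{1}(gen_polyK x) -{1}(gen_polyK y) -rmorphD regular_mxE rmorphD. Qed.

Lemma regular_mx_alg (q : rat) : regular_mx q%:A = q%:M.
Proof. by rewrite -(horner_algC t) regular_mxE horner_mx_C. Qed.

Lemma regular_mx0 : regular_mx 0 = 0.
Proof. by rewrite -(rmorph0 (horner_alg t)) regular_mxE rmorph0. Qed.

Definition field_norm (z : K) : rat := \det (regular_mx z).

Lemma field_normM x y : field_norm (x * y) = field_norm x * field_norm y.
Proof. by rewrite /field_norm regular_mxM det_mulmx. Qed.

Lemma field_norm1 : field_norm 1 = 1.
Proof. by rewrite /field_norm regular_mx1 det1. Qed.

Lemma field_norm_alg q : field_norm q%:A = q ^+ n.
Proof. by rewrite /field_norm regular_mx_alg det_scalar. Qed.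

Lemma field_norm_eq0 z : z != 0 -> field_norm z != 0.
Proof.
move=> z0; apply/eqP => h; have := field_norm1.
by rewrite -(divff z0) field_normM h mul0r => /eqP; rewrite eq_sym oner_eq0.
Qed.

Lemma field_normX z k : field_norm (z ^+ k) = field_norm z ^+ k.
Proof. by elim: k => [|k IH]; rewrite ?field_norm1 // !exprS field_normM IH. Qed.

Lemma field_norm_prod I (r : seq I) (P : pred I) (F : I -> K) :
  field_norm (\prod_(i <- r | P i) F i) = \prod_(i <- r | P i) field_norm (F i).
Proof. exact: (big_morph _ field_normM field_norm1). Qed.

Lemma field_normV z : field_norm z^-1 = (field_norm z)^-1.
Proof.
have [->|z0] := eqVneq z 0.
  rewrite invr0 -(scale0r 1) field_norm_alg expr0n /= invr0 //.
apply: (mulfI (field_norm_eq0 z0)).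
by rewrite -field_normM !divff ?field_norm_eq0 // field_norm1.
Qed.

Section Places.
Variables (R : realType) (a : rat -> R).
Hypothesis Ha : is_absolute_value a.

Definition places : set (K -> R) :=
  [set w | is_absolute_value w /\ forall q : rat, w q%:A = a q].

Definition entry_norm (z : K) : R := \sum_i \sum_j a (regular_mx z i j).

Lemma entry_norm_ge i j z : a (regular_mx z i j) <= entry_norm z.
Proof.
rewrite /entry_norm (bigD1 i) //= (bigD1 j) //= -addrA lerDl addr_ge0 //.
  by apply: sumr_ge0 => *; exact: abs_ge0.
by apply: sumr_ge0 => *; apply: sumr_ge0 => *; exact: abs_ge0.
Qed.

Lemma entry_norm_ge0 z : 0 <= entry_norm z.
Proof. by apply: sumr_ge0 => *; apply: sumr_ge0 => *; exact: abs_ge0. Qed.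

Lemma entry_norm_submult : submult entry_norm.
Proof.
split.
- exact: entry_norm_ge0.
- rewrite /entry_norm regular_mx0; apply: big1 => i _; apply: big1 => j _.
  by rewrite mxE (abs0 Ha).
- apply: lt_le_trans (entry_norm_ge 0 0 1).
  by rewrite regular_mx1 mxE eqxx (abs1 Ha).
- move=> x y; rewrite /entry_norm -big_split; apply: ler_sum => i _ /=.
  rewrite -big_split; apply: ler_sum => j _ /=.
  by rewrite regular_mxD mxE (absD Ha).
- move=> x y; rewrite {1 2}/entry_norm mulr_suml; apply: ler_sum => i _.
  apply: (@le_trans _ _ (\sum_j \sum_k a (regular_mx x i k) * a (regular_mx y k j))).
    apply: ler_sum => j _; rewrite regular_mxM mxE.
    apply: (le_trans (abs_sum Ha _ _ _)); apply: ler_sum => k _.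
    by rewrite (absM Ha).
  rewrite exchange_big /= mulr_suml; apply: ler_sum => k _.
  rewrite -mulr_sumr ler_wpM2l ?(abs_ge0 Ha) //.
  rewrite /entry_norm [leRHS](bigD1 k) //= lerDl.
  by apply: sumr_ge0 => *; apply: sumr_ge0 => *; exact: abs_ge0.
Qed.

Lemma abs_norm_le_entry z : a (field_norm z) <= n`!%:R * entry_norm z ^+ n.
Proof.
apply: (le_trans (abs_sum Ha _ _ _)).
apply: (@le_trans _ _ (\sum_(s : {perm 'I_n}) entry_norm z ^+ n)); last first.
  by rewrite sumr_const (card_Sn n) mulr_natl.
apply: ler_sum => s _; rewrite (absM Ha).
have -> : a ((-1) ^+ s) = 1.
  by rewrite (absX Ha) (absN Ha) (abs1 Ha) expr1n.
rewrite mul1r (abs_prod Ha) -[X in entry_norm z ^+ X]card_ord -prodr_const.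
by apply: ler_prod => i _; rewrite (abs_ge0 Ha) entry_norm_ge.
Qed.

Lemma exists_place_norm_le z : z != 0 ->
  exists2 w, places w & a (field_norm z) <= w z ^+ n.
Proof.
move=> z0; set x := a (field_norm z).
have x0 : 0 < x by rewrite (abs_gt0 Ha) field_norm_eq0.
(* The root of [|N(z)|] of order [n]. By multiplicativity of the norm, [s ^ (k n) = |N(z^k)|], which
   is at most [n!] times the [n]-th power of the matrix norm of [z^k]; as a constant, [n!] also
   bounds its own [n]-th root. *)
pose s := x `^ (n%:R^-1).
have s0 : 0 < s by exact: powR_gt0.
have sn : s ^+ n = x.
  by rewrite -powR_mulrn ?powR_ge0 // -powRrM mulVf ?pnatr_eq0 // powRr1 // ltW.
have sub := entry_norm_submult.
have [|w [absw wsp sw]] := @absolute_value_below _ _ entry_norm z s n`!%:R sub s0.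
  move=> k; rewrite -(@ler_pXn2r _ n) // ?nnegrE ?exprn_ge0 ?mulr_ge0 ?entry_norm_ge0 ?(ltW s0) //.
  rewrite -exprM mulnC exprM sn -(absX Ha) -field_normX.
  apply: (le_trans (abs_norm_le_entry _)); rewrite exprMn ler_wpM2r ?exprn_ge0 ?entry_norm_ge0 //.
  by rewrite -natrX ler_nat expnS leq_pmulr // expn_gt0 fact_gt0.
exists w; last by rewrite -sn; apply: lerXn2r; rewrite ?nnegrE ?(abs_ge0 absw) ?(ltW s0).
split => //.
(* Scalar matrices have spectral radius at most [a q]; the same bound at the inverse of [q] gives
   the opposite inequality. *)
have wq q : w q%:A <= a q.
  apply: (le_trans (wsp _)); apply: (spectral_le).
  split; first exact: abs_ge0.
  exists (entry_norm 1) => k; rewrite -(rmorphXn (in_alg K)) /= /entry_norm mulr_suml.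
  apply: ler_sum => i _; rewrite mulr_suml; apply: ler_sum => j _.
  rewrite regular_mx_alg regular_mx1 !mxE -[a _ * _]mulrC -(absX Ha) -(absM Ha).
  by rewrite mulr_natr.
move=> q; apply/eqP; rewrite eq_le wq /=.
have [->|q0] := eqVneq q 0; first by rewrite scale0r (abs0 Ha) (abs0 absw).
have := wq q^-1; rewrite -[q^-1%:A]/(in_alg K q^-1) fmorphV /= (absV absw) (absV Ha).
rewrite lef_pV2 // posrE ?(abs_gt0 Ha) // (abs_gt0 absw).
by rewrite -[q%:A]/(in_alg K q) fmorph_eq0.
Qed.

End Places.
End NumberField.

(** * The local norm formula *)

Section LogAbs.
Variables (R : realType) (F : fieldType) (f : F -> R).
Hypothesis Hf : is_absolute_value f.

Definition lnabs (x : F) : R := ln (f x).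

Lemma lnabsM x y : x != 0 -> y != 0 -> lnabs (x * y) = lnabs x + lnabs y.
Proof. by move=> x0 y0; rewrite /lnabs (absM Hf) lnM // posrE (abs_gt0 Hf). Qed.

Lemma lnabs1 : lnabs 1 = 0.
Proof. by rewrite /lnabs (abs1 Hf) ln1. Qed.

Lemma lnabsV x : lnabs x^-1 = - lnabs x.
Proof.
have [->|x0] := eqVneq x 0; first by rewrite invr0 /lnabs (abs0 Hf) ln0 ?oppr0.
by rewrite /lnabs (absV Hf) lnV // posrE (abs_gt0 Hf).
Qed.

Lemma lnabsX x n : x != 0 -> lnabs (x ^+ n) = n%:R * lnabs x.
Proof.
move=> x0; elim: n => [|n IH]; first by rewrite mul0r lnabs1.
by rewrite exprS lnabsM ?expf_neq0 // IH -natr1 mulrDl mul1r addrC.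
Qed.

Lemma lnabs_expz x (m : int) : x != 0 -> lnabs (x ^ m) = m%:~R * lnabs x.
Proof.
move=> x0; case: m => n; first by rewrite lnabsX.
by rewrite NegzE -exprnN lnabsV lnabsX // mulrNz mulNr.
Qed.

Lemma lnabs_prod I (r : seq I) (P : pred I) (x : I -> F) : (forall i, x i != 0) ->
  lnabs (\prod_(i <- r | P i) x i) = \sum_(i <- r | P i) lnabs (x i).
Proof.
move=> h; suff [] : lnabs (\prod_(i <- r | P i) x i) = \sum_(i <- r | P i) lnabs (x i)
  /\ \prod_(i <- r | P i) x i != 0 by [].
elim/big_rec2: _ => [|i y z _ [<- y0]]; first by rewrite lnabs1 oner_neq0.
by rewrite lnabsM // mulf_neq0.
Qed.

Lemma lnabs_lt0 x : x != 0 -> (lnabs x < 0) = (f x < 1).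
Proof. by move=> x0; rewrite -lnabs1 /lnabs (abs1 Hf) ltr_ln // posrE ?(abs_gt0 Hf). Qed.

End LogAbs.

(** Otherwise [w z < 1] would always imply [w' z < 1], whence [w' <= w] and, by inversion, equality.
    The common value [a q > 1] calibrates the two absolute values against each other. *)
Lemma places_separated (R : realType) (K : fieldExtType rat) (a : rat -> R) (q : rat)
    (w w' : K -> R) : is_absolute_value a -> 1 < a q -> places a w -> places a w' ->
  w' <> w -> exists z, w z < 1 <= w' z.
Proof.
move=> Ha aq [Hw wq] [Hw' w'q] ne; apply: contrapT => h.
have imp z : w z < 1 -> w' z < 1.
  by move=> wz; rewrite ltNge; apply/negP => w'z; apply: h; exists z; rewrite wz.
have q0 : q != 0.
  by apply: contraTneq aq => ->; rewrite (abs0 Ha) ltNge ler01.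
have qK : q%:A != 0 :> K by rewrite -[q%:A]/(in_alg K q) fmorph_eq0.
suff le z : w' z <= w z.
  apply: ne; apply/funext => z; apply/eqP; rewrite eq_le le /=.
  have [->|z0] := eqVneq z 0; first by rewrite (abs0 Hw) (abs0 Hw').
  have := le z^-1; rewrite (absV Hw) (absV Hw') lef_pV2 // posrE.
    by rewrite (abs_gt0 Hw').
  by rewrite (abs_gt0 Hw).
rewrite leNgt; apply/negP => lt.
have z0 : z != 0 by apply: contraTneq lt => ->; rewrite (abs0 Hw) (abs0 Hw') ltxx.
pose A := ln (a q); have A0 : 0 < A by rewrite ln_gt0.
pose x := lnabs w z; pose y := lnabs w' z.
have xy : 0 < y - x by rewrite subr_gt0 /x /y /lnabs ltr_ln // posrE ?(abs_gt0 Hw) ?(abs_gt0 Hw').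
(* [n] is so large that some [m * A] lies between [n * x] and [n * y]; dividing [z ^+ n] by the
   power [m] of [q] then gives [w u < 1 <= w' u]. *)
pose n := Num.bound (A / (y - x)).
have nA : A < n%:R * (y - x).
  by rewrite -ltr_pdivrMr //; apply: archi_boundP; rewrite divr_ge0 // ltW.
pose m := Num.floor (n%:R * y / A).
have /andP[m1 m2] := floor_itv (n%:R * y / A); rewrite -/m in m1 m2.
rewrite ler_pdivlMr // in m1; rewrite intrD ltr_pdivrMr // mulrDl mul1r in m2.
pose u := z ^+ n * (q%:A ^ m)^-1.
have qm : q%:A ^ m != 0 :> K by rewrite expfz_neq0.
have u0 : u != 0 by rewrite mulf_neq0 ?invr_neq0 ?expf_neq0.
have lu f : places a f -> lnabs f u = n%:R * lnabs f z - m%:~R * A.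
  move=> [Hf fq]; rewrite /u lnabsM ?invr_neq0 ?expf_neq0 // lnabsX // lnabsV // lnabs_expz //.
  by rewrite {2}/lnabs fq.
have := imp u; rewrite -(lnabs_lt0 Hw) // -(lnabs_lt0 Hw') //.
rewrite (lu w) // (lu w') // -/x -/y; move: nA; rewrite mulrBr => nA h1.
have h2 : n%:R * x - m%:~R * A < 0 by lra.
have := h1 h2; lra.
Qed.

(** * A place seen through an arbitrary model of its completion *)

Section Model.
Variables (R : realType) (K : fieldExtType rat) (G : generator K).
Variables (a : rat -> R) (w : K -> R).
Hypotheses (Ha : is_absolute_value a) (Hw : places a w).
Variables (Qv Kw : fieldType) (jQ : {rmorphism rat -> Qv}) (b : Qv -> R).
Variables (jK : {rmorphism K -> Kw}) (c : Kw -> R) (phi : {rmorphism Qv -> Kw}).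
Hypotheses (HQ : is_completion a jQ b) (HK : is_completion w jK c).
Hypothesis phi_j : forall q : rat, phi (jQ q) = jK q%:A.
Hypothesis phi_abs : forall y, c (phi y) = b y.

Local Notation t := (gen G).
Local Notation C := (gen_mx G).
Local Notation n := (gen_deg G).+1.
Local Notation ev := (horner_alg t).

Let Hb : is_absolute_value b. Proof. by case: HQ. Qed.
Let Hc : is_absolute_value c. Proof. by case: HK. Qed.
Let Hw1 : is_absolute_value w. Proof. by case: Hw. Qed.
Let bj q : b (jQ q) = a q. Proof. by case: HQ. Qed.
Let cj x : c (jK x) = w x. Proof. by case: HK. Qed.

Let tau := jK t.
Let f := char_poly C.
Let fv := map_poly jQ f.
Let Cv := map_mx jQ C.

(** Evaluation at the generator, from [Qv[X]] to [Kw]; its kernel is generated by the factor of [f]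
    attached to the place. *)
Definition local_eval (g : {poly Qv}) : Kw := (map_poly phi g).[jK t].
Local Notation evw := local_eval.

Lemma local_evalD g h : evw (g + h) = evw g + evw h.
Proof. by rewrite /local_eval rmorphD hornerD. Qed.
Lemma local_evalM g h : evw (g * h) = evw g * evw h.
Proof. by rewrite /local_eval rmorphM hornerM. Qed.
Lemma local_eval1 : evw 1 = 1.
Proof. by rewrite /local_eval rmorph1 hornerC. Qed.

Lemma local_eval_map g : evw (map_poly jQ g) = jK (ev g).
Proof.
rewrite /local_eval /horner_alg /horner_morph -horner_map; congr (_.[_]).
rewrite -!map_poly_comp; apply: eq_map_poly => q; exact: phi_j.
Qed.

Lemma local_eval_char_poly : evw fv = 0.
Proof.
rewrite local_eval_map; suff /eqP -> : ev f == 0 by rewrite rmorph0.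
by rewrite gen_eq0.
Qed.

Let tpow (i : nat) : Kw := tau ^+ i.

Lemma comb_poly d (x : nat -> Qv) : comb phi tpow d x = evw (\poly_(i < d) x i).
Proof.
rewrite /local_eval (horner_coef_wide _ (n := d)) ?size_map_poly ?size_poly //.
by apply: eq_bigr => i _; rewrite coef_map coef_poly ltn_ord.
Qed.

Lemma local_eval_comb (g : {poly Qv}) d : (size g <= d)%N ->
  evw g = comb phi tpow d (fun i => g`_i).
Proof.
move=> sg; rewrite comb_poly; congr evw; apply/polyP => i; rewrite coef_poly.
by case: ltnP => // /(leq_trans sg) h; rewrite nth_default.
Qed.

Lemma local_minpoly_exists : exists p : {poly Qv},
  [/\ p != 0, (1 < size p)%N & forall g, (evw g == 0) = (p %| g)].
Proof.
have fv0 : fv != 0 by rewrite map_poly_eq0 monic_neq0 // char_poly_monic.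
pose P (m : nat) := `[< exists g : {poly Qv}, [/\ g != 0, size g = m & evw g = 0] >].
have exP : exists m, P m.
  by exists (size fv); apply/asboolP; exists fv; split => //; exact: local_eval_char_poly.
case: (ex_minnP exP) => m /asboolP[p [p0 sp evp]] pmin.
have dvd g : (evw g == 0) = (p %| g).
  apply/idP/idP => [/eqP h|/dvdpP[q ->]]; last by rewrite local_evalM evp mulr0.
  apply: contraT => ndvd.
  have : (m <= size (g %% p)%R)%N.
    apply: pmin; apply/asboolP; exists (g %% p); split => //.
    have := h; rewrite {1}(divp_eq g p) local_evalD local_evalM evp mulr0 add0r.
    by [].
  by rewrite leqNgt -sp ltn_modp p0.
exists p; split => //.
rewrite ltnNge; apply/negP => /size1_polyC pC; move: evp p0; rewrite pC.
by rewrite /local_eval map_polyC hornerC /= => /eqP; rewrite fmorph_eq0 => /eqP ->; rewrite eqxx.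
Qed.

Section MinimalPolynomial.
Variable p : {poly Qv}.
Hypotheses (p0 : p != 0) (sp : (1 < size p)%N).
Hypothesis evp : forall g, (evw g == 0) = (p %| g).
Let d := (size p).-1.

Let sizep : size p = d.+1.
Proof. by rewrite /d prednK // (ltn_trans _ sp). Qed.

Lemma tpow_free : comb_free phi tpow d.
Proof.
move=> x; rewrite comb_poly => /eqP; rewrite evp => dv i im.
suff e : \poly_(i < d) x i = 0.
  by have := congr1 (fun g : {poly _} => g`_i) e; rewrite coef_poly im coef0.
apply/eqP; apply: contraT => nz; have := dvdp_leq nz dv.
by rewrite sizep ltnNge size_poly.
Qed.

Lemma local_eval_mod g : evw (g %% p) = evw g.
Proof.
rewrite {2}(divp_eq g p) local_evalD local_evalM.
have /eqP -> : evw p == 0 by rewrite evp.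
by rewrite mulr0 add0r.
Qed.

(** The span of the powers of [t] is closed, being finite dimensional over a complete field, and it
    contains the image of [K], which is dense. *)
Lemma tpow_span y : exists x, y = comb phi tpow d x.
Proof.
have [_ _ _ bC] := HQ.
apply: (comb_free_closed Hb Hc phi_abs bC tpow_free) => e e0.
have [_ _ dense _] := HK; have [x hx] := dense y e e0.
exists (fun i => (map_poly jQ (gen_poly G x) %% p)`_i).
rewrite -local_eval_comb; first by rewrite local_eval_mod local_eval_map gen_polyK.
by rewrite -ltnS -sizep ltn_modp.
Qed.

Lemma local_has_degree : has_degree phi d.
Proof.
exists (fun i : 'I_d => tpow i) => y; have [x ->] := tpow_span y.
exists (\row_i x i); split.
  by apply: eq_bigr => i _; rewrite mxE.
move=> z hz; apply/rowP => i; rewrite mxE; apply/eqP; rewrite -subr_eq0; apply/eqP.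
pose z' (j : nat) := oapp (z 0) 0 (insub j : option 'I_d).
have := @tpow_free (fun j => x j - z' j) _ i (ltn_ord i).
rewrite {2}/z' valK /=; apply.
rewrite combB hz; apply/eqP; rewrite subr_eq0; apply/eqP.
by apply: eq_bigr => j _; rewrite /z' valK.
Qed.

End MinimalPolynomial.

(** Elements of [K], represented by rational polynomials, approximate an element of [Qv[X]]
    coefficientwise; the bound on sizes makes evaluation pass to the limit. *)
Definition poly_lim (g : nat -> {poly rat}) (h : {poly Qv}) : Prop :=
  (exists s, forall m, (size (g m) <= s)%N) /\
  forall i, abs_lim b (fun m => jQ (g m)`_i) h`_i.

Lemma poly_lim_cst g : poly_lim (fun=> g) (map_poly jQ g).
Proof.
split=> [|i]; first by exists (size g).
by rewrite coef_map; exact: abs_lim_cst.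
Qed.

Lemma poly_limB g h g' h' : poly_lim g g' -> poly_lim h h' ->
  poly_lim (fun m => g m - h m) (g' - h').
Proof.
move=> [[s sg] hg] [[s' sh] hh]; split=> [|i].
  exists (maxn s s') => m; apply: (leq_trans (size_polyD _ _)); rewrite size_polyN.
  by rewrite geq_max !leq_max sg sh orbT.
rewrite coefB; rewrite (_ : (fun m => _) = fun m => jQ (g m)`_i - jQ (h m)`_i).
  exact: abs_limB.
by apply/funext => m; rewrite coefB rmorphB.
Qed.

Lemma poly_limM g h g' h' : poly_lim g g' -> poly_lim h h' ->
  poly_lim (fun m => g m * h m) (g' * h').
Proof.
move=> [[s sg] hg] [[s' sh] hh]; split=> [|i].
  exists (s + s')%N => m; apply: (leq_trans (size_polyMleq _ _)).
  by rewrite (leq_trans (leq_pred _)) // leq_add.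
rewrite coefM; rewrite (_ : (fun m => _) = fun m => \sum_(j < i.+1) jQ (g m)`_j * jQ (h m)`_(i - j)).
  by apply: abs_lim_sum => // j _; exact: abs_limM.
by apply/funext => m; rewrite coefM rmorph_sum; apply: eq_bigr => j _; rewrite rmorphM.
Qed.

Lemma poly_lim_exists h : exists g, poly_lim g h.
Proof.
have [_ _ dense _] := HQ.
have /choice[x hx] : forall i, exists x : nat -> rat, abs_lim b (fun m => jQ (x m)) h`_i.
  move=> i; have [|u /choice[x ux] hu] := @exists_abs_lim _ _ _ Hb (fun y => exists q, y = jQ q) h`_i.
    by move=> e /(dense h`_i)[q hq]; exists (jQ q) => //; exists q.
  by exists x; rewrite (_ : (fun m => _) = u) //; apply/funext => m; rewrite ux.
exists (fun m => \poly_(i < size h) x i m); split=> [|i].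
  by exists (size h) => m; exact: size_poly.
rewrite (_ : (fun m => _) = fun m => if (i < size h)%N then jQ (x i m) else 0).
  case: ltnP => [//|ih]; rewrite nth_default //; exact: abs_lim_cst.
by apply/funext => m; rewrite coef_poly; case: ifP => //; rewrite rmorph0.
Qed.

Lemma ev_sum (g : {poly rat}) s : (size g <= s)%N -> ev g = \sum_(i < s) (g`_i)%:A * t ^+ i.
Proof.
move=> sg; rewrite /horner_alg /horner_morph (horner_coef_wide _ (n := s)) ?size_map_poly //.
by apply: eq_bigr => i _; rewrite coef_map.
Qed.

(** The limit [h] has no value at a place [w'] other than the one being completed; only this upper
    bound in terms of its coefficients passes to the limit. *)
Lemma poly_lim_place_bound w' g h s : places a w' -> poly_lim g h ->
  (forall m, (size (g m) <= s)%N) ->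
  exists2 u : nat -> R, (forall m, w' (ev (g m)) <= u m) &
    u @ \oo --> \sum_(i < s) b h`_i * w' t ^+ i.
Proof.
move=> [Hw' w'q] [_ hg] sg.
exists (fun m => \sum_(i < s) b (jQ (g m)`_i) * w' t ^+ i).
  move=> m; rewrite (ev_sum (sg m)); apply: (le_trans (abs_sum Hw' _ _ _)).
  by apply: ler_sum => i _; rewrite (absM Hw') w'q (absX Hw') bj.
apply: cvg_sumr => i _; apply: cvgM; last exact: cvg_cst.
exact: (abs_lim_norm Hb (hg i)).
Qed.

Lemma poly_lim0_place w' g : places a w' -> poly_lim g 0 -> abs_lim w' (fun m => ev (g m)) 0.
Proof.
move=> Hw' hg; have [[s sg] _] := hg.
have [u hu cu] := poly_lim_place_bound Hw' hg sg.
apply: (@cvg0_le _ _ u) => [m|]; first by rewrite subr0 hu (abs_ge0 (proj1 Hw')).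
rewrite (_ : 0 = \sum_(i < s) b (0 : {poly Qv})`_i * w' t ^+ i) //.
by rewrite big1 // => i _; rewrite coef0 (abs0 Hb) mul0r.
Qed.

Lemma poly_lim_eval g h : poly_lim g h -> abs_lim c (fun m => jK (ev (g m))) (evw h).
Proof.
move=> [[s sg] hg]; pose S := maxn s (size h).
have sgS m : (size (g m) <= S)%N by rewrite leq_max sg.
rewrite (_ : (fun m => _) = fun m => comb phi tpow S (fun i => jQ (g m)`_i)); last first.
  apply/funext => m; rewrite -local_eval_map (@local_eval_comb _ S) ?size_map_poly //.
  by apply: eq_bigr => i _; rewrite coef_map.
rewrite (@local_eval_comb _ S) ?leq_maxr //; apply: abs_lim_sum => // i _.
apply: abs_limM => //; last exact: abs_lim_cst.
have := hg i; rewrite /abs_lim.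
by under [in X in _ -> X]eq_fun do rewrite -rmorphB phi_abs.
Qed.

Lemma poly_lim_det g h : poly_lim g h ->
  abs_lim b (fun m => jQ (\det (horner_mx C (g m)))) (\det (horner_mx Cv h)).
Proof.
move=> [[s sg] hg]; pose S := maxn s (size h).
have hE (k : {poly Qv}) i j : (size k <= S)%N ->
    horner_mx Cv k i j = \sum_(l < S) k`_l * (Cv ^+ l) i j.
  move=> sk; rewrite (_ : k = \sum_(l < S) k`_l *: 'X^l) ?[in LHS]rmorph_sum; last first.
    rewrite -poly_def; apply/polyP => l; rewrite coef_poly.
    by case: ltnP => // /(leq_trans sk) ?; rewrite nth_default.
  rewrite summxE; apply: eq_bigr => l _.
  rewrite /= horner_mxZ mxE rmorphXn /= horner_mx_X -poly_def coef_poly ltn_ord.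
  by [].
rewrite (_ : (fun m => _) = fun m => \det (horner_mx Cv (map_poly jQ (g m)))); last first.
  by apply/funext => m; rewrite -det_map_mx map_horner_mx.
apply: abs_lim_det => // i j; rewrite hE ?leq_maxr //.
rewrite (_ : (fun m => _) = fun m => \sum_(l < S) jQ (g m)`_l * (Cv ^+ l) i j); last first.
  apply/funext => m; rewrite hE ?size_map_poly ?leq_max ?sg //.
  by apply: eq_bigr => l _; rewrite coef_map.
apply: abs_lim_sum => // l _; apply: abs_limM => //; exact: abs_lim_cst.
Qed.

Lemma cyclic_map : cyclic_mx Cv.
Proof.
move=> i; have := congr1 (map_mx jQ) (@gen_cyclic _ G i).
by rewrite map_mxM rmorphXn /= !map_delta_mx.
Qed.

(* [e] approximates the idempotent of [Qv[T]/(f)] which projects onto the factor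
   [Kw]. For another place [w'], pick [z] with [w z < 1 <= w' z]: the elements
   [e z^k] tend to 0 in this algebra, hence at [w'], which forces [w' e] to 0. *)
Lemma separating_sequence q d : 1 < a q -> has_degree phi d ->
  (0 < d)%N /\ exists e : nat -> K,
    [/\ abs_lim w e 1,
        forall w', places a w' -> w' <> w -> abs_lim w' e 0
      & forall x : rat, (fun m => a (field_norm G (1 + x%:A * e m))) @ \oo --> a (1 + x) ^+ d].
Proof.
move=> aq hd; have [p [p0 sp evp]] := local_minpoly_exists.
have -> : d = (size p).-1 := has_degree_uniq hd (local_has_degree p0 sp evp).
split; first by rewrite -ltnS prednK // (ltn_trans _ sp).
have /dvdpP[h fE] : p %| fv by rewrite -evp; apply/eqP; exact: local_eval_char_poly.
have : separable_poly fv by rewrite separable_map; exact: gen_separable.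
rewrite fE separable_mul => /and3P[_ _]; rewrite coprimep_sym => /Bezout_eq1_coprimepP[[u s] /= bez].
pose e := s * h.
have ewe : evw e = 1.
  have := congr1 local_eval bez; rewrite local_evalD local_evalM local_eval1 => <-.
  by have /eqP -> : evw p == 0; [rewrite evp | rewrite mulr0 add0r].
have [E limE] := poly_lim_exists e.
exists (fun m => ev (E m)); split.
- have := poly_lim_eval limE; rewrite ewe /abs_lim => h1.
  apply: cvg0_le h1 => m; rewrite (abs_ge0 Hw1) -cj rmorphB rmorph1 /=.
  exact: lexx.
- move=> w' Hw' /(places_separated Ha aq Hw Hw')[z /andP[wz w'z]].
  have [Hw'1 w'q] := Hw'.
  have q4 : 0 < 4^-1 :> R by rewrite invr_gt0.
  have [_ _ _ bC] := HQ.
  have [B B0 hB] := comb_free_bounded Hb Hc phi_abs bC (tpow_free sp evp).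
  pose g := map_poly jQ (gen_poly G z).
  have evg k : evw (g ^+ k %% p) = jK z ^+ k.
    rewrite (local_eval_mod evp) -[g ^+ k]rmorphXn /= local_eval_map rmorphXn /=.
    by rewrite gen_polyK rmorphXn.
  pose d' := (size p).-1.
  have sr k : (size (g ^+ k %% p)%R <= d')%N.
    by rewrite -ltnS prednK ?ltn_modp // (ltn_trans _ sp).
  pose S := \sum_(i < d') w' t ^+ i.
  have S0 : 0 <= S by apply: sumr_ge0 => i _; rewrite exprn_ge0 ?(abs_ge0 Hw'1).
  (* The coefficients of [g ^+ k %% p] are controlled by its value [z ^ k] at [w], which tends to 0
     since [w z < 1]; smallness at [w] is thus passed on to [w']. *)
  have hr k : \sum_(i < d') b (g ^+ k %% p)`_i * w' t ^+ i <= B * S * w z ^+ k.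
    rewrite mulrAC mulr_sumr; apply: ler_sum => i _.
    rewrite ler_wpM2r ?exprn_ge0 ?(abs_ge0 Hw'1) //.
    apply: (le_trans (hB (fun i => (g ^+ k %% p)`_i) i (ltn_ord i))).
    by rewrite -local_eval_comb // evg (absX Hc) cj.
  have [k hk] : exists k, B * S * w z ^+ k < 4^-1.
    have := @cvg_geometric R (B * S) (w z); rewrite ger0_norm ?(abs_ge0 Hw1) // => /(_ wz).
    move=> /cvgrPdist_lt/(_ _ q4)[N _ hN].
    exists N; have := hN N (leqnn N); rewrite /= sub0r normrN ger0_norm //.
    by rewrite !mulr_ge0 ?exprn_ge0 ?(abs_ge0 Hw1).
  set r := g ^+ k %% p in hk sr.
  have {}hk := le_lt_trans (hr k) hk; rewrite -/r in hk.
  pose kap := s * (g ^+ k %/ p).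
  (* [e] is a multiple of [h] and [g ^+ k - r] one of [p], so their product is a multiple of [fv],
     and [f] vanishes at the generator. *)
  have eE : e * g ^+ k - e * r - fv * kap = 0.
    rewrite {1}(divp_eq (g ^+ k) p) -/r /e /kap fE; ring.
  have [r' limr0] := poly_lim_exists r.
  (* Truncation to the size of [r], so that the bound at [w'] is exactly the sum over [d'] terms
     estimated in [hk]. *)
  pose rr m : {poly rat} := \poly_(i < d') (r' m)`_i.
  have limr : poly_lim rr r.
    split=> [|i]; first by exists d' => m; exact: size_poly.
    case: (ltnP i d') => id'; last first.
      rewrite nth_default ?(leq_trans (sr k)) // /abs_lim.
      under eq_fun do rewrite coef_poly ltnNge id' /= rmorph0.
      exact: (abs_lim_cst Hb 0).
    rewrite /abs_lim; under eq_fun do rewrite coef_poly id'.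
    by case: limr0 => _ /(_ i).
  have [kk limk] := poly_lim_exists kap.
  have gk : g ^+ k = map_poly jQ (gen_poly G z ^+ k) by rewrite rmorphXn.
  have := poly_limB (poly_limB (poly_limM limE (poly_lim_cst (gen_poly G z ^+ k)))
    (poly_limM limE limr)) (poly_limM (poly_lim_cst f) limk).
  rewrite -gk eE => /(poly_lim0_place Hw') lim0.
  have [v hv cv] := poly_lim_place_bound Hw' limr (fun m => size_poly _ _).
  have ev0 : ev f = 0 by apply/eqP; rewrite gen_eq0.
  have [N0 hN0] : exists N, forall m, (N <= m)%N -> v m < 2^-1.
    move: cv; set l := \sum_(i < d') _ in hk *.
    move=> /cvgrPdist_lt/(_ _ q4)[N _ hN].
    exists N => m /hN /=; rewrite ltr_norml => /andP[h1 _]; lra.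
  apply/(abs_lim_eps Hw'1) => eps eps0.
  have [|N1 hN1] := (abs_lim_eps Hw'1 _ _).1 lim0 (eps / 2); first by rewrite divr_gt0.
  exists (maxn N0 N1) => m; rewrite geq_max => /andP[/hN0 m0 /hN1].
  rewrite !subr0 !rmorphB !rmorphM /= ev0 mul0r subr0 -mulrBr rmorphXn /= gen_polyK (absM Hw'1).
  (* [w' z ^+ k >= 1] while the remainder stays below 1/2. One factor of the product in [lim0] is
     bounded away from 0, so the other tends to 0. *)
  have : 2^-1 <= w' (z ^+ k - ev (rr m)).
    have h1 := absD Hw'1 (z ^+ k - ev (rr m)) (ev (rr m)); rewrite subrK (absX Hw'1) in h1.
    have h2 : 1 <= w' z ^+ k by exact: exprn_ege1.
    have := hv m; lra.
  have := abs_ge0 Hw'1 (ev (E m)); nra.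
- move=> x; have detE : \det (horner_mx Cv (1 + (jQ x)%:P * e)) = jQ (1 + x) ^+ (size p).-1.
    have fE' : char_poly Cv = p * h by rewrite /Cv -map_char_poly -/f -/fv fE mulrC.
    have := det_coprime_idempotent cyclic_map (jQ x) fE' bez.
    rewrite -/e => h1; rewrite [in RHS]rmorphD [in RHS]rmorph1 -h1.
    rewrite rmorphD rmorph1 rmorphM /= horner_mx_C.
    by rewrite -[_ * _]/(_ *m _) mul_scalar_mx.
  have lim1 : poly_lim (fun m => 1 - (- x)%:P * E m) (1 - (jQ (- x))%:P * e).
    have := poly_limB (poly_lim_cst 1) (poly_limM (poly_lim_cst (- x)%:P) limE).
    by rewrite rmorph1 map_polyC.
  have := abs_lim_norm Hb (poly_lim_det lim1).
  rewrite (rmorphN jQ x) (polyCN (jQ x)) mulNr opprK detE (absX Hb) bj.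
  under eq_fun => m do rewrite polyCN mulNr opprK bj -(regular_mxE G) rmorphD rmorph1 rmorphM /= horner_algC.
  by [].
Qed.

End Model.

Lemma eventually_fin (T : finType) (P : T -> nat -> Prop) :
  (forall i, exists N, forall n, (N <= n)%N -> P i n) ->
  exists N, forall n, (N <= n)%N -> forall i, P i n.
Proof.
move=> /choice[N hN]; exists (\max_i N i)%N => n Nn i; apply: hN.
by apply: leq_trans Nn; exact: leq_bigmax.
Qed.

Lemma cvg_ln (R : realType) (u : nat -> R) (l : R) : 0 < l -> u @ \oo --> l ->
  (fun n => ln (u n)) @ \oo --> ln l.
Proof. by move=> l0 ul; apply: continuous_cvg => //; exact: continuous_ln. Qed.

Lemma cvg_eps (R : realType) (u : nat -> R) (l e : R) : 0 < e -> u @ \oo --> l ->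
  exists N, forall n, (N <= n)%N -> `|u n - l| < e.
Proof.
move=> e0 /cvgrPdist_lt/(_ e e0)[N _ hN]; exists N => n Nn.
by rewrite distrC; exact: hN.
Qed.

Section LocalFormula.
Variables (R : realType) (K : fieldExtType rat) (G : generator K) (v : rat_place).
Local Notation a := (rat_abs R v).
Local Notation n := (gen_deg G).+1.
Hypothesis Ha : is_absolute_value a.
Variable q : rat.
Hypothesis aq : 1 < a q.

(** Guards against the default 0 of [xget] in [local_degree], by exhibiting Cauchy sequence models
    of both completions. *)
Lemma local_degree_exists (w : K -> R) : places_above v w -> exists d, is_local_degree v w d.
Proof.
move=> Hw; pose b := AbsVal Ha; pose c := AbsVal (proj1 Hw).
have bc x : c (in_alg K x) = b x by have := proj2 Hw x.
have hd : exists d, has_degree (completion_map bc) d.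
  have phij x : completion_map bc (cinj b x) = cinj c (x%:A) := completion_map_inj bc x.
  have HQ := completionP b; have HK := completionP c.
  have [p [p0 sp evp]] := local_minpoly_exists G phij.
  by exists (size p).-1; apply: (local_has_degree HQ HK phij (cabs_completion_map bc)) => //; exact: evp.
have [d hd'] := hd; exists d.
exists (completion b), (completion c), (cinj b), (@cabs _ _ b), (cinj c), (@cabs _ _ c), (completion_map bc).
split => //; [exact: completionP|exact: completionP| |exact: cabs_completion_map].
exact: completion_map_inj.
Qed.

Lemma local_separating (w : K -> R) : places_above v w ->
  (0 < local_degree v w)%N /\ exists e : nat -> K,
    [/\ abs_lim w e 1,
        forall w', places_above v w' -> w' <> w -> abs_lim w' e 0
      & forall x : rat, (fun m => a (field_norm G (1 + x%:A * e m))) @ \oo -->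
          a (1 + x) ^+ local_degree v w].
Proof.
move=> Hw; have := xgetPex 0%N (local_degree_exists Hw).
rewrite -/(local_degree v w) => -[Qv [Kw [jQ [b [jK [c [phi [HQ HK hj habs hd]]]]]]]].
exact: (separating_sequence G Ha Hw HQ HK hj habs aq hd).
Qed.

(* More separating elements than the degree would be linearly dependent over the
   rationals; the place attached to the largest coefficient forbids it. *)
Lemma places_bound (s : seq (K -> R)) : uniq s ->
  (forall w, w \in s -> places_above v w) -> (size s <= n)%N.
Proof.
move=> us sW; rewrite leqNgt; apply/negP => ns.
set m := size s in ns *; pose w (i : 'I_m) := nth (fun=> 0) s i.
have sw i : places_above v (w i) by apply: sW; exact: mem_nth.
have winj i j : j != i -> w j <> w i.
  by move=> ij /eqP; rewrite /w nth_uniq // => /eqP/val_inj/eqP; rewrite (negPf ij).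
have /choice[e he] i := proj2 (local_separating (sw i)).
have lime i j : abs_lim (w j) (e i) (i == j)%:R.
  have [e1 e0 _] := he i; case: eqVneq => [<-//|ij].
  by apply: e0 => //; apply: winj; rewrite eq_sym.
(* For large [N] the matrix of the values of [e j N] at [w i] is strictly diagonally dominant. *)
have [N hN] : exists N, forall k, (N <= k)%N -> forall i, \sum_(j | j != i) w i (e j k) < w i (e i k).
  apply: eventually_fin => i; have [Hi _] := sw i.
  have h1 : (fun k => w i (e i k)) @ \oo --> (1 : R).
    by rewrite -(abs1 Hi); apply: (abs_lim_norm Hi); have := lime i i; rewrite eqxx.
  have h2 : (fun k => \sum_(j | j != i) w i (e j k)) @ \oo --> \sum_(j < m | j != i) (0 : R).
    apply: cvg_sumr => j ij; rewrite -(abs0 Hi); apply: (abs_lim_norm Hi).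
    by have := lime j i; rewrite (negPf ij).
  have h3 : (fun k => w i (e i k) - \sum_(j | j != i) w i (e j k)) @ \oo -->
      1 - \sum_(j < m | j != i) (0 : R) by exact: cvgB.
  rewrite big1 // subr0 in h3; have [N hN] := cvg_eps ltr01 h3; exists N => k /hN.
  by rewrite ltr_norml => /andP[h _]; lra.
have [k knz] : exists2 k : 'I_m -> rat, \sum_i k i *: e i N = 0 & exists i, k i != 0.
  apply: contrapT => h; pose X := [tuple e i N | i < m].
  suff /eqP fr : free X.
    have := dimvS (subvf <<X>>%VS).
    by rewrite fr size_tuple (gen_dim G) leqNgt ns.
  apply/freeP => k hk i; apply/eqP; apply: contraT => ki; exfalso; apply: h.
  exists k; last by exists i.
  by rewrite -[RHS]hk; apply: eq_bigr => j _; rewrite -tnth_nth tnth_mktuple.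
move=> [i0 ki0].
have [i _ imax] := arg_maxP (fun i => a (k i)) (isT : xpredT i0).
have [Hi iq] := sw i.
have ai0 : 0 < a (k i).
  by apply: lt_le_trans (imax i0 isT); rewrite (abs_gt0 Ha).
have := hN N (leqnn N) i; apply/negP; rewrite -leNgt -(ler_pM2l ai0).
move: knz; rewrite (bigD1 i) //= => /eqP; rewrite addr_eq0 => /eqP h.
have wz j x : w i (k j *: x) = a (k j) * w i x by rewrite -mulr_algl (absM Hi) iq.
rewrite -wz h (absN Hi); apply: (le_trans (abs_sum Hi _ _ _)).
rewrite mulr_sumr; apply: ler_sum => j _; rewrite wz ler_wpM2r ?(abs_ge0 Hi) //.
exact: imax.
Qed.

Lemma places_finite : finite_set (@places_above R K v).
Proof.
apply: contrapT => inf; have [B BW Bn] := infinite_set_fset n.+1 inf.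
have := @places_bound (enum_fset B) (fset_uniq B) (fun w wB => BW w wB).
by rewrite leqNgt Bn.
Qed.

Definition place_seq : seq (K -> R) := fset_set (@places_above R K v).

Lemma place_seq_uniq : uniq place_seq. Proof. exact: fset_uniq. Qed.

Lemma mem_place_seq (w : K -> R) : (w \in place_seq) <-> places_above v w.
Proof.
rewrite /place_seq in_fset_set; last exact: places_finite.
by split; [exact: set_mem | exact: mem_set].
Qed.

Lemma fsbig_places (F : (K -> R) -> R) :
  \sum_(w \in @places_above R K v) F w = \sum_(w <- place_seq) F w.
Proof. by rewrite fsbig_finite //; exact: places_finite. Qed.

(** The one-sided estimate of [exists_place_norm_le], applied to [u] and to its inverse. *)
Lemma lnabs_norm_bound u B : u != 0 ->
  (forall w, places_above v w -> `|lnabs w u| <= B) ->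
  `|lnabs a (field_norm G u)| <= n%:R * B.
Proof.
move=> u0 hB.
have le x : x != 0 -> (forall w, places_above v w -> lnabs w x <= B) ->
    lnabs a (field_norm G x) <= n%:R * B.
  move=> x0 hx; have [w Hw le] := exists_place_norm_le G Ha x0; have [Hw1 _] := Hw.
  apply: (@le_trans _ _ (n%:R * lnabs w x)); last by rewrite ler_pM2l // hx.
  rewrite -(lnabsX Hw1) // /lnabs ler_ln ?posrE ?(abs_gt0 Ha) ?field_norm_eq0 //.
    by rewrite (absX Hw1).
  by rewrite (abs_gt0 Hw1) expf_neq0.
rewrite ler_norml lerNl; apply/andP; split.
  rewrite -(lnabsV Ha) -field_normV; apply: le; first exact: invr_neq0.
  move=> w Hw; rewrite (lnabsV (proj1 Hw)); have := hB w Hw.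
  by rewrite ler_norml lerNl => /andP[].
by apply: le => // w Hw; have := hB w Hw; rewrite ler_norml => /andP[].
Qed.

Lemma places_approximation (eps : R) : 0 < eps ->
  let m := size place_seq in let w (i : 'I_m) := nth (fun=> 0) place_seq i in
  exists t : 'I_m -> K, forall i,
    [/\ t i != 0,
        `|lnabs a (field_norm G (t i)) - (local_degree v (w i))%:R * ln (a q)| < eps
      & forall j, `|lnabs (w j) (t i) - (i == j)%:R * ln (a q)| < eps].
Proof.
move=> eps0 m w.
have sw i : places_above v (w i) by apply/mem_place_seq; exact: mem_nth.
have winj i j : j != i -> w j <> w i.
  by move=> ij /eqP; rewrite /w nth_uniq ?place_seq_uniq // => /eqP/val_inj/eqP; rewrite (negPf ij).
have /choice[e he] i := proj2 (local_separating (sw i)).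
have aq0 : 0 < a q := lt_trans ltr01 aq.
have qq : 1 + (q - 1) = q by rewrite addrC subrK.
(* Tends to [1 + (q - 1) = q] at [w i] and to 1 at the other places. *)
pose t i k := 1 + (q - 1)%:A * e i k.
have limt i j : (fun k => w j (t i k)) @ \oo --> (if i == j then a q else 1).
  have [Hj jq] := sw j; have [e1 e0 _] := he i.
  have h l : abs_lim (w j) (e i) l -> (fun k => w j (t i k)) @ \oo --> w j (1 + (q - 1)%:A * l).
    move=> hl; apply: (abs_lim_norm Hj); apply: (abs_limD Hj); first exact: abs_lim_cst.
    by apply: (abs_limM Hj) => //; exact: abs_lim_cst.
  case: eqVneq => [ij|ij].
    have qA : 1 + (q - 1)%:A = q%:A :> K by rewrite -[X in X + _]scale1r -scalerDl qq.
    by have := h 1; rewrite mulr1 qA jq -ij; apply.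
  have := h 0; rewrite mulr0 addr0 (abs1 Hj); apply; apply: e0 => //.
  by apply: winj; rewrite eq_sym.
have limN i : (fun k => lnabs a (field_norm G (t i k))) @ \oo -->
    (local_degree v (w i))%:R * ln (a q).
  have [_ _ /(_ (q - 1))] := he i; rewrite qq => h.
  rewrite mulr_natl -lnXn //; apply: cvg_ln h; exact: exprn_gt0.
have limw i j : (fun k => lnabs (w j) (t i k)) @ \oo --> (i == j)%:R * ln (a q).
  rewrite (_ : _ * _ = ln (if i == j then a q else 1)); last first.
    by case: eqP; rewrite ?mul1r ?mul0r ?ln1.
  by apply: cvg_ln (limt i j); case: eqP.
have [N hN] : exists N, forall k, (N <= k)%N -> forall i j,
    `|lnabs (w j) (t i k) - (i == j)%:R * ln (a q)| < eps.
  have [N hN] : exists N, forall k, (N <= k)%N -> forall ij : 'I_m * 'I_m,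
      `|lnabs (w ij.2) (t ij.1 k) - (ij.1 == ij.2)%:R * ln (a q)| < eps.
    by apply: eventually_fin => -[i j]; exact: cvg_eps (limw i j).
  by exists N => k Nk i j; exact: (hN k Nk (i, j)).
have [N' hN'] := eventually_fin (fun i => cvg_eps eps0 (limN i)).
have [N0 hN0] := eventually_fin (fun i => cvg_eps aq0 (limt i i)).
pose k := maxn N (maxn N' N0).
exists (fun i => t i k) => i; split.
- have := hN0 k _ i; rewrite eqxx ltr_norml => /(_ _)/andP[].
    by rewrite /k !leq_max leqnn !orbT.
  move=> h _; rewrite -(abs_gt0 (proj1 (sw i))); lra.
- by apply: hN'; rewrite /k !leq_max leqnn !orbT.
- by move=> j; apply: hN; rewrite /k !leq_max leqnn.
Qed.

(* [z^k] is compared with a product of integral powers of the approximation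
   elements: the two differ by a bounded factor at every place above [v], hence
   their norms differ by a factor bounded independently of [k]. *)
Lemma local_formula z : z != 0 ->
  \sum_(w <- place_seq) (local_degree v w)%:R * lnabs w z = lnabs a (field_norm G z).
Proof.
move=> z0; set m := size place_seq; pose w (i : 'I_m) := nth (fun=> 0) place_seq i.
rewrite (big_nth (fun=> 0)) big_mkord -/m -/(w _).
pose d i : R := (local_degree v (w i))%:R; pose x i := lnabs (w i) z.
pose L := lnabs a (field_norm G z); pose A := ln (a q).
have A0 : 0 < A by exact: ln_gt0.
have sw i : places_above v (w i) by apply/mem_place_seq; exact: mem_nth.
pose D := L - \sum_i d i * x i.
(* The three summands bound, in this order, the norm of the quotient [u], the error on the norms of
   the [t i], and the rounding of [k x_i / A] to [l i]; none depends on [k]. *)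
pose M := n%:R * (A + 1) + 1 + \sum_i d i * A.
suff hk (k : nat) : k%:R * `|D| <= M.
  have : D = 0.
    apply/eqP; rewrite -normr_le0 leNgt; apply/negP => D0.
    have M0 : 0 <= M by have := hk 0%N; rewrite mul0r.
    have := archi_boundP (divr_ge0 M0 (ltW D0)).
    by rewrite ltr_pdivrMr // ltNge hk.
  by move/eqP; rewrite subr_eq0 => /eqP.
pose l i := Num.floor (k%:R * x i / A).
have lE i : 0 <= k%:R * x i - (l i)%:~R * A < A.
  have /andP[h1 h2] := floor_itv (k%:R * x i / A); rewrite -/(l i) in h1 h2.
  rewrite ler_pdivlMr // in h1; rewrite intrD ltr_pdivrMr // mulrDl mul1r in h2.
  by apply/andP; split; lra.
pose S : R := \sum_i `|(l i)%:~R|.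
have S0 : 0 <= S by apply: sumr_ge0.
(* The precision may depend on [k]: it only has to outweigh the exponents [l i], so that the total
   error is at most 1. *)
pose eps := (1 + S)^-1.
have eps0 : 0 < eps by rewrite invr_gt0; lra.
have epsS : eps * S <= 1.
  by rewrite mulrC ler_pdivrMr ?mul1r; lra.
have [t ht] := places_approximation eps0.
have approx (y c : 'I_m -> R) : (forall i, `|y i - c i| < eps) ->
    `|\sum_i (l i)%:~R * y i - \sum_i (l i)%:~R * c i| <= 1.
  move=> h; rewrite -sumrB; apply: le_trans epsS.
  apply: (le_trans (ler_norm_sum _ _ _)); rewrite mulr_sumr; apply: ler_sum => i _.
  by rewrite -mulrBr normrM mulrC ler_wpM2r // ltW.
pose u := z ^+ k * (\prod_i t i ^ l i)^-1.
have tl i : t i ^ l i != 0 by rewrite expfz_neq0 //; have [] := ht i.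
have p0 : \prod_i t i ^ l i != 0 by apply/prodf_neq0 => i _.
have u0 : u != 0 by rewrite mulf_neq0 ?expf_neq0 ?invr_neq0.
have lu : `|lnabs a (field_norm G u)| <= n%:R * (A + 1).
  apply: lnabs_norm_bound => // w' /mem_place_seq w'in.
  have mi : (index w' place_seq < m)%N by rewrite index_mem.
  pose j := Ordinal mi; have <- : w j = w' by exact: nth_index.
  have [Hj _] := sw j.
  have -> : lnabs (w j) u = k%:R * x j - \sum_i (l i)%:~R * lnabs (w j) (t i).
    rewrite /u (lnabsM Hj) ?expf_neq0 ?invr_neq0 // (lnabsX Hj) // (lnabsV Hj) (lnabs_prod Hj) //.
    by congr (_ - _); apply: eq_bigr => i _; rewrite (lnabs_expz Hj) //; have [] := ht i.
  have := @approx (fun i => lnabs (w j) (t i)) (fun i => (i == j)%:R * A).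
  move=> /(_ (fun i => let: And3 _ _ h := ht i in h j)).
  have -> : \sum_i (l i)%:~R * ((i == j)%:R * A) = (l j)%:~R * A.
    rewrite (bigD1 j) //= eqxx mul1r big1 ?addr0 // => i ij.
    by rewrite (negPf ij) mul0r mulr0.
  have /andP[h1 h2] := lE j.
  rewrite !ler_norml => /andP[h3 h4]; apply/andP; split; lra.
have lNu : lnabs a (field_norm G u) = k%:R * L - \sum_i (l i)%:~R * lnabs a (field_norm G (t i)).
  have Nz := field_norm_eq0 G.
  have NV y : field_norm G (y ^ (-1)) = (field_norm G y)^-1 by rewrite exprN1 field_normV.
  have Nexp y (c : int) : field_norm G (y ^ c) = field_norm G y ^ c.
    case: c => c; first by rewrite -!exprnP field_normX.
    by rewrite NegzE -!exprnN field_normV field_normX.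
  rewrite /u field_normM field_normX field_normV field_norm_prod (lnabsM Ha); last first.
  - by rewrite invr_neq0 //; apply/prodf_neq0 => i _; exact: Nz.
  - by rewrite expf_neq0 // Nz.
  rewrite (lnabsX Ha) ?Nz // (lnabsV Ha) (lnabs_prod Ha) => [|i]; last exact: Nz.
  congr (_ - _); apply: eq_bigr => i _; rewrite Nexp (lnabs_expz Ha) //.
  by apply: Nz; have [] := ht i.
have := @approx (fun i => lnabs a (field_norm G (t i))) (fun i => d i * A).
move=> /(_ (fun i => let: And3 _ h _ := ht i in h)).
rewrite lNu in lu; move: lu.
set T := \sum_i _; set T' := \sum_i _ => lu h1.
have h2 : `|T' - k%:R * \sum_i d i * x i| <= \sum_i d i * A.
  rewrite mulr_sumr -sumrB; apply: (le_trans (ler_norm_sum _ _ _)); apply: ler_sum => i _.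
  rewrite (_ : _ - _ = - (d i * (k%:R * x i - (l i)%:~R * A))); last ring.
  have /andP[h3 h4] := lE i; have d0 : 0 <= d i by exact: ler0n.
  by rewrite normrN normrM (ger0_norm d0) (ger0_norm h3) ler_wpM2l // ltW.
rewrite -[k%:R * _]ger0_norm ?mulr_ge0 // normrM normr_id -normrM.
rewrite (_ : k%:R * D = (k%:R * L - T) + (T - T') + (T' - k%:R * \sum_i d i * x i)); last first.
  by rewrite /D; ring.
rewrite /M; apply: (le_trans (ler_normD _ _)); apply: lerD => //.
by apply: (le_trans (ler_normD _ _)); apply: lerD.
Qed.

End LocalFormula.

(** * The product formula and heights *)

Section RationalAbsoluteValues.
Variable R : realType.

Lemma padic_abs_frac p (x y : int) : prime p -> x != 0 -> y != 0 ->
  padic_abs R p (x%:~R / y%:~R) = p%:R ^+ logn p `|y|%N / p%:R ^+ logn p `|x|%N.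
Proof.
move=> pp x0 y0; set r : rat := x%:~R / y%:~R.
have x0' : x%:~R != 0 :> rat by rewrite intr_eq0.
have y0' : y%:~R != 0 :> rat by rewrite intr_eq0.
have r0 : r != 0 by rewrite /r mulf_eq0 invr_eq0 negb_or x0' y0'.
have p0 : p%:R != 0 :> R by rewrite pnatr_eq0 -lt0n prime_gt0.
rewrite /padic_abs (negPf r0); apply/eqP; rewrite eqr_div ?expf_neq0 // -!exprD.
apply/eqP; congr (_ ^+ _).
have e : numq r * y = x * denq r.
  apply: (@intr_inj rat); rewrite !rmorphM /=; apply/eqP.
  rewrite -eqr_div ?intr_eq0 ?denq_eq0 //; exact/eqP/divq_num_den.
have := congr1 (fun z : int => logn p `|z|%N) e.
rewrite !abszM !lognM ?absz_gt0 ?numq_eq0 ?denq_eq0 // => h.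
by rewrite addnC -h addnC.
Qed.

(** Dividing by the larger argument reduces the triangle inequality, in its ultrametric form, to
    [|1 + r| <= 1] for [|r| <= 1]; the denominator of such an [r] is prime to [p]. *)
Lemma padic_abs_absolute_value p : prime p -> is_absolute_value (padic_abs R p).
Proof.
move=> pp; have p0 : 0 < p%:R :> R by rewrite ltr0n prime_gt0.
have p1 : 1 <= p%:R :> R by rewrite ler1n prime_gt0.
have pos q : q != 0 -> 0 < padic_abs R p q.
  by move=> q0; rewrite /padic_abs (negPf q0) divr_gt0 // exprn_gt0.
have z0 : padic_abs R p 0 = 0 by rewrite /padic_abs eqxx.
have ge0 q : 0 <= padic_abs R p q.
  by have [->|/pos/ltW//] := eqVneq q 0; rewrite z0.
have M x y : padic_abs R p (x * y) = padic_abs R p x * padic_abs R p y.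
  have [->|x0] := eqVneq x 0; first by rewrite mul0r z0 mul0r.
  have [->|y0] := eqVneq y 0; first by rewrite mulr0 z0 mulr0.
  rewrite -{1}(divq_num_den x) -{1}(divq_num_den y) mulf_div -!rmorphM /=.
  rewrite padic_abs_frac ?mulf_neq0 ?numq_eq0 ?denq_eq0 //.
  rewrite /padic_abs (negPf x0) (negPf y0) !abszM !lognM ?absz_gt0 ?numq_eq0 ?denq_eq0 //.
  by rewrite !exprD mulf_div.
have le1 r : padic_abs R p r <= 1 -> padic_abs R p (1 + r) <= 1.
  have [->|r0] := eqVneq r 0; first by rewrite addr0 /padic_abs /= logn1 expr0 divr1.
  have [->|r1] := eqVneq (1 + r) 0; first by rewrite z0.
  rewrite {1}/padic_abs (negPf r0) ler_pdivrMr ?exprn_gt0 // mul1r.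
  rewrite ler_eXn2l ?ltr1n ?prime_gt1 // => h.
  have d0 : logn p `|denq r|%N = 0%N.
    apply/eqP; rewrite -leqn0 leqNgt; apply/negP => dp.
    have np := leq_trans dp h; rewrite !logn_gt0 !mem_primes in dp np.
    case/and3P: dp => _ _ dp; case/and3P: np => _ _ np.
    have := coprime_num_den r; rewrite /coprime => /eqP g1.
    have : (p %| gcdn `|numq r| `|denq r|)%N by rewrite dvdn_gcd np dp.
    by rewrite g1 dvdn1 => /eqP p11; move: pp; rewrite p11.
  have e : 1 + r = (denq r + numq r)%:~R / (denq r)%:~R.
    by rewrite rmorphD mulrDl /= divff ?intr_eq0 ?denq_eq0 // divq_num_den.
  have n0 : denq r + numq r != 0.
    by apply: contraNneq r1 => h'; rewrite e h' mul0r.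
  rewrite e padic_abs_frac ?denq_eq0 // d0 expr0 ler_pdivrMr ?exprn_gt0 // mul1r.
  exact: exprn_ege1.
split => //.
- by move=> x; split=> [h|->//]; apply/eqP; apply: contraT => /pos; rewrite h ltxx.
- suff ult x y : padic_abs R p y <= padic_abs R p x -> padic_abs R p (x + y) <= padic_abs R p x.
    move=> x y; have [/ult h|/ltW/ult h] := leP (padic_abs R p y) (padic_abs R p x).
      by apply: (le_trans h); rewrite lerDl.
    by rewrite addrC; apply: (le_trans h); rewrite lerDr.
  have [->|x0 h] := eqVneq x 0; first by rewrite add0r.
  have -> : x + y = x * (1 + y / x) by rewrite mulrDr mulr1 mulrC divfK.
  rewrite M ler_piMr // le1 //; have : padic_abs R p (y / x * x) <= padic_abs R p x by rewrite divfK.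
  by rewrite M ger_pMl // pos.
Qed.

Lemma rat_abs_absolute_value v : is_absolute_value (rat_abs R v).
Proof.
case: v => [[p pp]|]; first exact: padic_abs_absolute_value.
split=> /= [x|x|x y|x y].
- exact: normr_ge0.
- by split=> [/eqP|->]; rewrite ?rmorph0 ?normr0 // normr_eq0 fmorph_eq0 => /eqP.
- by rewrite rmorphM normrM.
- by rewrite rmorphD ler_normD.
Qed.

(** A witness that [|.|_v] is not trivial: the local norm formula requires a rational with
    [|q|_v > 1]. *)
Definition rat_pole (v : rat_place) : rat :=
  if v is Some p then (val p)%:R^-1 else 2.

Lemma padic_abs_nat p m : prime p -> (0 < m)%N ->
  padic_abs R p m%:R = (p%:R ^+ logn p m)^-1.
Proof.
move=> pp m0; have := @padic_abs_frac p (Posz m) 1 pp.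
rewrite divr1 logn1 expr0 mul1r => -> //; by rewrite -lt0n.
Qed.

Lemma padic_abs_self p : prime p -> padic_abs R p p%:R = p%:R^-1.
Proof. by move=> pp; rewrite padic_abs_nat ?prime_gt0 // logn_prime // eqxx expr1. Qed.

Lemma padic_abs_nat_le1 p m : prime p -> padic_abs R p m%:R <= 1.
Proof.
move=> pp; case: m => [|m]; first by rewrite /padic_abs eqxx.
rewrite padic_abs_nat // invf_le1 ?exprn_gt0 ?ltr0n ?prime_gt0 // exprn_ege1 //.
by rewrite ler1n prime_gt0.
Qed.

Lemma padic_abs_nat_eq1 p m : prime p -> (0 < m)%N -> ~~ (p %| m)%N -> padic_abs R p m%:R = 1.
Proof.
move=> pp m0 pm; rewrite padic_abs_nat // (_ : logn p m = 0%N) ?expr0 ?invr1 //.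
by apply/eqP; rewrite -leqn0 leqNgt logn_gt0 mem_primes pp m0.
Qed.

Lemma rat_pole_gt1 v : 1 < rat_abs R v (rat_pole v).
Proof.
case: v => [[p pp]|] /=; last by rewrite rmorph_nat ger0_norm // ltr1n.
rewrite (absV (padic_abs_absolute_value pp)) padic_abs_self // invrK ltr1n.
exact: prime_gt1.
Qed.

Definition finite_places_lt (B : nat) : seq {p : nat | prime p} :=
  pmap insub (iota 0 B).

Definition places_lt (B : nat) : seq rat_place := None :: map Some (finite_places_lt B).

Lemma mem_finite_places_lt B p : (p \in finite_places_lt B) = (val p < B)%N.
Proof. by rewrite mem_pmap_sub mem_iota. Qed.

Lemma places_lt_uniq B : uniq (places_lt B).
Proof.
rewrite /= map_inj_uniq; last by move=> x y [].
rewrite pmap_sub_uniq ?iota_uniq // andbT.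
by apply/negP => /mapP[].
Qed.

Lemma sum_finite_places_lt B (F : nat -> R) :
  \sum_(p <- finite_places_lt B) F (val p) = \sum_(0 <= p < B | prime p) F p.
Proof.
rewrite /finite_places_lt /index_iota subn0; elim: (iota 0 B) => [|i s IH].
  by rewrite !big_nil.
rewrite big_cons /=; case: insubP => [u pu ui|np]; last by rewrite (negPf np).
by rewrite /= big_cons IH pu ui.
Qed.

Lemma ln_nat_primes B m : (0 < m)%N -> (m < B)%N ->
  ln (m%:R : R) = \sum_(0 <= p < B | prime p) (logn p m)%:R * ln p%:R.
Proof.
move=> m0; case: B => // B mB; rewrite -{1}(partnT m0) (widen_partn _ (mB : (m <= B)%N)).
rewrite (big_mkcond prime) /= natr_prod.
elim: (index_iota 0 B.+1) => [|i s IH]; first by rewrite !big_nil ln1.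
have nz (t : seq nat) : 0 < \prod_(i <- t) ((i ^ logn i m)%:R : R).
  elim: t => [|j t IHt]; first by rewrite big_nil.
  rewrite big_cons mulr_gt0 // ltr0n; case: j => [|j]; last by rewrite expn_gt0.
  by rewrite lognE.
have i0 : 0 < ((i ^ logn i m)%:R : R).
  by have := nz [:: i]; rewrite big_seq1.
rewrite !big_cons /= lnM ?posrE // IH; congr (_ + _).
case: ifP => pi; last by rewrite lognE pi expn0 ln1.
by rewrite natrX lnXn ?ltr0n ?prime_gt0 // mulr_natl.
Qed.

(** Prime factorization of numerator and denominator. It is stated for all large finite sets
    [places_lt B], so that it can be added termwise to truncated heights without comparing
    supports. *)
Lemma rat_product_formula (q : rat) : q != 0 -> exists B0, forall B, (B0 <= B)%N ->
  \sum_(v <- places_lt B) lnabs (rat_abs R v) q = 0.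
Proof.
move=> q0; set n := `|numq q|%N; set d := `|denq q|%N.
have n0 : (0 < n)%N by rewrite absz_gt0 numq_eq0.
have d0 : (0 < d)%N by rewrite absz_gt0 denq_eq0.
exists (maxn n d).+1 => B hB.
have nB : (n < B)%N by rewrite (leq_trans _ hB) // ltnS leq_maxl.
have dB : (d < B)%N by rewrite (leq_trans _ hB) // ltnS leq_maxr.
rewrite /places_lt big_cons big_map.
have -> : lnabs (rat_abs R None) q = ln n%:R - ln d%:R.
  rewrite /lnabs /= -{1}(divq_num_den q) fmorph_div /= !ratr_int normrM normfV -!intr_norm.
  by rewrite ln_div ?posrE ?ltr0z ?normr_gt0 ?numq_eq0 ?denq_eq0 // -!abszE.
pose F p : R := (logn p d)%:R * ln p%:R - (logn p n)%:R * ln p%:R.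
rewrite (eq_bigr (fun p => F (val p))); last first.
  move=> [p pp] _; rewrite /lnabs /= /padic_abs (negPf q0) /F /=.
  have p0 : 0 < p%:R :> R by rewrite ltr0n prime_gt0.
  by rewrite ln_div ?posrE ?exprn_gt0 // !lnXn // !mulr_natl.
rewrite sum_finite_places_lt /F sumrB -!ln_nat_primes //; ring.
Qed.

Lemma rat_abs_eq1 (q : rat) : q != 0 -> exists B0, forall p, (B0 <= val p)%N ->
  rat_abs R (Some p) q = 1.
Proof.
move=> q0; set n := `|numq q|%N; set d := `|denq q|%N.
have n0 : (0 < n)%N by rewrite absz_gt0 numq_eq0.
have d0 : (0 < d)%N by rewrite absz_gt0 denq_eq0.
exists (maxn n d).+1 => -[p pp] /= hB.
have l m : (0 < m)%N -> (m < p)%N -> logn p m = 0%N.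
  move=> m0 mp; apply/eqP; rewrite -leqn0 leqNgt logn_gt0 mem_primes pp m0 /=.
  by apply/negP => /(dvdn_leq m0); rewrite leqNgt mp.
rewrite /padic_abs (negPf q0) !l ?expr0 ?divr1 //.
  by rewrite (leq_trans _ hB) // ltnS leq_maxl.
by rewrite (leq_trans _ hB) // ltnS leq_maxr.
Qed.

End RationalAbsoluteValues.

Section Ultrametric.
Variables (R : realType) (K : fieldExtType rat) (p : {p : nat | prime p}) (w : K -> R).
Hypothesis Hw : places_above (Some p) w.

Lemma place_nat v (w' : K -> R) m : places_above v w' -> w' m%:R = rat_abs R v m%:R.
Proof. by move=> [_ <-]; rewrite scaler_nat. Qed.

(** Binomial coefficients are p-adically at most 1, so [w ((x + y) ^+ k) <= (k + 1) * M ^ k]; a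
    factor linear in [k] cannot make up for exponential growth. *)
Lemma place_ultrametric x y M : w x <= M -> w y <= M -> w (x + y) <= M.
Proof.
have [H _] := Hw; move=> xM yM.
have M0 : 0 <= M := le_trans (abs_ge0 H x) xM.
set s := w (x + y); have s0 : 0 <= s := abs_ge0 H _.
have hk k : s ^+ k <= k.+1%:R * M ^+ k.
  rewrite -(absX H) exprDn; apply: (le_trans (abs_sum H _ _ _)).
  have -> : k.+1%:R * M ^+ k = \sum_(i < k.+1) M ^+ k by rewrite sumr_const card_ord mulr_natl.
  apply: ler_sum => i _.
  rewrite -mulr_natr (absM H) (absM H) !(absX H) (place_nat _ Hw).
  have le1 := padic_abs_nat_le1 R 'C(k, i) (valP p).
  apply: (@le_trans _ _ (M ^+ (k - i) * M ^+ i)); last by rewrite -exprD subnK // -ltnS.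
  rewrite -[leRHS]mulr1; apply: ler_pM => //.
  - by rewrite mulr_ge0 // exprn_ge0 // (abs_ge0 H).
  - exact: (abs_ge0 (rat_abs_absolute_value R (Some p))).
  - by apply: ler_pM; rewrite ?exprn_ge0 ?(abs_ge0 H) //; apply: lerXn2r; rewrite ?nnegrE ?(abs_ge0 H).
rewrite leNgt; apply/negP => Ms.
have [M00|Mn0] := eqVneq M 0.
  by have := hk 1%N; rewrite M00 !expr1 mulr0; lra.
have Mp : 0 < M by rewrite lt0r Mn0.
pose d := s / M - 1.
have d0 : 0 < d by rewrite subr_gt0 ltr_pdivlMr // mul1r.
have bern k : 1 + d * k%:R <= (s / M) ^+ k.
  elim: k => [|k IH]; first by rewrite mulr0 addr0.
  rewrite exprS -natr1; apply: (@le_trans _ _ (s / M * (1 + d * k%:R))).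
    have -> : s / M = 1 + d by rewrite /d addrC subrK.
    have : 0 <= d * (d * k%:R) by rewrite !mulr_ge0 // ltW.
    nra.
  by rewrite ler_wpM2l // divr_ge0.
have up k : (s / M) ^+ k <= k.+1%:R by rewrite expr_div_n ler_pdivrMr ?exprn_gt0.
(* Bernoulli's lower bound is linear in the exponent, like the upper bound [up], so it is squared:
   with [z = k.+1] this gives [1 + d^2 z^2 <= 2 z + 1], against [d^2 z > 3]. *)
have [k hk'] : exists k : nat, 3 < d ^+ 2 * k.+1%:R.
  exists (Num.bound (3 / d ^+ 2)); rewrite mulrC -ltr_pdivrMr ?exprn_gt0 //.
  apply: lt_trans (archi_boundP _) _; last by rewrite ltr_nat.
  by rewrite divr_ge0 // exprn_ge0 // ltW.
have := up (k.+1 + k.+1)%N; rewrite exprD -expr2.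
have h1 := bern k.+1.
have h2 : (1 + d * k.+1%:R) ^+ 2 <= ((s / M) ^+ k.+1) ^+ 2.
  apply: lerXn2r => //; rewrite nnegrE; last by rewrite exprn_ge0 // divr_ge0.
  by rewrite addr_ge0 // mulr_ge0 // ltW.
have e : (k.+1 + k.+1).+1%:R = k.+1%:R + k.+1%:R + 1 :> R by rewrite -[LHS]natr1 natrD.
move=> h3; have := le_trans h2 h3; rewrite e.
set z := k.+1%:R in hk' *.
have z1 : 1 <= z by rewrite /z ler1n.
have : 3 * z < d ^+ 2 * z * z by rewrite ltr_pM2r //; lra.
have : 0 <= d * z by rewrite mulr_ge0 ?ltW //; lra.
nra.
Qed.

Lemma place_sum_le I (r : seq I) (P : pred I) (F : I -> K) M : 0 <= M ->
  (forall i, P i -> w (F i) <= M) -> w (\sum_(i <- r | P i) F i) <= M.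
Proof.
move=> M0 h; elim/big_ind: _ => //; first by rewrite (abs0 (proj1 Hw)).
by move=> x y; exact: place_ultrametric.
Qed.

End Ultrametric.

(** * Local heights as weighted means, and finite formulas for the height *)

Section Heights.
Variables (R : realType) (K : fieldExtType rat) (G : generator K) (n : nat).
Implicit Types (x y : 'rV[K]_n.+1) (v : rat_place).
Local Notation N := (\dim {:K}).

Definition coord_max (w : K -> R) x : R := \big[Num.max/0]_(i < n.+1) w (x 0 i).

Definition local_height v x : R :=
  \sum_(w \in @places_above R K v) (local_degree v w)%:R / N%:R * ln (coord_max w x).

Lemma heightE x : height R x = \sum_(v \in [set: rat_place]) local_height v x.
Proof. by []. Qed.

Section CoordMax.
Variable w : K -> R.
Hypothesis Hw : is_absolute_value w.

Lemma coord_max_ge x i : w (x 0 i) <= coord_max w x.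
Proof. exact: (le_bigmax _ (fun i => w (x 0 i))). Qed.

Lemma coord_max_le x M : 0 <= M -> (forall i, w (x 0 i) <= M) -> coord_max w x <= M.
Proof. by move=> M0 h; apply: bigmax_le. Qed.

Lemma coord_max_gt0 x : x != 0 -> 0 < coord_max w x.
Proof.
move=> /rV0Pn[i xi]; apply: lt_le_trans (coord_max_ge x i).
by rewrite (abs_gt0 Hw).
Qed.

Lemma coord_maxZ c x : coord_max w (c *: x) = w c * coord_max w x.
Proof.
have [->|c0] := eqVneq c 0.
  rewrite scale0r (abs0 Hw) mul0r; apply/eqP; rewrite eq_le; apply/andP; split.
    by apply: coord_max_le => // i; rewrite mxE (abs0 Hw).
  by apply: le_trans (coord_max_ge 0 0); rewrite mxE (abs0 Hw).
have wc : 0 < w c by rewrite (abs_gt0 Hw).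
apply/eqP; rewrite eq_le; apply/andP; split.
  apply: coord_max_le => [|i]; last by rewrite mxE (absM Hw) ler_pM2l // coord_max_ge.
  by rewrite mulr_ge0 ?(abs_ge0 Hw) // (le_trans (abs_ge0 Hw _) (coord_max_ge x 0)).
rewrite mulrC -ler_pdivlMr //; apply: coord_max_le => [|i].
  by rewrite divr_ge0 ?(abs_ge0 Hw) // (le_trans (abs_ge0 Hw _) (coord_max_ge (c *: x) 0)).
by rewrite ler_pdivlMr // mulrC -(absM Hw) (le_trans _ (coord_max_ge _ i)) // mxE.
Qed.

Lemma coord_max_eq x : exists i, coord_max w x = w (x 0 i).
Proof.
pose i := [arg max_(i > ord0) w (x 0 i)]%O; exists i.
apply/eqP; rewrite eq_le coord_max_ge andbT; apply: coord_max_le; first exact: abs_ge0.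
by move=> j; rewrite /i; case: arg_maxP => // k _ /(_ j isT).
Qed.

End CoordMax.

Let Ha v := rat_abs_absolute_value R v.
Let aq v := rat_pole_gt1 R v.

Lemma dim_gt0 : 0 < N%:R :> R.
Proof. by rewrite (gen_dim G) ltr0n. Qed.

Lemma local_heightE v x : local_height v x =
  \sum_(w <- place_seq R K v) (local_degree v w)%:R / N%:R * ln (coord_max w x).
Proof. exact: (fsbig_places G (Ha v) (aq v)). Qed.

Lemma mem_places v (w : K -> R) : (w \in place_seq R K v) <-> places_above v w.
Proof. exact: (mem_place_seq G (Ha v) (aq v)). Qed.

Lemma local_degree_gt0 v (w : K -> R) : places_above v w -> 0 < (local_degree v w)%:R / N%:R :> R.
Proof.
move=> Hw; rewrite divr_gt0 ?dim_gt0 // ltr0n.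
by have [] := local_separating G (Ha v) (aq v) Hw.
Qed.

Lemma sum_lnabs v z : z != 0 ->
  \sum_(w <- place_seq R K v) (local_degree v w)%:R / N%:R * lnabs w z
  = lnabs (rat_abs R v) (field_norm G z) / N%:R.
Proof.
move=> z0; rewrite -(local_formula G (Ha v) (aq v) z0) mulr_suml.
by apply: eq_bigr => w _; rewrite mulrAC.
Qed.

(** The norm formula for the rational [rat_pole v], which has the same nonzero logarithm at all
    places above [v]. *)
Lemma sum_local_degree v : \sum_(w <- place_seq R K v) (local_degree v w)%:R / N%:R = 1 :> R.
Proof.
set q := rat_pole v; have q0 : q != 0.
  by apply: contraTneq (aq v) => h; rewrite -/q h (abs0 (Ha v)) ltNge ler01.
have A0 : 0 < lnabs (rat_abs R v) q by exact: ln_gt0.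
have qK : q%:A != 0 :> K by rewrite -[q%:A]/(in_alg K q) fmorph_eq0.
have := sum_lnabs v qK; rewrite field_norm_alg -(gen_dim G) (lnabsX (Ha v)) //.
rewrite mulrAC divff ?mul1r ?gt_eqF ?dim_gt0 // => h.
apply: (mulIf (lt0r_neq0 A0)); rewrite mul1r -[RHS]h mulr_suml.
rewrite !big_seq; apply: eq_bigr => w /mem_places[_ wq].
by rewrite [in RHS]/lnabs wq.
Qed.

Lemma local_heightZ v c x : c != 0 -> x != 0 ->
  local_height v (c *: x) = lnabs (rat_abs R v) (field_norm G c) / N%:R + local_height v x.
Proof.
move=> c0 x0; rewrite !local_heightE -sum_lnabs // -big_split !big_seq /=.
apply: eq_bigr => w /mem_places[Hw _]; rewrite -mulrDr; congr (_ * _).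
by rewrite coord_maxZ // lnM // posrE ?coord_max_gt0 ?(abs_gt0 Hw).
Qed.

Lemma ln_weighted v (M : R) : ln M =
  \sum_(w <- place_seq R K v) (local_degree v w)%:R / N%:R * ln M.
Proof. by rewrite -mulr_suml sum_local_degree mul1r. Qed.

Lemma local_height_le v x M : x != 0 ->
  (forall w, places_above v w -> coord_max w x <= M) -> local_height v x <= ln M.
Proof.
move=> x0 h; rewrite local_heightE (ln_weighted v M).
rewrite !big_seq; apply: ler_sum => w /mem_places Hw.
rewrite ler_pM2l ?local_degree_gt0 //.
have m0 := coord_max_gt0 (proj1 Hw) x0.
by rewrite ler_ln ?posrE ?h // (lt_le_trans m0) ?h.
Qed.

Lemma local_height_ge v x M : x != 0 -> 0 < M ->
  (forall w, places_above v w -> M <= coord_max w x) -> ln M <= local_height v x.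
Proof.
move=> x0 M0 h; rewrite local_heightE (ln_weighted v M).
rewrite !big_seq; apply: ler_sum => w /mem_places Hw.
rewrite ler_pM2l ?local_degree_gt0 //.
have m0 := coord_max_gt0 (proj1 Hw) x0.
by rewrite ler_ln ?posrE ?h.
Qed.

(** All weights are positive, so strictness at one place survives in the mean. *)
Lemma local_height_lt v w x M : x != 0 -> places_above v w ->
  (forall w, places_above v w -> coord_max w x <= M) -> coord_max w x < M ->
  local_height v x < ln M.
Proof.
move=> x0 Hw h lt; rewrite local_heightE (ln_weighted v M).
have win : w \in place_seq R K v by apply/mem_places.
have uq : uniq (place_seq R K v) := place_seq_uniq R K v.
rewrite !(bigD1_seq w) //=; apply: ltr_leD.
  rewrite ltr_pM2l ?local_degree_gt0 //.
  have m0 := coord_max_gt0 (proj1 Hw) x0.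
  by rewrite ltr_ln ?posrE // (lt_trans m0).
rewrite big_seq_cond [leRHS]big_seq_cond; apply: ler_sum => w' /andP[/mem_places Hw' _].
rewrite ler_pM2l ?local_degree_gt0 //.
have m0 := coord_max_gt0 (proj1 Hw') x0.
by rewrite ler_ln ?posrE ?h // (lt_le_trans m0) ?h.
Qed.

Lemma local_height_gt v w x M : x != 0 -> 0 < M -> places_above v w ->
  (forall w, places_above v w -> M <= coord_max w x) -> M < coord_max w x ->
  ln M < local_height v x.
Proof.
move=> x0 M0 Hw h lt; rewrite local_heightE (ln_weighted v M).
have win : w \in place_seq R K v by apply/mem_places.
have uq : uniq (place_seq R K v) := place_seq_uniq R K v.
rewrite !(bigD1_seq w) //=; apply: ltr_leD.
  rewrite ltr_pM2l ?local_degree_gt0 //.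
  by rewrite ltr_ln ?posrE ?(coord_max_gt0 (proj1 Hw) x0).
rewrite big_seq_cond [leRHS]big_seq_cond; apply: ler_sum => w' /andP[/mem_places Hw' _].
rewrite ler_pM2l ?local_degree_gt0 //.
by rewrite ler_ln ?posrE ?h ?(coord_max_gt0 (proj1 Hw') x0).
Qed.

Definition integral_coords x := forall p w, places_above (Some p) w ->
  forall i, (w (x 0 i) : R) <= 1.

(** A sum over all places with infinite support would be 0 by convention; this condition makes the
    height a genuine finite sum. *)
Definition good_coords x := exists B0, forall p : {p : nat | prime p},
  (B0 <= val p)%N -> local_height (Some p) x = 0.

(** Integrality gives local heights at most 0; a nonzero coordinate [x_j] bounds them below by the
    mean of [ln |x_j|_w], which is 0 once the norm of [x_j] is a unit at [p]. *)
Lemma integral_good x : x != 0 -> integral_coords x -> good_coords x.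
Proof.
move=> x0 xi; have /rV0Pn[j xj] := x0.
have [B hB] := rat_abs_eq1 R (field_norm_eq0 G xj).
exists B => p /hB pB; apply/eqP; rewrite eq_le; apply/andP; split.
  rewrite -ln1; apply: local_height_le => // w Hw; apply: coord_max_le => // i.
  exact: xi Hw i.
rewrite local_heightE.
have e : lnabs (rat_abs R (Some p)) (field_norm G (x 0 j)) / N%:R = 0.
  by rewrite /lnabs pB ln1 mul0r.
rewrite -[leLHS]e -sum_lnabs // !big_seq.
apply: ler_sum => w /mem_places Hw.
rewrite ler_pM2l ?local_degree_gt0 // ler_ln ?posrE ?coord_max_gt0 ?(abs_gt0 (proj1 Hw)) ?coord_max_ge //.
exact: (proj1 Hw).
Qed.

Lemma good_coordsZ c x : c != 0 -> x != 0 -> good_coords x -> good_coords (c *: x).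
Proof.
move=> c0 x0 [B hB]; have [B' hB'] := rat_abs_eq1 R (field_norm_eq0 G c0).
exists (maxn B B') => p; rewrite geq_max => /andP[/hB h /hB' h'].
by rewrite local_heightZ // h addr0 /lnabs h' ln1 mul0r.
Qed.

Lemma height_good x : good_coords x -> exists B0, forall B, (B0 <= B)%N ->
  height R x = \sum_(v <- places_lt B) local_height v x.
Proof.
move=> [B0 hB0]; exists B0 => B BB; rewrite heightE (fsbigE (places_lt B)) ?places_lt_uniq //.
  by apply: eq_bigl => v; rewrite in_setT.
move=> [p|] _; last by rewrite inE eqxx.
rewrite inE /= mem_map => [|a b []//]; rewrite mem_finite_places_lt -leqNgt => h.
by apply: hB0; rewrite (leq_trans BB).
Qed.

(** Given coordinates are treated as [c *: x] for a convenient [x]; the contributions of [c] cancel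
    by the product formula. *)
Lemma height_scale c x : c != 0 -> x != 0 -> good_coords x ->
  exists B0, forall B, (B0 <= B)%N ->
  height R (c *: x) = \sum_(v <- places_lt B) local_height v x.
Proof.
move=> c0 x0 gx; have [B hB] := height_good (good_coordsZ c0 x0 gx).
have [B' hB'] := rat_product_formula R (field_norm_eq0 G c0).
exists (maxn B B') => b; rewrite geq_max => /andP[/hB -> /hB' h].
under eq_bigr do rewrite local_heightZ //.
by rewrite big_split /= -mulr_suml h mul0r add0r.
Qed.

End Heights.

(** * Roots of unity *)

Section RootsOfUnity.

Lemma rmorph_rat_alg (L : fieldExtType rat) (F : fieldType) (g : {rmorphism L -> F}) (x : rat) :
  g x%:A = ratr x.
Proof. exact: (fmorph_eq_rat (g \o in_alg L) x). Qed.

Lemma root_of_unity_conj (C : numClosedFieldType) (z : C) n :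
  (0 < n)%N -> z ^+ n = 1 -> z^* = z^-1.
Proof.
move=> n0 zn; have nz : `|z| = 1.
  by apply/eqP; rewrite -(@pexpr_eq1 _ _ n) // -normrX zn normr1.
by rewrite invC_norm nz expr1n invr1 mul1r.
Qed.

Lemma cyclotomic_field (N : nat) : (0 < N)%N ->
  exists (Qn : splittingFieldType rat) (QnC : {rmorphism Qn -> algC}) (e : Qn),
    [/\ galois 1 {:Qn}, N.-primitive_root e & <<1; e>>%VS = fullv].
Proof.
case: N => // n _.
have [Qn galQn [QnC _ [e [pe defQn] _]]] := group_num_field_exists [set: 'I_n.+1]%G.
by exists Qn, QnC, e; split; rewrite // cardsT card_ord in pe *.
Qed.

Lemma eq_on_generator (L : fieldExtType rat) (g h : {rmorphism L -> L}) (e : L) :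
  <<1; e>>%VS = fullv -> g e = h e -> g =1 h.
Proof.
move=> defL ge y; have : y \in <<1; e>>%VS by rewrite defL memvf.
move=> /Fadjoin1_polyP[q ->]; rewrite -!horner_map ge; congr (_.[_]).
rewrite -!map_poly_comp; apply: eq_map_poly => c /=.
by rewrite !rmorph_rat_alg.
Qed.

(* Galois groups of cyclotomic fields are abelian, so complex conjugation
   preserves every subfield. *)
Lemma cyclotomic_conj (K : fieldExtType rat) (iota : {rmorphism K -> algC})
    (N : nat) (e : algC) (p q : {poly rat}) (r : K) :
  (0 < N)%N -> e ^+ N = 1 -> iota r = (map_poly ratr p).[e] / (map_poly ratr q).[e] ->
  exists r', iota r' = (iota r)^*.
Proof.
move=> N0 eN er; have [Qn [QnC [z [galQn pz defQn]]]] := cyclotomic_field N0.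
have pz' : N.-primitive_root (QnC z) by rewrite fmorph_primitive_root.
have [i ei] := prim_rootP pz' eN.
pose h (g : {poly rat}) := (map_poly (in_alg Qn) g).[z ^+ i].
have hE g : QnC (h g) = (map_poly ratr g).[e].
  rewrite ei /h -horner_map rmorphXn -map_poly_comp; congr (_.[_]).
  by apply: eq_map_poly => c /=; rewrite rmorph_rat_alg.
pose u := h p / h q.
have uE : QnC u = iota r by rewrite er fmorph_div !hE.
clearbody u; have [c hc] := restrict_aut_to_normal_num_field QnC (Num.conj : {rmorphism algC -> algC}).
have cz : c z = z^-1.
  apply: (fmorph_inj QnC); rewrite hc fmorphV; apply: (root_of_unity_conj N0).
  exact: prim_expr_order pz'.
(* Galois correspondence: an automorphism fixing [u] commutes with [c], since both send the
   generator [z] to a power of itself, and so it fixes [c u]. *)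
have cu : c u \in <<1; u>>%VS.
  have gal_u : galois <<1; u>> {:Qn} by apply: galoisS galQn; rewrite sub1v subvf.
  rewrite -(elimT galois_fixedField gal_u); apply/fixedFieldP; first exact: memvf.
  move=> s sG; have su : s u = u by apply: (fixed_gal _ sG); rewrite ?subvf ?memv_adjoin.
  rewrite -{2}su.
  have [j sz] := prim_rootP pz (prim_expr_order (etrans (fmorph_primitive_root s N z) pz : N.-primitive_root (s z))).
  apply: (@eq_on_generator _ (s \o c) (c \o s) z defQn).
  have e2 : (s z)^-1 = c (s z) by rewrite sz rmorphXn /= cz exprVn.
  by rewrite /= cz; exact: etrans (fmorphV s z) e2.
have /Fadjoin1_polyP[g cuE] := cu.
exists (map_poly (in_alg K) g).[r].
rewrite -uE -hc cuE -!horner_map uE -!map_poly_comp; congr (_.[_]).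
by apply: eq_map_poly => x /=; rewrite !rmorph_rat_alg.
Qed.

(** One has [1 + r = (b - a) / (1 - a)]. Conjugation inverts [a] and [b], so
    [1 + r' = (b - a) / (b (1 - a))] and the quotient is [b]. Then [a = 1 + (1 - b) / r]. *)
Lemma cyclotomic_ratio_mem (K : fieldExtType rat) (iota : {rmorphism K -> algC})
    (a b : algC) (r : K) :
  mu_infty a -> mu_infty b -> a != 1 -> b != 1 -> a != b ->
  iota r = (1 - b) / (a - 1) -> exists s t : K, iota s = a /\ iota t = b.
Proof.
move=> [n n0 an] [m m0 bm] a1 b1 ab rE.
have N0 : (0 < n * m)%N by rewrite muln_gt0 n0.
have [e pe] := C_prim_root_exists N0; have eN := prim_expr_order pe.
have [i ai] : exists i, a = e ^+ i.
  have [|i ai] := prim_rootP pe (_ : a ^+ (n * m) = 1); last by exists i.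
  by rewrite exprM an expr1n.
have [j bj] : exists j, b = e ^+ j.
  have [|j bj] := prim_rootP pe (_ : b ^+ (n * m) = 1); last by exists j.
  by rewrite mulnC exprM bm expr1n.
have [|r' r'E] := @cyclotomic_conj K iota (n * m) e (1 - 'X^j) ('X^i - 1) r N0 eN.
  by rewrite rE !rmorphB !rmorph1 /= !map_polyXn !hornerE ?hornerXn -ai -bj.
have a0 : a != 0 by apply: contra_eq_neq an => ->; rewrite expr0n eqn0Ngt n0 eq_sym oner_eq0.
have b0 : b != 0 by apply: contra_eq_neq bm => ->; rewrite expr0n eqn0Ngt m0 eq_sym oner_eq0.
have a10 : a - 1 != 0 by rewrite subr_eq0.
have b10 : 1 - b != 0 by rewrite subr_eq0 eq_sym.
have a10' : 1 - a != 0 by rewrite subr_eq0 eq_sym.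
have ba0 : b - a != 0 by rewrite subr_eq0 eq_sym.
have r'E2 : iota r' = a * (b - 1) / (b * (1 - a)).
  rewrite r'E rE fmorph_div !rmorphB !rmorph1 /= (root_of_unity_conj n0 an) (root_of_unity_conj m0 bm).
  by field; rewrite a0 b0 a10'.
have tE : iota ((1 + r) / (1 + r')) = b.
  rewrite fmorph_div !rmorphD !rmorph1 r'E2 rE.
  have -> : 1 + (1 - b) / (a - 1) = (b - a) / (1 - a) by field; rewrite ?a10 ?a10'.
  have -> : 1 + a * (b - 1) / (b * (1 - a)) = (b - a) / (b * (1 - a)) by field; rewrite ?b0 ?a10'.
  by field; rewrite ?b0 ?a10' ?ba0.
exists (1 + (1 - (1 + r) / (1 + r')) / r), ((1 + r) / (1 + r')); split=> //.
rewrite rmorphD rmorph1 fmorph_div rmorphB rmorph1 tE rE.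
by field; rewrite ?a10 ?b10.
Qed.

End RootsOfUnity.

Section ComplexPlace.
Variables (R : realType) (K : fieldExtType rat) (G : generator K).

Lemma embedding_exists (C : numClosedFieldType) : inhabited {rmorphism K -> C}.
Proof.
set f := char_poly (gen_mx G).
have [x fx] : exists x : C, root (map_poly ratr f) x.
  by apply/closed_rootP; rewrite size_map_poly size_char_poly.
pose psi (g : {poly rat}) := (map_poly ratr g).[x].
have psiE g : psi (gen_poly G (horner_alg (gen G) g)) = psi g.
  apply/eqP; rewrite -subr_eq0 /psi -hornerN -hornerD -rmorphN -rmorphD /=.
  have /dvdpP[k ->] : f %| gen_poly G (horner_alg (gen G) g) - g.
    by rewrite -gen_eq0 rmorphB /= gen_polyK subrr.
  by rewrite rmorphM hornerM (eqP fx) mulr0.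
pose tau (z : K) := psi (gen_poly G z).
have tauB : zmod_morphism tau.
  move=> y z; rewrite /tau -{1}(gen_polyK G y) -{1}(gen_polyK G z) -rmorphB psiE.
  by rewrite /psi rmorphB hornerD hornerN.
have tauM : monoid_morphism tau.
  split; first by rewrite /tau -(rmorph1 (horner_alg (gen G))) psiE /psi rmorph1 hornerC.
  move=> y z; rewrite /tau -{1}(gen_polyK G y) -{1}(gen_polyK G z) -rmorphM psiE.
  by rewrite /psi rmorphM hornerM.
pose mZ := GRing.isZmodMorphism.Build K C tau tauB.
pose mM := GRing.isMonoidMorphism.Build K C tau tauM.
by exists; exact: (HB.pack tau mZ mM).
Qed.

Lemma complex_place : exists (tau : {rmorphism K -> complex R}) (w : K -> R),
  places_above None w /\ forall z, real_complex R (w z) = `|tau z|.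
Proof.
have [tau] := embedding_exists (complex R : numClosedFieldType).
pose w z : R := Normc.normc (tau z).
have wE z : real_complex R (w z) = `|tau z| by [].
have inj : injective (real_complex R) := @complexI R.
exists tau, w; split=> //; split.
  split.
  - by move=> x; rewrite /w; case: (tau x) => u v; exact: sqrtr_ge0.
  - move=> x; split=> [/Normc.eq0_normc/eqP|->]; first by rewrite fmorph_eq0 => /eqP.
    by rewrite /w rmorph0 Normc.normc0.
  - by move=> x y; rewrite /w rmorphM Normc.normcM.
  - by move=> x y; rewrite /w rmorphD; exact: le_normcD.
move=> q; apply: inj; rewrite wE rmorph_rat_alg -(fmorph_rat (real_complex R)) /=.
by rewrite normc_def /= expr0n addr0 sqrtr_sqr.
Qed.

End ComplexPlace.

Section RootsOfUnityAtPlaces.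
Variables (R : realType) (K : fieldExtType rat).
Implicit Types (z a b : K) (w : K -> R).

Definition is_torsion z := exists2 n : nat, (0 < n)%N & z ^+ n = 1.

Lemma is_torsionN z : is_torsion z -> is_torsion (- z).
Proof.
move=> [n n0 zn]; exists (n * 2)%N; first by rewrite muln_gt0 n0.
by rewrite mulnC exprM sqrrN -exprM mulnC exprM zn expr1n.
Qed.

Lemma is_torsion_neq0 z : is_torsion z -> z != 0.
Proof.
by move=> [n n0]; apply: contra_eq_neq => ->; rewrite expr0n eqn0Ngt n0 eq_sym oner_eq0.
Qed.

Lemma place_torsion w z : is_absolute_value w -> is_torsion z -> w z = 1.
Proof. by move=> Hw [n n0 zn]; exact: (abs_root_of_unity Hw n0 zn). Qed.

Lemma finite_place_diff_le1 p w a b : places_above (Some p) w ->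
  is_torsion a -> is_torsion b -> w (a - b) <= 1.
Proof.
move=> Hw ha hb; have [H _] := Hw; apply: (place_ultrametric Hw).
  by rewrite (place_torsion H).
by rewrite (absN H) (place_torsion H).
Qed.

(** Conjugation inverts roots of unity, so a squared distance is the image of an element of [K], and
    metric conditions become equations in [K]. *)
Lemma complex_place_dist tau w a b :
  (forall z, real_complex R (w z) = `|(tau : {rmorphism K -> complex R}) z|) ->
  is_torsion a -> is_torsion b ->
  real_complex R (w (a - b) ^+ 2) = tau ((a - b) * (a^-1 - b^-1)).
Proof.
move=> wE [n n0 an] [m m0 bm]; rewrite rmorphXn /= wE normCK !rmorphM /=; congr (_ * _).
rewrite !rmorphB /= !fmorphV; congr (_ - _).
  by apply: (root_of_unity_conj n0); rewrite -rmorphXn an rmorph1.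
by apply: (root_of_unity_conj m0); rewrite -rmorphXn bm rmorph1.
Qed.

Lemma complex_place_antipodal tau w a b :
  (forall z, real_complex R (w z) = `|(tau : {rmorphism K -> complex R}) z|) ->
  is_torsion a -> is_torsion b -> w (a - b) = 2 -> b = - a.
Proof.
move=> wE ha hb w2; have := complex_place_dist wE ha hb; rewrite w2.
have -> : real_complex R (2 ^+ 2) = tau 4.
  by rewrite rmorphXn /= !rmorph_nat -natrX.
move=> /fmorph_inj e; have a0 := is_torsion_neq0 ha; have b0 := is_torsion_neq0 hb.
apply/eqP; rewrite -addr_eq0; suff: (b + a) ^+ 2 == 0 by rewrite expf_eq0.
apply/eqP.
(* Clearing denominators gives [-(a - b)^2 = 4 a b], that is [(a + b)^2 = 0]. *)
have : (a - b) * (a^-1 - b^-1) * (a * b) = 4 * (a * b) by rewrite -e.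
have -> : (a - b) * (a^-1 - b^-1) * (a * b) = - (a - b) ^+ 2 by field; rewrite a0 b0.
move=> e2; have -> : (b + a) ^+ 2 = (a - b) ^+ 2 + 4 * (a * b) by ring.
by rewrite -e2 addrN.
Qed.

(* [1], [a], [b] are the vertices of an equilateral triangle inscribed in the
   unit circle. *)
Lemma complex_place_equilateral tau w a b :
  (forall z, real_complex R (w z) = `|(tau : {rmorphism K -> complex R}) z|) ->
  is_torsion a -> is_torsion b -> a != 1 -> a != b ->
  w (a - 1) = w (1 - b) -> w (b - a) = w (1 - b) -> a ^+ 3 = 1 /\ b = a ^+ 2.
Proof.
move=> wE ha hb a1 ab e1 e2.
have h1 : is_torsion (1 : K) by exists 1%N => //; rewrite expr1.
have E1 : (a - 1) * (a^-1 - 1) = (1 - b) * (1 - b^-1).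
  apply: (fmorph_inj tau); rewrite -{2}(invr1 K) -(complex_place_dist wE ha h1) e1.
  by rewrite (complex_place_dist wE h1 hb) invr1.
have E2 : (b - a) * (b^-1 - a^-1) = (1 - b) * (1 - b^-1).
  apply: (fmorph_inj tau); rewrite -(complex_place_dist wE hb ha) e2.
  by rewrite (complex_place_dist wE h1 hb) invr1.
have a0 := is_torsion_neq0 ha; have b0 := is_torsion_neq0 hb.
have a10 : a - 1 != 0 by rewrite subr_eq0.
have ab0 : a - b != 0 by rewrite subr_eq0.
(* Equality of the two sides at the vertex 1 makes [a] and [b] complex conjugate; the third side
   then forces [a ^+ 3 = 1]. *)
have bE : a * b = 1.
  have : (a - b) * (a * b - 1) = 0.
    have : ((a - 1) * (a^-1 - 1) - (1 - b) * (1 - b^-1)) * (a * b) = 0 by rewrite E1 subrr mul0r.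
    have -> : ((a - 1) * (a^-1 - 1) - (1 - b) * (1 - b^-1)) * (a * b) = - ((a - b) * (a * b - 1)).
      by field; rewrite ?a0 ?b0.
    by move/eqP; rewrite oppr_eq0 => /eqP.
  by move/eqP; rewrite mulf_eq0 (negPf ab0) /= subr_eq0 => /eqP.
have bV : b = a^-1 by apply: (mulfI a0); rewrite bE divff.
have a3 : a ^+ 3 = 1.
  have : (a - 1) * (a ^+ 3 - 1) = 0.
    have : ((b - a) * (b^-1 - a^-1) - (a - 1) * (a^-1 - 1)) * a ^+ 2 = 0.
      by rewrite E1 E2 subrr mul0r.
    rewrite bV invrK.
    have -> : ((a^-1 - a) * (a - a^-1) - (a - 1) * (a^-1 - 1)) * a ^+ 2 = - ((a - 1) * (a ^+ 3 - 1)).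
      by field; rewrite ?a0.
    by move/eqP; rewrite oppr_eq0 => /eqP.
  by move/eqP; rewrite mulf_eq0 (negPf a10) /= subr_eq0 => /eqP.
by split=> //; rewrite bV; apply: (mulfI a0); rewrite divff // -exprS.
Qed.

Section DyadicPlace.
Variable w : K -> R.
Let two : {p : nat | prime p} := exist _ 2%N isT.
Hypothesis Hw : places_above (Some two) w.

(** Induction through [z^2]: in [(1 - z)^2 = (1 - z^2) - 2 z (1 - z)] both terms have absolute value
    less than 1, the second because [|2| = 1/2]. *)
Lemma dyadic_2power_lt1 z k : is_torsion z -> z ^+ (2 ^ k) = 1 -> w (1 - z) < 1.
Proof.
have [H _] := Hw; elim: k z => [|k IH] z hz.
  by rewrite expr1 => ->; rewrite subrr (abs0 H).
rewrite expnS exprM => zk.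
have hz2 : is_torsion (z ^+ 2).
  by move: hz => [n n0 zn]; exists n => //; rewrite -exprM mulnC exprM zn expr1n.
have lt := IH _ hz2 zk.
have w2 : w 2 = 2^-1 by rewrite (place_nat _ Hw) /= padic_abs_self.
have h1 : is_torsion (1 : K) by exists 1%N => //; rewrite expr1.
have le1 := finite_place_diff_le1 Hw h1 hz.
set M := Num.max (w (1 - z ^+ 2)) 2^-1.
have M1 : M < 1 by rewrite gt_max lt invf_lt1 // ltr1n.
suff : w ((1 - z) ^+ 2) <= M.
  move=> h; have {h} := le_lt_trans h M1; rewrite (absX H).
  by rewrite expr_lt1 // (abs_ge0 H).
rewrite (_ : (1 - z) ^+ 2 = (1 - z ^+ 2) + - (2 * z * (1 - z))); last by ring.
apply: (place_ultrametric Hw); first by rewrite le_max lexx.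
rewrite (absN H) !(absM H) w2 (place_torsion H hz) mulr1 le_max; apply/orP; right.
by rewrite ler_piMr // invr_ge0.
Qed.

(* For [y] of odd order [m > 1], [1 - y] divides [m]; [z] is reduced to this case
   by taking a [2^k]-th power. *)
Lemma dyadic_unit z : is_torsion z -> (forall k, z ^+ (2 ^ k) <> 1) -> w (1 - z) = 1.
Proof.
have [H _] := Hw; move=> hz nz; have h1 : is_torsion (1 : K) by exists 1%N => //; rewrite expr1.
apply/eqP; rewrite eq_le (finite_place_diff_le1 Hw) //=.
have [n n0 zn] := hz; have [m cm nE] := pfactor_coprime (isT : prime 2) n0.
set k := logn 2 n in nE; pose y := z ^+ (2 ^ k).
have ym : y ^+ m = 1 by rewrite /y -exprM mulnC -nE.
have y1 : y != 1 by apply/eqP; exact: nz.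
have powle1 x j : is_torsion x -> w (\sum_(i < j) x ^+ i) <= 1.
  move=> hx; apply: (place_sum_le Hw) => // i _.
  by rewrite (absX H) (place_torsion H hx) expr1n.
have factor (x : K) j : (1 - x) * \sum_(i < j) x ^+ i = 1 - x ^+ j.
  elim: j => [|j IH]; first by rewrite big_ord0 mulr0 expr0 subrr.
  rewrite big_ord_recr /= mulrDr IH exprS; ring.
have hy : is_torsion y.
  by exists n => //; rewrite /y -exprM mulnC exprM zn expr1n.
apply: (@le_trans _ _ (w (1 - y))); last first.
  by rewrite /y -factor (absM H) ler_piMr ?(abs_ge0 H) ?powle1.
have m0 : (0 < m)%N by move: n0; rewrite nE; case: (m).
have wm : w m%:R = 1.
  rewrite (place_nat _ Hw) /= padic_abs_nat_eq1 //.
  by rewrite -prime_coprime.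
have sum0 : \sum_(j < m) y ^+ j = 0.
  have := factor y m; rewrite ym subrr => /eqP; rewrite mulf_eq0 subr_eq0 eq_sym.
  by rewrite (negPf y1) => /eqP.
have mE : m%:R = (1 - y) * \sum_(j < m) \sum_(i < j) y ^+ i.
  rewrite mulr_sumr (eq_bigr (fun j : 'I_m => 1 - y ^+ j)) => [|j _]; last exact: factor.
  by rewrite sumrB sum0 subr0 sumr_const card_ord.
rewrite -wm {1}mE (absM H) ler_piMr ?(abs_ge0 H) //.
by apply: (place_sum_le Hw) => // j _; exact: powle1.
Qed.

End DyadicPlace.

End RootsOfUnityAtPlaces.

(** * The height of the point *)

Section PointHeight.
Variables (R : realType) (K : fieldExtType rat) (G : generator K).

(** The cases of height 0 reduce to this: coordinates 0, 1, -1 for a degenerate triangle, roots of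
    unity for an equilateral one. *)
Lemma height_unit_coords n (c : K) (y : 'rV[K]_n.+1) : c != 0 -> y != 0 ->
  (forall v (w : K -> R), places_above v w -> coord_max w y = 1) ->
  height R (c *: y) = 0.
Proof.
move=> c0 y0 h.
have l0 v : local_height R v y = 0.
  apply/eqP; rewrite eq_le -(ln1 R); apply/andP; split.
    by apply: (local_height_le G) => // w Hw; rewrite (h v).
  by apply: (local_height_ge G) => // w Hw; rewrite (h v).
have gy : good_coords R y by exists 0%N.
have [B hB] := height_scale G c0 y0 gy.
by rewrite (hB B) //; apply: big1.
Qed.

Definition triangle_point (a b : K) : 'rV[K]_3 :=
  \row_(i < 3) [:: b - a; 1 - b; a - 1]`_i.

Section Triangle.
Variables a b : K.
Hypotheses (ha : is_torsion a) (hb : is_torsion b).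
Hypotheses (a1 : a != 1) (b1 : b != 1) (ab : a != b).
Local Notation y := (triangle_point a b).

Let h1 : is_torsion (1 : K). Proof. by exists 1%N => //; rewrite expr1. Qed.

Lemma triangle_coord i : exists u v : K,
  [/\ y 0 i = u - v, is_torsion u, is_torsion v & u != v].
Proof.
case: i => -[|[|[|//]]] hi; rewrite mxE /=.
- by exists b, a; rewrite eq_sym.
- by exists 1, b; rewrite eq_sym.
- by exists a, 1.
Qed.

Lemma triangle_neq0 i : y 0 i != 0.
Proof. by have [u [v [-> _ _ uv]]] := triangle_coord i; rewrite subr_eq0. Qed.

Lemma triangle_point_neq0 : y != 0.
Proof. by apply/rV0Pn; exists 0; exact: triangle_neq0. Qed.

Lemma triangle_complex_le2 (w : K -> R) : places_above None w -> coord_max w y <= 2.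
Proof.
move=> [H _]; apply: coord_max_le => // i.
have [u [v [-> hu hv _]]] := triangle_coord i; apply: (le_trans (absB H _ _)).
by rewrite !(place_torsion H).
Qed.

Lemma triangle_finite_le1 p (w : K -> R) : places_above (Some p) w -> coord_max w y <= 1.
Proof.
move=> Hw; apply: coord_max_le => // i.
by have [u [v [-> hu hv _]]] := triangle_coord i; exact: (finite_place_diff_le1 Hw).
Qed.

Lemma triangle_good : good_coords R y.
Proof.
apply: (integral_good G) => [|p w Hw i]; first exact: triangle_point_neq0.
exact: le_trans (coord_max_ge _ _ _) (triangle_finite_le1 Hw).
Qed.

Lemma triangle_local_le v : local_height R v y <= if v is None then ln 2 else 0.
Proof.
have y0 := triangle_point_neq0; case: v => [p|].
  by rewrite -(ln1 R); apply: (local_height_le G) => // w; exact: triangle_finite_le1.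
by apply: (local_height_le G) => // w; exact: triangle_complex_le2.
Qed.

Variable c : K.
Hypothesis c0 : c != 0.
Local Notation h := (height R (c *: y)).

Lemma triangle_height_le : h <= ln 2.
Proof.
have [B hB] := height_scale G c0 triangle_point_neq0 triangle_good.
rewrite (hB B) // /places_lt big_cons -[leRHS]addr0; apply: lerD.
  exact: triangle_local_le.
by rewrite big_map; apply: sumr_le0 => p _; exact: triangle_local_le.
Qed.

(* Normalizing one coordinate to 1 makes every local height nonnegative. *)
Lemma triangle_unit_coord i : exists B0, forall B, (B0 <= B)%N ->
  h = \sum_(v <- places_lt B) local_height R v ((y 0 i)^-1 *: y).
Proof.
have yi : (y 0 i)^-1 != 0 by rewrite invr_neq0 // triangle_neq0.
have z0 : (y 0 i)^-1 *: y != 0.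
  by rewrite scaler_eq0 negb_or yi triangle_point_neq0.
have gz := good_coordsZ G yi triangle_point_neq0 triangle_good.
have c0' : c * y 0 i != 0 by rewrite mulf_neq0 ?triangle_neq0.
have [B hB] := height_scale G c0' z0 gz.
by exists B => b' /hB <-; rewrite scalerA mulfK // triangle_neq0.
Qed.

Lemma triangle_unit_ge1 i v (w : K -> R) : places_above v w ->
  1 <= coord_max w ((y 0 i)^-1 *: y).
Proof.
move=> [H _]; apply: le_trans (coord_max_ge _ _ i).
by rewrite mxE mulVf ?triangle_neq0 // (abs1 H).
Qed.

Lemma triangle_unit_neq0 i : (y 0 i)^-1 *: y != 0.
Proof. by rewrite scaler_eq0 invr_eq0 negb_or triangle_neq0 triangle_point_neq0. Qed.

Lemma triangle_height_ge0 : 0 <= h.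
Proof.
have [B hB] := triangle_unit_coord 0; rewrite (hB B) //; apply: sumr_ge0 => v _.
rewrite -(ln1 R); apply: (local_height_ge G) => //; first exact: triangle_unit_neq0.
by move=> w Hw; exact: triangle_unit_ge1 Hw.
Qed.

(** After division by the [i]-th coordinate all local heights are nonnegative; a larger [j]-th
    coordinate at one Archimedean place would make their sum positive. *)
Lemma triangle_height0_coords (w : K -> R) i j : places_above None w ->
  h = 0 -> w (y 0 j) <= w (y 0 i).
Proof.
move=> Hw h0; have [H _] := Hw; rewrite leNgt; apply/negP => lt.
have [B hB] := triangle_unit_coord i; have := hB B (leqnn _); rewrite h0.
rewrite /places_lt big_cons => e; have : 0 < local_height R None ((y 0 i)^-1 *: y).
  rewrite -(ln1 R); apply: (local_height_gt G _ _ Hw) => //; first exact: triangle_unit_neq0.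
    by move=> w' Hw'; exact: triangle_unit_ge1 Hw'.
  apply: lt_le_trans (coord_max_ge _ _ j); rewrite mxE (absM H) (absV H).
  by rewrite mulrC ltr_pdivlMr ?mul1r // (abs_gt0 H) triangle_neq0.
apply/negP; rewrite -leNgt.
suff : 0 <= \sum_(p <- map Some (finite_places_lt B)) local_height R p ((y 0 i)^-1 *: y) by lra.
apply: sumr_ge0 => v _; rewrite -(ln1 R); apply: (local_height_ge G) => //.
  exact: triangle_unit_neq0.
by move=> w' Hw'; exact: triangle_unit_ge1 Hw'.
Qed.

Lemma triangle_height_eq0 : h = 0 <-> a ^+ 3 = 1 /\ b = a ^+ 2.
Proof.
have a10 : a - 1 != 0 by rewrite subr_eq0.
split=> [h0|[a3 bE]].
  have [tau [w [Hw wE]]] := complex_place R G.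
  have eqw i j : w (y 0 i) = w (y 0 j).
    by apply/eqP; rewrite eq_le !(triangle_height0_coords _ _ Hw h0).
  have c01 := eqw 0 1; have c21 := eqw (inord 2) 1.
  rewrite !mxE /= in c01; rewrite !mxE /= inordK // in c21.
  exact: (complex_place_equilateral wE ha hb a1 ab c21 c01).
(* For a primitive cube root of unity [a], the coordinates are [a - 1] times roots of unity. *)
pose z : 'rV[K]_3 := \row_(i < 3) [:: a; a ^+ 2; 1]`_i.
have a2 : a ^+ 2 = - a - 1.
  have : (a - 1) * (a ^+ 2 + a + 1) = 0.
    have -> : (a - 1) * (a ^+ 2 + a + 1) = a ^+ 3 - 1 by ring.
    by rewrite a3 subrr.
  by move/eqP; rewrite mulf_eq0 (negPf a10) /= -addrA addr_eq0 opprD => /eqP.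
have yE : y = (a - 1) *: z.
  apply/rowP => -[[|[|[|//]]] hi]; rewrite !mxE /= ?bE.
  - by ring.
  - have -> : (a - 1) * a ^+ 2 = a ^+ 3 - a ^+ 2 by ring.
    by rewrite a3.
  - by rewrite mulr1.
rewrite yE scalerA; apply: height_unit_coords; first by rewrite mulf_neq0.
  by apply/rV0Pn; exists 0; rewrite mxE /= (is_torsion_neq0 ha).
move=> v w [H _]; have zi i : w (z 0 i) = 1.
  case: i => -[|[|[|//]]] hi; rewrite mxE /= ?(absX H) ?(abs1 H) ?(place_torsion H ha) //.
  by rewrite expr1n.
apply/eqP; rewrite eq_le; apply/andP; split.
  by apply: coord_max_le => // i; rewrite zi.
by rewrite -(zi 0) coord_max_ge.
Qed.

Definition antipodal_pair (z : K) := (forall k, z ^+ (2 ^ k) <> 1) /\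
  [\/ a = -1 /\ b = z, a = z /\ b = -1 | a = z /\ b = - z].

Let two : {p : nat | prime p} := exist _ 2%N isT.

Lemma triangle_height_eq_ln2 : h = ln 2 <-> exists z, antipodal_pair z.
Proof.
have [B0 hB] := height_scale G c0 triangle_point_neq0 triangle_good.
have y0 := triangle_point_neq0.
(* The 3 ensures that the prime 2 occurs in the sum. *)
pose B := maxn B0 3; have {}hB := hB B (leq_maxl _ _).
have split_h : h = local_height R None y + \sum_(p <- finite_places_lt B) local_height R (Some p) y.
  by rewrite hB /places_lt big_cons big_map.
have lN := triangle_local_le None; have lp p := triangle_local_le (Some p).
have twoB : two \in finite_places_lt B by rewrite mem_finite_places_lt leq_max orbT.
have uB : uniq (finite_places_lt B) by rewrite pmap_sub_uniq // iota_uniq.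
split=> [h2|[z [nz zE]]].
  have [tau [w [Hw wE]]] := complex_place R G; have [H _] := Hw.
  have l2 : local_height R (Some two) y = 0.
    apply/eqP; rewrite eq_le lp /=.
    have := h2; rewrite split_h (bigD1_seq two) //= => e.
    have : \sum_(i <- finite_places_lt B | i != two) local_height R (Some i) y <= 0.
      by apply: sumr_le0 => p _; exact: lp.
    by move: lN => /=; lra.
  have lN2 : local_height R None y = ln 2.
    apply/eqP; rewrite eq_le lN /=; have := h2; rewrite split_h => e.
    have : \sum_(i <- finite_places_lt B) local_height R (Some i) y <= 0.
      by apply: sumr_le0 => p _; exact: lp.
    lra.
  have max2 : coord_max w y = 2.
    apply/eqP; rewrite eq_le triangle_complex_le2 //= leNgt; apply/negP => lt.
    have := local_height_lt G y0 Hw (fun w Hw => triangle_complex_le2 Hw) lt.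
    by rewrite lN2 ltxx.
  (* A place above 2 exists: the norm estimate at any nonzero element, here 1, produces one. *)
  have [u Hu _] : exists2 u : K -> R, places_above (Some two) u &
      rat_abs R (Some two) (field_norm G 1) <= u 1 ^+ (gen_deg G).+1.
    exact: (exists_place_norm_le G (rat_abs_absolute_value R (Some two)) (oner_neq0 K)).
  have [Hu1 _] := Hu.
  have u2 : u 2 < 1 by rewrite (place_nat _ Hu) /= padic_abs_self // invf_lt1 // ltr1n.
  (* If the order of [z] were a power of 2, then [2], [1 - z] and [1 + z] would all be small at [u],
     against the vanishing [l2] of the local height at 2. [1 + z] is treated as [1 - (- z)], with
     exponent [k.+1] so that the sign disappears even for [k = 0]. *)
  have npow z : is_torsion z -> (forall i, u (y 0 i) <= Num.max (u 2) (Num.max (u (1 - z)) (u (1 + z)))) ->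
      forall k, z ^+ (2 ^ k) <> 1.
    move=> hz hi k zk.
    have lt1 : u (1 - z) < 1 := dyadic_2power_lt1 Hu hz zk.
    have lt2 : u (1 + z) < 1.
      have := @dyadic_2power_lt1 R K u Hu (- z) k.+1 (is_torsionN hz).
      rewrite opprK; apply; rewrite expnS exprM sqrrN -exprM mulnC exprM zk expr1n //.
    set M := Num.max (u 2) _ in hi.
    have M1 : M < 1 by rewrite !gt_max u2 lt1 lt2.
    have cM : coord_max u y < 1.
      have [i ->] := coord_max_eq Hu1 y; exact: le_lt_trans (hi i) M1.
    have := local_height_lt G y0 Hu (fun w Hw => triangle_finite_le1 Hw) cM.
    by rewrite l2 ln1 ltxx.
  have uN := absN Hu1.
  have [i ci] := coord_max_eq H y; rewrite max2 in ci; move: ci.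
  case: i => -[|[|[|//]]] hi; rewrite mxE /= => /esym ci.
  - have aE := complex_place_antipodal wE hb ha ci.
    have bE : b = - a by rewrite aE opprK.
    exists a; split; last by apply: Or33.
    apply: npow => // -[[|[|[|//]]] hj]; rewrite mxE /= ?bE !le_max.
    + have -> : - a - a = - (2 * a) by ring.
      by rewrite uN (absM Hu1) (place_torsion Hu1 ha) mulr1 lexx.
    + by rewrite opprK lexx !orbT.
    + by rewrite -opprB uN lexx !orbT.
  - have bE := complex_place_antipodal wE h1 hb ci.
    exists a; split; last by apply: Or32.
    apply: npow => // -[[|[|[|//]]] hj]; rewrite mxE /= ?bE !le_max.
    + by rewrite -opprD uN lexx !orbT.
    + by rewrite opprK lexx.
    + by rewrite -opprB uN lexx !orbT.
  - have aE : a = -1 by rewrite (complex_place_antipodal wE ha h1 ci) opprK.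
    exists b; split; last by apply: Or31.
    apply: npow => // -[[|[|[|//]]] hj]; rewrite mxE /= ?aE !le_max.
    + by rewrite opprK addrC lexx !orbT.
    + by rewrite lexx !orbT.
    + by rewrite -opprD uN lexx.
have hz : is_torsion z.
  by case: zE => -[aE bE]; rewrite -?aE -?bE //; move: ha; rewrite aE.
(* The coordinate of absolute value [w 2] attains the bound at infinity and at the odd primes, the
   one with [w (1 - z)] at the prime 2. *)
have coords : exists i j, [/\ forall w : K -> R, is_absolute_value w -> w (y 0 i) = w 2
    & forall w : K -> R, is_absolute_value w -> w (y 0 j) = w (1 - z)].
  case: zE => -[aE bE].
  - exists (inord 2), 1; split=> w Hw; rewrite !mxE /= ?inordK // ?aE ?bE //.
    by rewrite /= -opprD (absN Hw).
  - exists 1, (inord 2); split=> w Hw; rewrite !mxE /= ?inordK //= ?aE ?bE ?opprK //.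
    by rewrite -opprB (absN Hw).
  - exists 0, (inord 2); split=> w Hw; rewrite !mxE /= ?inordK //= ?aE ?bE.
      have -> : - z - z = - (2 * z) by ring.
      by rewrite (absN Hw) (absM Hw) (place_torsion Hw hz) mulr1.
    by rewrite -opprB (absN Hw).
have [i [j [yi yj]]] := coords.
have max2 (w : K -> R) : places_above None w -> 2 <= coord_max w y.
  move=> Hw; apply: le_trans (coord_max_ge _ _ i); rewrite yi; last by case: Hw.
  by rewrite (place_nat _ Hw) /= rmorph_nat ger0_norm.
have hN : local_height R None y = ln 2.
  by apply/eqP; rewrite eq_le lN /=; apply: (local_height_ge G).
have hp p : local_height R (Some p) y = 0.
  apply/eqP; rewrite eq_le lp /= -(ln1 R); apply: (local_height_ge G) => // w Hw.
  have [H _] := Hw; case: p Hw {lp} => p pp Hw.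
  have [p2|p2] := eqVneq p 2%N.
    have Hw2 : places_above (Some two) w.
      by move: Hw; rewrite (_ : exist _ p pp = two) //; apply: val_inj.
    by apply: le_trans (coord_max_ge _ _ j); rewrite yj // (dyadic_unit Hw2).
  apply: le_trans (coord_max_ge _ _ i); rewrite yi // (place_nat _ Hw) /=.
  rewrite padic_abs_nat_eq1 //; apply: contra p2 => /(dvdn_leq (isT : (0 < 2)%N)).
  by have := prime_gt1 pp; case: p {pp Hw} => [|[|[|]]].
by rewrite split_h hN big1 ?addr0 // => p _; exact: hp.
Qed.

End Triangle.
End PointHeight.

(** * Transfer between [K] and [algC], and the degenerate cases *)

Lemma mu_inftyV (z : algC) : mu_infty z -> mu_infty z^-1.
Proof. by move=> [n n0 zn]; exists n => //; rewrite exprVn zn invr1. Qed.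

Lemma mu_infty_neq0 (z : algC) : mu_infty z -> z != 0.
Proof.
by move=> [n n0]; apply: contra_eq_neq => ->; rewrite expr0n eqn0Ngt n0 eq_sym oner_eq0.
Qed.

Lemma order_not_2power (z : algC) : mu_infty z ->
  (forall n k : nat, n.-primitive_root z -> n <> (2 ^ k)%N) <->
  (forall k, z ^+ (2 ^ k) <> 1).
Proof.
move=> [m m0 zm]; split=> [h k zk|h n k pn nk]; last first.
  by apply: (h k); rewrite -nk; exact: prim_expr_order.
have k0 : (0 < 2 ^ k)%N by rewrite expn_gt0.
have [n pn dn] := prim_order_exists k0 zk.
by have /(dvdn_pfactor _ _ (isT : prime 2))[j _ nj] := dn; exact: (h n j pn nj).
Qed.

Lemma primitive_root3 (z : algC) : z ^+ 3 = 1 -> z != 1 -> 3.-primitive_root z.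
Proof.
move=> z3 z1; have [n pn dn] := prim_order_exists (isT : (0 < 3)%N) z3.
have [_ /(_ n dn)/orP[/eqP n1|/eqP <- //]] := primeP (isT : prime 3).
by move: z1; have := prim_expr_order pn; rewrite n1 expr1 => ->; rewrite eqxx.
Qed.

Section ProjectivePoint.
Variable omega : algC * algC.
Hypotheses (t1 : mu_infty omega.1) (t2 : mu_infty omega.2) (nt : omega <> (1, 1)).
Let a := omega.1^-1.
Let b := omega.2^-1.

Let omegaE : omega = (a^-1, b^-1).
Proof. by rewrite /a /b !invrK; case: (omega). Qed.

Lemma inv_nontrivial : (a != 1) || (b != 1).
Proof.
rewrite -negb_and; apply/negP => /andP[/eqP a1 /eqP b1]; apply: nt.
by rewrite omegaE a1 b1 invr1.
Qed.

Lemma P_point_neq0 : P_point omega != 0.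
Proof.
case/orP: inv_nontrivial => h; apply/rV0Pn.
  by exists (inord 2); rewrite mxE /= inordK //= subr_eq0.
by exists 1; rewrite mxE /= subr_eq0 eq_sym.
Qed.

Lemma P_point_on_lines : on_lines omega (P_point omega).
Proof. by split; rewrite !mxE /= -/a -/b; ring. Qed.

Lemma P_point_unique (x : 'rV[algC]_3) : x != 0 -> on_lines omega x ->
  proj_eq (P_point omega) x.
Proof.
move=> x0 [e1 e2]; rewrite -/a -/b in e1 e2.
have x00 : x 0 0 = - (x 0 1 + x 0 2) by apply/eqP; rewrite -addr_eq0 addrA e1.
have e3 : (a - 1) * x 0 1 = (1 - b) * x 0 2.
  apply/eqP; rewrite -subr_eq0; apply/eqP; rewrite -[RHS]e2 x00; ring.
suff [c xc] : exists c, x = c *: P_point omega.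
  by exists c => //; apply: contraNneq x0 => c0; rewrite xc c0 scale0r.
case/orP: inv_nontrivial => h.
  have h' : a - 1 != 0 by rewrite subr_eq0.
  have x1 : x 0 1 = (1 - b) * x 0 2 / (a - 1) by rewrite -e3 mulrAC divff // mul1r.
  exists (x 0 2 / (a - 1)); apply/rowP => -[[|[|[|//]]] hi]; rewrite !mxE /= -/a -/b.
  - rewrite (_ : Ordinal hi = 0) ?x00 ?x1; [|exact: val_inj]; by field; rewrite h'.
  - rewrite (_ : Ordinal hi = 1) ?x1; [|exact: val_inj]; by field; rewrite h'.
  - rewrite (_ : Ordinal hi = 2); [|exact: val_inj]; by field; rewrite h'.
have h' : 1 - b != 0 by rewrite subr_eq0 eq_sym.
have x2 : x 0 2 = (a - 1) * x 0 1 / (1 - b) by rewrite e3 mulrAC divff // mul1r.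
exists (x 0 1 / (1 - b)); apply/rowP => -[[|[|[|//]]] hi]; rewrite !mxE /= -/a -/b.
- rewrite (_ : Ordinal hi = 0) ?x00 ?x2; [|exact: val_inj]; by field; rewrite h'.
- rewrite (_ : Ordinal hi = 1); [|exact: val_inj]; by field; rewrite h'.
- rewrite (_ : Ordinal hi = 2) ?x2; [|exact: val_inj]; by field; rewrite h'.
Qed.

Variables (R : realType) (K : fieldExtType rat) (iota : {rmorphism K -> algC}) (x : 'rV[K]_3).
Hypothesis xP : proj_eq (P_point omega) (map_mx iota x).

(** The scalar relating [x] and [y] lies a priori in [algC]; as a quotient of coordinates it comes
    from [K]. *)
Lemma descend_scalar (y : 'rV[K]_3) (d : algC) : y != 0 -> d != 0 ->
  P_point omega = d *: map_mx iota y -> exists2 c, c != 0 & x = c *: y.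
Proof.
move=> y0 d0 Py; have [c c0 xE] := xP; rewrite Py scalerA in xE.
have /rV0Pn[j yj] := y0.
have e : iota (x 0 j / y 0 j) = c * d.
  have := congr1 (fun A : 'rV_3 => A 0 j) xE; rewrite !mxE fmorph_div => ->.
  by rewrite mulfK // fmorph_eq0.
exists (x 0 j / y 0 j).
  by rewrite -(fmorph_eq0 iota) e mulf_neq0.
by apply: (map_mx_inj (f := iota)); rewrite map_mxZ e.
Qed.

(** The exponents [k = 0] and [k = 1] exclude [z = 1] and [z = -1]; so no degenerate point belongs
    to [upper_set]. *)
Lemma upper_set_nondegenerate : upper_set omega -> [/\ a != 1, b != 1 & a != b].
Proof.
move=> [z [mz hz] oE]; have {}hz := (order_not_2power mz).1 hz.
have z1 : z != 1 by apply/eqP => e; apply: (hz 0%N); rewrite e expr1n.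
have zN1 : z != -1 by apply/eqP => e; apply: (hz 1%N); rewrite e sqrrN expr1n.
have z0 := mu_infty_neq0 mz.
have m1 : (-1 : algC) != 1.
  by rewrite eq_sym -subr_eq0 opprK -mulr2n pnatr_eq0.
have inv1 (y : algC) : (y^-1 == 1) = (y == 1) by rewrite -[X in _ == X]invr1 (inj_eq invr_inj).
have zNz : z != - z by rewrite -subr_eq0 opprK -mulr2n mulrn_eq0.
rewrite /a /b !inv1 (inj_eq invr_inj).
have Nz1 : - z != 1 by rewrite eqr_oppLR.
by case: oE => -> /=; split; rewrite // eq_sym.
Qed.

(** If two of [1], [a], [b] coincide, the point is [[1 : -1 : 0]] up to order and sign, whatever the
    remaining value, so [a] and [b] need not lie in [K]. *)
Lemma height_degenerate : ~~ [&& a != 1, b != 1 & a != b] ->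
  lower_set omega /\ height R x = 0.
Proof.
move=> deg.
have low : lower_set omega.
  left.
  have inv1 (y : algC) : y^-1 = 1 -> y = 1 by move=> /(congr1 GRing.inv); rewrite invrK invr1.
  move: deg; rewrite !negb_and !negbK => /or3P[/eqP e|/eqP e|/eqP e].
  - have o1 := inv1 _ e; exists omega.2; first split=> // o2.
      by apply: nt; rewrite [omega]surjective_pairing o1 o2.
    by apply: Or31; rewrite [LHS]surjective_pairing o1.
  - have o2 := inv1 _ e; exists omega.1; first split=> // o1.
      by apply: nt; rewrite [omega]surjective_pairing o1 o2.
    by apply: Or32; rewrite [LHS]surjective_pairing o2.
  - have o2 := invr_inj e; exists omega.1; first split=> // o1.
      by apply: nt; rewrite [omega]surjective_pairing -o2 o1.
    by apply: Or33; rewrite [LHS]surjective_pairing -o2.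
split=> //; have [G] := generator_exists K.
suff [y [d [y0 d0 Py y1]]] : exists (y : 'rV[K]_3) (d : algC), [/\ y != 0, d != 0,
    P_point omega = d *: map_mx iota y &
    forall w : K -> R, is_absolute_value w -> coord_max w y = 1].
  have [c c0 ->] := descend_scalar y0 d0 Py.
  by apply: (height_unit_coords G) => // v w [Hw _]; exact: y1.
have max1 (y : 'rV[K]_3) i : (forall i, y 0 i \in [:: 0; 1; -1]) -> y 0 i = 1 ->
    forall w : K -> R, is_absolute_value w -> coord_max w y = 1.
  move=> yin yi w Hw; apply/eqP; rewrite eq_le; apply/andP; split.
    apply: coord_max_le => // j; have := yin j; rewrite !inE => /or3P[] /eqP ->.
    - by rewrite (abs0 Hw).
    - by rewrite (abs1 Hw).
    - by rewrite (absN Hw) (abs1 Hw).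
  by rewrite -(abs1 Hw) -yi coord_max_ge.
have nz (y : 'rV[K]_3) i : y 0 i = 1 -> y != 0.
  by move=> yi; apply/rV0Pn; exists i; rewrite yi oner_eq0.
pose tri (u v s : K) : 'rV[K]_3 := \row_(i < 3) [:: u; v; s]`_i.
case: (eqVneq a 1) deg => [a1 _|a1].
  have b1 : b != 1 by have := inv_nontrivial; rewrite a1 eqxx.
  have y1 : tri 1 (-1) 0 0 0 = 1 by rewrite mxE.
  exists (tri 1 (-1) 0), (b - 1); split; [exact: nz y1 | by rewrite subr_eq0 | |].
    apply/rowP => -[[|[|[|//]]] hi]; rewrite !mxE /= -/a -/b ?a1.
    - by rewrite rmorph1 mulr1.
    - by rewrite rmorphN rmorph1 mulrN1 opprB.
    - by rewrite rmorph0 mulr0 subrr.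
  by apply: (max1 _ 0) => // -[[|[|[|//]]] hi]; rewrite mxE /= !inE eqxx ?orbT.
case: (eqVneq b 1) => [b1 _|b1 /negbNE/eqP ab].
  have y1 : tri 1 0 (-1) 0 0 = 1 by rewrite mxE.
  exists (tri 1 0 (-1)), (1 - a); split; [exact: nz y1 | by rewrite subr_eq0 eq_sym | |].
    apply/rowP => -[[|[|[|//]]] hi]; rewrite !mxE /= -/a -/b ?b1.
    - by rewrite rmorph1 mulr1.
    - by rewrite rmorph0 mulr0 subrr.
    - by rewrite rmorphN rmorph1 mulrN1 opprB.
  by apply: (max1 _ 0) => // -[[|[|[|//]]] hi]; rewrite mxE /= !inE eqxx ?orbT.
have y1 : tri 0 1 (-1) 0 1 = 1 by rewrite mxE.
exists (tri 0 1 (-1)), (1 - b); split; [exact: nz y1 | by rewrite subr_eq0 eq_sym | |].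
  apply/rowP => -[[|[|[|//]]] hi]; rewrite !mxE /= -/a -/b ?ab.
  - by rewrite rmorph0 mulr0 subrr.
  - by rewrite rmorph1 mulr1.
  - by rewrite rmorphN rmorph1 mulrN1 opprB.
by apply: (max1 _ 1) => // -[[|[|[|//]]] hi]; rewrite mxE /= !inE eqxx ?orbT.
Qed.

Lemma torsion_coords_mem : a != 1 -> b != 1 -> a != b ->
  exists s t : K, iota s = a /\ iota t = b.
Proof.
move=> a1 b1 ab; have [c c0 xE] := xP.
apply: (@cyclotomic_ratio_mem K iota a b (x 0 1 / x 0 2)) => //; try exact: mu_inftyV.
have e1 := congr1 (fun A : 'rV_3 => A 0 1) xE.
have e2 := congr1 (fun A : 'rV_3 => A 0 2) xE.
rewrite !mxE /= -/a -/b in e1 e2.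
rewrite fmorph_div e1 e2 invfM mulrACA divff // mul1r //.
Qed.

Lemma height_nondegenerate : a != 1 -> b != 1 -> a != b ->
  [/\ 0 <= height R x <= ln 2,
      height R x = 0 <-> lower_set omega
    & height R x = ln 2 <-> upper_set omega].
Proof.
move=> a1 b1 ab; have [s [t [sa tb]]] := torsion_coords_mem a1 b1 ab.
have [G] := generator_exists K.
have tor z (y : K) : mu_infty z -> iota y = z -> is_torsion y.
  by move=> [n n0 zn] yz; exists n => //; apply: (fmorph_inj iota); rewrite rmorphXn yz zn rmorph1.
have hs : is_torsion s := tor _ _ (mu_inftyV t1) sa.
have ht : is_torsion t := tor _ _ (mu_inftyV t2) tb.
have s1 : s != 1 by rewrite -(inj_eq (fmorph_inj iota)) sa rmorph1.
have t1' : t != 1 by rewrite -(inj_eq (fmorph_inj iota)) tb rmorph1.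
have st : s != t by rewrite -(inj_eq (fmorph_inj iota)) sa tb.
have y0 := triangle_point_neq0 hs ht s1 t1' st.
have Py : P_point omega = 1 *: map_mx iota (triangle_point s t).
  rewrite scale1r; apply/rowP => -[[|[|[|//]]] hi]; rewrite !mxE /= -/a -/b;
  by rewrite rmorphB ?rmorph1 ?sa ?tb.
have [c c0 ->] := descend_scalar y0 (oner_neq0 _) Py.
have o1 : omega.1 = a^-1 by rewrite /a invrK.
have o2 : omega.2 = b^-1 by rewrite /b invrK.
split.
- by rewrite (triangle_height_ge0 R G hs ht s1 t1' st c0) (triangle_height_le R G hs ht s1 t1' st c0).
- rewrite (triangle_height_eq0 R G hs ht s1 t1' st c0); split=> [[s3 te]|].
    have z3 : omega.1 ^+ 3 = 1 by rewrite o1 exprVn -sa -rmorphXn s3 rmorph1 invr1.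
    have be : b = a ^+ 2 by rewrite -tb te rmorphXn sa.
    right; exists omega.1.
      by apply: primitive_root3 => //; rewrite o1 -[X in _ != X]invr1 (inj_eq invr_inj).
    have o2' : omega.2 = omega.1 ^+ 2 by rewrite o2 be o1; exact: esym (exprVn _ _).
    by rewrite -o2' -surjective_pairing.
  case=> [[z _]|[z pz oE]].
    (* The first three families of [lower_set] have two of [1], [a], [b] equal and are excluded
       here; only the primitive cube roots remain. *)
    have ho : omega.1 = 1 \/ omega.2 = 1 \/ omega.1 = omega.2 -> s ^+ 3 = 1 /\ t = s ^+ 2.
      rewrite o1 o2 => -[e|[e|/invr_inj e]]; exfalso.
      - by move/eqP: a1; apply; apply: invr_inj; rewrite e invr1.
      - by move/eqP: b1; apply; apply: invr_inj; rewrite e invr1.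
      - by move/eqP: ab; apply.
    by case=> oE; apply: ho; rewrite oE /=; [left|right; left|right; right].
  have az : a = z^-1 by rewrite /a oE.
  have bz : b = (z ^+ 2)^-1 by rewrite /b oE.
  split; apply: (fmorph_inj iota); rewrite rmorphXn sa az.
    by rewrite exprVn (prim_expr_order pz) invr1 rmorph1.
  by rewrite tb bz exprVn.
- rewrite (triangle_height_eq_ln2 R G hs ht s1 t1' st c0).
  (* The triangle is built on the inverses of the coordinates of [omega]; inversion does not affect
     which powers equal 1. *)
  have pow (y : K) (z : algC) : iota y = z^-1 ->
      (forall k, y ^+ (2 ^ k) <> 1) <-> (forall k, z ^+ (2 ^ k) <> 1).
    move=> yz; have e k : (y ^+ (2 ^ k) = 1) <-> (z ^+ (2 ^ k) = 1).
      split=> h.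
        have := congr1 iota h; rewrite rmorphXn rmorph1 yz exprVn => /(congr1 GRing.inv).
        by rewrite invrK invr1.
      by apply: (fmorph_inj iota); rewrite rmorphXn rmorph1 yz exprVn h invr1.
    by split=> h k /e; exact: h.
  split.
    move=> [z [nz zE]]; have : exists2 o : algC, o = omega.1 \/ o = omega.2 &
        iota z = o^-1 /\ [\/ omega = (-1, o), omega = (o, -1) | omega = (o, - o)].
      case: zE => -[sE tE].
      - exists omega.2; first by right.
        split; first by rewrite -tE tb.
        by apply: Or31; rewrite [LHS]surjective_pairing o1 -sa sE rmorphN rmorph1 invrN1.
      - exists omega.1; first by left.
        split; first by rewrite -sE sa.
        by apply: Or32; rewrite [LHS]surjective_pairing o2 -tb tE rmorphN rmorph1 invrN1.
      - exists omega.1; first by left.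
        split; first by rewrite -sE sa.
        apply: Or33; rewrite [LHS]surjective_pairing o2 -tb tE -sE rmorphN sa invrN.
        by rewrite o1.
    move=> [u uo [zu oE]].
    have mu : mu_infty u by case: uo => ->.
    by exists u => //; split=> //; apply/(order_not_2power mu); apply/(pow z).
  move=> [z [mz hz] oE]; have {}hz := (order_not_2power mz).1 hz.
  case: oE => oE.
  - exists t; split; first by apply/(pow t z) => //; rewrite tb /b oE.
    by apply: Or31; split=> //; apply: (fmorph_inj iota); rewrite sa /a oE /= invrN1 rmorphN rmorph1.
  - exists s; split; first by apply/(pow s z) => //; rewrite sa /a oE.
    by apply: Or32; split=> //; apply: (fmorph_inj iota); rewrite tb /b oE /= invrN1 rmorphN rmorph1.
  - exists s; split; first by apply/(pow s z) => //; rewrite sa /a oE.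
    by apply: Or33; split=> //; apply: (fmorph_inj iota); rewrite rmorphN tb sa /a /b oE /= invrN.
Qed.

End ProjectivePoint.

Theorem proposition2p2 (R : realType) (omega : algC * algC)
  (torsion1 : mu_infty omega.1) (torsion2 : mu_infty omega.2)
  (nontrivial : omega <> (1, 1)) :
  (* P(omega) is a point, the unique one on the two lines *)
  [/\ P_point omega != 0,
      on_lines omega (P_point omega)
    & forall x : 'rV[algC]_3, x != 0 -> on_lines omega x ->
        proj_eq (P_point omega) x]
  /\
  (* its height, from any homogeneous coordinates x in any number field K *)
  (forall (K : fieldExtType rat) (iota : {rmorphism K -> algC})
     (x : 'rV[K]_3), proj_eq (P_point omega) (map_mx iota x) ->
     [/\ 0 <= height R x <= ln 2,
         height R x = 0 <-> lower_set omega
       & height R x = ln 2 <-> upper_set omega]).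
Proof.
split.
  split; [exact: P_point_neq0 | exact: P_point_on_lines | exact: P_point_unique].
move=> K iota x xP.
have l2 : 0 < ln (2 : R) by apply: ln_gt0; rewrite ltr1n.
have [/and3P[a1 b1 ab]|deg] := boolP [&& omega.1^-1 != 1, omega.2^-1 != 1 & omega.1^-1 != omega.2^-1].
  exact: (height_nondegenerate torsion1 torsion2 R xP a1 b1 ab).
have [low h0] := height_degenerate torsion1 torsion2 nontrivial R xP deg.
rewrite h0; split=> //; first by rewrite lexx ltW.
split=> [e|/upper_set_nondegenerate[a1 b1 ab]]; first by move: l2; rewrite -e ltxx.
by move: deg; rewrite a1 b1 ab.
Qed.
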